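(* Let $X$ be a bounded geometry, uniformly discrete metric space with property A. Then the canonical quotient maps $\lambda:C^*_{u,max}(X)\to C^*_u(X)$ and $\lambda:C^*_{max}(X)\to C^*(X)$ are isomorphisms.
   Context: Let $(X,d)$ be a metric space. $X$ is uniformly discrete if there is $\delta>0$ with $d(x,y)\ge\delta$ for all $x\ne y$ in $X$. $X$ has bounded geometry if for every $r>0$ there is $N_r\in\mathbb{N}$ with $|\{y\in X: d(x,y)<r\}|\le N_r$ for all $x\in X$. An $X$-by-$X$ matrix $T=(T(x,y))_{x,y\in X}$ with entries in some algebra has finite propagation if there is $S>0$ with $T(x,y)=0$ whenever $d(x,y)\ge S$. The algebraic uniform Roe algebra $\mathbb{C}_u[X]$ is the $*$-algebra (usual matrix operations) of $X$-by-$X$ complex matrices of finite propagation with uniformly bounded entries. Fix a separable infinite-dimensional Hilbert space $\mathcal{H}$ with compact operators $\mathcal{K}=\mathcal{K}(\mathcal{H})$. The algebraic Roe algebra $\mathbb{C}[X,\mathcal{K}]$ is the $*$-algebra of $X$-by-$X$ matrices of finite propagation with uniformly bounded (in norm) entries from $\mathcal{K}$. The uniform Roe algebra $C^*_u(X)$ is the norm completion of $\mathbb{C}_u[X]$ in its natural representation on $\ell^2(X)$ by matrix multiplication. The Roe algebra $C^*(X)$ is the norm completion of $\mathbb{C}[X,\mathcal{K}]$ in its natural representation on $\ell^2(X,\mathcal{H})$. The maximal uniform Roe algebra $C^*_{u,max}(X)$ (respectively the maximal Roe algebra $C^*_{max}(X)$) is the completion of $\mathbb{C}_u[X]$ (respectively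 $\mathbb{C}[X,\mathcal{K}]$) in the norm $\|T\|=\sup\|\pi(T)\|$, the supremum being over all $*$-representations $\pi$ of the $*$-algebra by bounded operators on Hilbert spaces (this is finite by bounded geometry). The maps $\lambda$ are the canonical quotient maps extending the identity on $\mathbb{C}_u[X]$, respectively $\mathbb{C}[X,\mathcal{K}]$. $X$ has property A if for any $R,\epsilon>0$ there exist a map $\xi:X\to\ell^2(X)$, $x\mapsto\xi_x$, and $S>0$ such that: for all $x,y\in X$, $\xi_x(y)\in[0,1]$; for all $x\in X$, $\|\xi_x\|_2=1$; for all $x\in X$, $\xi_x$ is supported in the open ball $B(x,S)$; and if $d(x,y)\le R$ then $|1-\langle\xi_x,\xi_y\rangle|<\epsilon$. *)

(* Defs.v *)
From HB Require Import structures.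
From mathcomp Require Import all_boot all_order all_algebra sesquilinear.
From mathcomp Require Export complex.
From mathcomp Require Import all_classical all_reals all_analysis.

Set Implicit Arguments.
Unset Strict Implicit.
Unset Printing Implicit Defensive.

Import Order.TTheory GRing.Theory Num.Theory.
Import numFieldNormedType.Exports.

Local Open Scope classical_set_scope.
Local Open Scope ring_scope.
Local Open Scope card_scope.

(* The norm of a complex normed module takes its values in R[i] (they are
   nonnegative reals there); [rnorm v] is the same number, as an element of R. *)
Definition rnorm (R : realType) (V : normedModType R[i]) (v : V) : R :=
  complex.Re `|v|.

(* Inner products are linear in the first variable. *)
HB.mixin Record CompleteNormedModule_isHilbert (R : realType) (V : Type)
    & CompleteNormedModule R[i] V := {
  hdot : {dot V for Num.conj} ;
  hdot_normE : forall v : V, hdot v v = `|v| ^+ 2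
}.

#[short(type="hilbertType")]
HB.structure Definition Hilbert (R : realType) :=
  { V of CompleteNormedModule R[i] V & CompleteNormedModule_isHilbert R V }.

(* Not necessarily unital. *)
HB.mixin Record CompleteNormedModule_isCStar (R : realType) (A : Type)
    & CompleteNormedModule R[i] A := {
  cmul : A -> A -> A ;
  cstar : A -> A ;
  cmulA : associative cmul ;
  cmulDl : left_distributive cmul +%R ;
  cmulDr : right_distributive cmul +%R ;
  cmulZl : forall (a : R[i]) (x y : A), cmul (a *: x) y = a *: cmul x y ;
  cmulZr : forall (a : R[i]) (x y : A), cmul x (a *: y) = a *: cmul x y ;
  cstarD : forall x y : A, cstar (x + y) = cstar x + cstar y ;
  cstarZ : forall (a : R[i]) (x : A), cstar (a *: x) = Num.conj a *: cstar x ;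
  cstarK : involutive cstar ;
  cstarM : forall x y : A, cstar (cmul x y) = cmul (cstar y) (cstar x) ;
  ler_normcM : forall x y : A, `|cmul x y| <= `|x| * `|y| ;
  normc_star : forall x : A, `|cmul (cstar x) x| = `|x| ^+ 2
}.

#[short(type="cstarAlgType")]
HB.structure Definition CStarAlgebra (R : realType) :=
  { A of CompleteNormedModule R[i] A & CompleteNormedModule_isCStar R A }.

Section Metric.
Variables (R : realType) (X : metricType R).

Definition uniformly_discrete :=
  exists2 delta : R, 0 < delta & forall x y : X, x != y -> delta <= mdist x y.

Definition bounded_geometry :=
  forall r : R, 0 < r ->
  exists N : nat, forall x : X, [set y : X | mdist x y < r] #<= `I_N.

Definition l2norm (f : X -> R) : \bar R :=
  ((\esum_(x in setT) (f x ^+ 2)%:E) `^ 2^-1)%E.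

(* Inner product of nonnegative real l2 functions, the only case needed:
   esum is meant for families of nonnegative terms. *)
Definition l2dot (f g : X -> R) : R :=
  fine (\esum_(x in setT) (f x * g x)%:E).

Definition propertyA :=
  forall r e : R, 0 < r -> 0 < e ->
  exists (xi : X -> X -> R) (S : R),
    [/\ 0 < S,
        forall x y, 0 <= xi x y <= 1,
        forall x, l2norm (xi x) = 1%E,
        forall x y, xi x y != 0 -> mdist x y < S
      & forall x y, mdist x y <= r -> `|1 - l2dot (xi x) (xi y)| < e].

End Metric.

Section Operators.
Variable R : realType.

Definition opnorm (V W : normedModType R[i]) (f : V -> W) : \bar R :=
  ereal_sup [set (rnorm (f v))%:E | v in [set v : V | rnorm v <= 1]].

Definition bounded_operator (V W : normedModType R[i]) (f : V -> W) :=
  linear f /\ (opnorm f < +oo)%E.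

Definition compact_operator (V W : normedModType R[i]) (f : V -> W) :=
  linear f /\ compact (closure (f @` [set v : V | rnorm v <= 1])).

(* The adjoint exists, and is unique, for every bounded operator. *)
Definition adjoint (H : hilbertType R) (f : H -> H) : H -> H :=
  xget (fun=> 0) [set g | forall u v, hdot (f u) v = hdot u (g v)].

Definition separable (H : normedModType R[i]) :=
  exists2 D : set H, countable D & dense D.

Definition infinite_dimensional (H : lmodType R[i]) :=
  forall (n : nat) (e : 'I_n -> H),
  exists v : H, forall c : 'I_n -> R[i], v <> \sum_(i < n) c i *: e i.

End Operators.

(* A *-algebra of matrices, given as the set [sa_elem] of its elements in an
   ambient vector space [sa_space] of all matrices; the operations are only
   meaningful on [sa_elem]. *)
Record starAlg (R : realType) := StarAlg {
  sa_space :> lmodType R[i] ;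
  sa_elem : set sa_space ;
  sa_mul : sa_space -> sa_space -> sa_space ;
  sa_star : sa_space -> sa_space
}.

Section Matrices.
Variables (R : realType) (X : metricType R).

Definition finite_propagation (E : zmodType) (T : X -> X -> E) :=
  exists2 S : R, 0 < S & forall x y, S <= mdist x y -> T x y = 0.

(* These sums have finitely many nonzero terms when the matrices have finite
   propagation and X has bounded geometry. *)
Definition matrix_mul (E : zmodType) (mul : E -> E -> E) (T S : X -> X -> E) :
    X -> X -> E :=
  fun x y => \sum_(z \in [set: X]) mul (T x z) (S z y).

Definition matrix_star (E : Type) (star : E -> E) (T : X -> X -> E) :
    X -> X -> E :=
  fun x y => star (T y x).

Definition matrix_act (E : Type) (V : zmodType) (act : E -> V -> V)
    (T : X -> X -> E) (xi : X -> V) : X -> V :=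
  fun x => \sum_(y \in [set: X]) act (T x y) (xi y).

Definition l2opnorm (V : normedModType R[i]) (f : (X -> V) -> (X -> V)) :
    \bar R :=
  ereal_sup [set l2norm (fun x => rnorm (f xi x))
            | xi in [set xi : X -> V | (l2norm (fun x => rnorm (xi x)) <= 1)%E]].

Definition uniform_roe_alg : starAlg R :=
  @StarAlg R (X -> X -> R[i]^o)
    [set T | finite_propagation T /\
             exists M : R, forall x y, rnorm (T x y) <= M]
    (matrix_mul (fun a b : R[i]^o => a * b))
    (matrix_star (fun a : R[i]^o => Num.conj a)).

Definition uniform_roe_norm (T : uniform_roe_alg) : \bar R :=
  l2opnorm (matrix_act (fun a b : R[i]^o => a * b) T).

Variable H : hilbertType R.

Definition roe_alg : starAlg R :=
  @StarAlg R (X -> X -> H -> H)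
    [set T | [/\ finite_propagation T,
                 forall x y, compact_operator (T x y)
               & exists M : R, forall x y, (opnorm (T x y) <= M%:E)%E]]
    (matrix_mul (fun f g : H -> H => f \o g))
    (matrix_star (@adjoint R H)).

Definition roe_norm (T : roe_alg) : \bar R :=
  l2opnorm (matrix_act (fun (f : H -> H) v => f v) T).

End Matrices.

Section Completions.
Variable R : realType.

Definition star_representation (A : starAlg R) (V : hilbertType R)
    (pi : A -> V -> V) :=
  [/\ forall T, sa_elem T -> bounded_operator (pi T),
      forall (a : R[i]) T S, sa_elem T -> sa_elem S ->
        pi (a *: T + S) = a *: pi T + pi S,
      forall T S, sa_elem T -> sa_elem S -> pi (sa_mul T S) = pi T \o pi S
    & forall T, sa_elem T ->
        forall u v, hdot (pi T u) v = hdot u (pi (sa_star T) v)].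

Definition max_norm (A : starAlg R) (T : A) : \bar R :=
  ereal_sup [set r | exists (V : hilbertType R) (pi : A -> V -> V),
                       star_representation pi /\ r = opnorm (pi T)].

(* (B, j) is the completion of the *-algebra A for the C*-norm N; this
   determines (B, j restricted to A) up to a unique *-isomorphism. *)
Definition cstar_completion (A : starAlg R) (N : A -> \bar R)
    (B : cstarAlgType R) (j : A -> B) :=
  [/\ forall (a : R[i]) T S, sa_elem T -> sa_elem S ->
        j (a *: T + S) = a *: j T + j S,
      forall T S, sa_elem T -> sa_elem S -> j (sa_mul T S) = cmul (j T) (j S),
      forall T, sa_elem T -> j (sa_star T) = cstar (j T),
      forall T, sa_elem T -> (rnorm (j T))%:E = N T
    & dense (j @` sa_elem (s := A))].

Definition star_homomorphism (B B' : cstarAlgType R) (f : B -> B') :=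
  [/\ linear f,
      forall x y, f (cmul x y) = cmul (f x) (f y)
    & forall x, f (cstar x) = cstar (f x)].

Definition star_isomorphism (B B' : cstarAlgType R) (f : B -> B') :=
  star_homomorphism f /\ bijective f.

Definition canonical_map (A : starAlg R) (B B' : cstarAlgType R)
    (j : A -> B) (j' : A -> B') (f : B -> B') :=
  [/\ star_homomorphism f,
      continuous f
    & forall T, sa_elem T -> f (j T) = j' T].

End Completions.

(* Main.v *)
(** It suffices to show that the maximal and the reduced norm agree on the matrix
    algebra: both completions are then the same by extension of an isometry.  The
    reduced norm is that of a representation on l2(X, V), hence at most the maximal
    one.  Conversely let [pi] be any *-representation and [T] a matrix of reduced norm
    [N T].

    - For a self-adjoint diagonal matrix [a] of norm less than [1] there is a
      self-adjoint [b] with [2 b - b^2 = a], so [|u|^2 - <pi(a) u, u> = |u - pi(b) u|^2]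
      is nonnegative: [pi] is contractive on diagonal matrices.  A colouring splits a
      matrix of propagation at most [S] into boundedly many partial translations, whence
      [|pi(T)| <= K_S sup |T(x, y)|].
    - On block diagonal matrices with blocks of bounded diameter the powers of [T^* T]
      keep their propagation, so [|pi(T)|^(2^n) <= K (N T)^(2^n)] for all [n] and thus
      [|pi(T)| <= N T].
    - Property A provides kernels [k] of finite propagation, close to [1] near the
      diagonal, for which the Schur product [k T] is a finite sum of [D_i T_i D_i] with
      [T_i] a block diagonal compression of [T], [D_i] diagonal and [sum_i D_i^2 = 1];
      hence [|pi(k T)| <= N T].  By the first point [|pi(T - k T)|] is small. *)

From HB Require Import structures.
Require Import Defs.
From mathcomp Require Import all_boot all_order all_algebra sesquilinear.
From mathcomp Require Import all_classical all_reals all_analysis.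
From mathcomp Require Import finmap ring lra.

Set Implicit Arguments.
Unset Strict Implicit.
Unset Printing Implicit Defensive.

Import Order.TTheory GRing.Theory Num.Theory.
Import numFieldNormedType.Exports.

Local Open Scope classical_set_scope.
Local Open Scope ring_scope.

(** * Norms and inner products *)

(** Both algebras are treated at once, as matrices whose entries act on a Hilbert space [V], the
    complex line in the uniform case and [H] in the other. That compact operators have no unit
    shapes two steps. The element [b] with [2 b - b^2 = a] stands for [1 - sqrt (1 - a)]: it belongs
    to the algebra although [1] and [sqrt (1 - a)] need not. Likewise the diagonals [D_i] have
    scalar entries and need not be matrices of the algebra, so [pi] cannot be applied to them; the
    decomposition of [k T] is used only after multiplication by a matrix [B] on the right, and the
    choice [B = (k T)^*] then gives the bound on [k T] itself.

    The reduced norm is read off its completion, as the norm of [j T]: its finiteness and the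
    identity [N (T^* T) = (N T)^2] come from the C*-algebra. The regular representation on l2(X, V)
    is needed only for the easy inequality, but it requires building that Hilbert space. *)

Lemma natSinv_small (R : realType) (e : R) : 0 < e ->
  exists N, forall n, (N <= n)%N -> n.+1%:R^-1 < e.
Proof.
move=> e0; have [N _ NP] := near_infty_natSinv_lt (PosNum e0).
by exists N => n Nn; exact: NP.
Qed.

Section RealNorm.
Variable R : realType.
Implicit Types V : normedModType R[i].

Lemma rnormE V (v : V) : `|v| = (rnorm v)%:C%C.
Proof. by rewrite /rnorm RRe_real// ger0_real. Qed.

Lemma rnorm_ge0 V (v : V) : 0 <= rnorm v.
Proof. by rewrite -ler0c -rnormE normr_ge0. Qed.

Lemma rnorm0 V : rnorm (0 : V) = 0.
Proof. by rewrite /rnorm normr0. Qed.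

Lemma rnorm_eq0 V (v : V) : (rnorm v == 0) = (v == 0).
Proof.
by rewrite -[RHS]normr_eq0 rnormE -[0 in RHS](rmorph0 (real_complex R)) (inj_eq (@complexI
    R)).
Qed.

Lemma rnorm_le0 V (v : V) : rnorm v <= 0 -> v = 0.
Proof. by move=> v0; apply/eqP; rewrite -rnorm_eq0 eq_le v0 rnorm_ge0. Qed.

Lemma rnormN V (v : V) : rnorm (- v) = rnorm v.
Proof. by rewrite /rnorm normrN. Qed.

Lemma rnormBC V (u v : V) : rnorm (u - v) = rnorm (v - u).
Proof. by rewrite /rnorm distrC. Qed.

Lemma rnormD V (u v : V) : rnorm (u + v) <= rnorm u + rnorm v.
Proof. by rewrite -lecR rmorphD/= -!rnormE ler_normD. Qed.

Lemma rnormZ V (a : R[i]) (v : V) : rnorm (a *: v) = rnorm (a : R[i]^o) * rnorm v.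
Proof. by apply: (@complexI R); rewrite rmorphM/= -!rnormE normrZ. Qed.

Lemma rnormZr V (a : R) (v : V) : rnorm (a%:C%C *: v) = `|a| * rnorm v.
Proof.
rewrite rnormZ; congr (_ * _); rewrite /rnorm normc_def/= expr0n/= addr0.
by rewrite sqrtr_sqr.
Qed.

Lemma rnorm_sum V (I : Type) (r : seq I) (P : pred I) (F : I -> V) :
  rnorm (\sum_(i <- r | P i) F i) <= \sum_(i <- r | P i) rnorm (F i).
Proof.
elim/big_ind2 : _ => //; first by rewrite rnorm0.
by move=> u a v b ua vb; rewrite (le_trans (rnormD _ _))// lerD.
Qed.

Lemma Re_le_rnorm (a : R[i]^o) : complex.Re a <= rnorm a.
Proof.
rewrite (le_trans (ler_norm _))// -lecR -rnormE.
exact: normc_ge_Re.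
Qed.

(** Convergence with real radii; the balls of the topology of [V] have radii in [R[i]]. *)
Definition rcvg V (u : nat -> V) (l : V) := forall e : R, 0 < e ->
  exists N, forall n, (N <= n)%N -> rnorm (u n - l) < e.

Lemma rcauchy_cvg (V : completeNormedModType R[i]) (u : nat -> V) :
  (forall e : R, 0 < e -> exists N, forall m n, (N <= m)%N -> (N <= n)%N ->
    rnorm (u m - u n) < e) ->
  exists l, rcvg u l.
Proof.
move=> uC.
have /cauchy_cvg/cvg_ex[/= l ul] : cauchy (u @ \oo).
  apply: cauchy_exP => e e0.
  have /complex_realP[d de] : e \is Num.real by rewrite gtr0_real.
  move: e0; rewrite de (ltcR 0) => d0.
  have [N NP] := uC _ d0.
  exists (u N), N => // n /= Nn; rewrite -ball_normE/=.
  by rewrite rnormE ltcR; exact: NP.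
exists l => e e0.
have /cvgrPdist_lt/(_ e%:C%C) := ul.
rewrite (ltcR 0) => /(_ e0)[N _ NP]; exists N => n Nn.
by move: (NP n Nn); rewrite rnormE ltcR rnormBC.
Qed.

Lemma rnorm_lim_le V (u : nat -> V) (l v : V) (c : R) :
  rcvg u l -> (exists N, forall n, (N <= n)%N -> rnorm (u n - v) <= c) ->
  rnorm (l - v) <= c.
Proof.
move=> ul [M uc]; apply/ler_addgt0Pl => e e0.
have [N /(_ (maxn M N) (leq_maxr _ _)) NP] := ul _ e0.
have -> : l - v = (l - u (maxn M N)) + (u (maxn M N) - v) by rewrite addrA subrK.
by rewrite (le_trans (rnormD _ _))// lerD ?uc ?leq_maxl//  rnormBC ltW.
Qed.

Lemma rcvg_le V (u : nat -> V) (l : V) (c : R) :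
  rcvg u l -> (forall n, rnorm (u n) <= c) -> rnorm l <= c.
Proof.
move=> ul uc; rewrite -[l]subr0; apply: rnorm_lim_le ul _.
by exists 0%N => n _; rewrite subr0.
Qed.

End RealNorm.

Section HilbertBasics.
Variables (R : realType) (V : hilbertType R).
Implicit Types u v w : V.

Local Notation "<[ u , v ]>" := (hdot u v) (format "<[ u ,  v ]>").

Lemma hdotDl u v w : <[u + v, w]> = <[u, w]> + <[v, w]>.
Proof. exact: linearDl. Qed.
Lemma hdotDr u v w : <[w, u + v]> = <[w, u]> + <[w, v]>.
Proof. exact: linearDr. Qed.
Lemma hdotBl u v w : <[u - v, w]> = <[u, w]> - <[v, w]>.
Proof. exact: linearBl. Qed.
Lemma hdotBr u v w : <[w, u - v]> = <[w, u]> - <[w, v]>.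
Proof. exact: linearBr. Qed.
Lemma hdotZl (a : R[i]) u v : <[a *: u, v]> = a * <[u, v]>.
Proof. exact: linearZl_LR. Qed.
Lemma hdotZr (a : R[i]) u v : <[u, a *: v]> = a^* * <[u, v]>.
Proof. exact: linearZr_LR. Qed.
Lemma hdotNr u v : <[u, - v]> = - <[u, v]>. Proof. exact: linearNr. Qed.
Lemma hdot0l u : <[0, u]> = 0. Proof. exact: linear0l. Qed.
Lemma hdot0r u : <[u, 0]> = 0. Proof. exact: linear0r. Qed.
Lemma hdotC u v : <[u, v]> = <[v, u]>^*.
Proof. by rewrite (hermC hdot) expr0 mul1r. Qed.
Lemma hdot_suml (I : Type) (r : seq I) (P : pred I) (F : I -> V) v :
  <[\sum_(i <- r | P i) F i, v]> = \sum_(i <- r | P i) <[F i, v]>.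
Proof.
by elim/big_ind2 : _ => [|x a y b <- <-|//]; rewrite ?hdot0l// hdotDl.
Qed.
Lemma hdot_sumr (I : Type) (r : seq I) (P : pred I) (F : I -> V) v :
  <[v, \sum_(i <- r | P i) F i]> = \sum_(i <- r | P i) <[v, F i]>.
Proof.
by elim/big_ind2 : _ => [|x a y b <- <-|//]; rewrite ?hdot0r// hdotDr.
Qed.

Lemma hdotvv v : <[v, v]> = (rnorm v ^+ 2)%:C%C.
Proof. by rewrite hdot_normE rnormE rmorphXn. Qed.

Lemma ReM_conj (a : R[i]) : complex.Re a^* = complex.Re a.
Proof. by case: a. Qed.

Lemma Re_hdotC u v : complex.Re <[u, v]> = complex.Re <[v, u]>.
Proof. by rewrite hdotC ReM_conj. Qed.

Lemma rnormD_sqr u v :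
  rnorm (u + v) ^+ 2 = rnorm u ^+ 2 + rnorm v ^+ 2 + 2 * complex.Re <[u, v]>.
Proof.
have H w : rnorm w ^+ 2 = complex.Re <[w, w]> by rewrite hdotvv.
rewrite !H hdotDl !hdotDr !raddfD/= [complex.Re <[v, u]>]Re_hdotC; ring.
Qed.

Lemma rnormB_sqr u v :
  rnorm (u - v) ^+ 2 = rnorm u ^+ 2 + rnorm v ^+ 2 - 2 * complex.Re <[u, v]>.
Proof. by rewrite rnormD_sqr rnormN hdotNr raddfN/= mulrN. Qed.

Lemma parallelogram u v :
  rnorm (u + v) ^+ 2 + rnorm (u - v) ^+ 2 = 2 * (rnorm u ^+ 2 + rnorm v ^+ 2).
Proof. rewrite rnormD_sqr rnormB_sqr; ring. Qed.

(** Cauchy-Schwarz, from expanding the square norm of [|v| u - |u| v]. *)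
Lemma Re_hdot_le u v : complex.Re <[u, v]> <= rnorm u * rnorm v.
Proof.
have := rnorm_ge0 u; rewrite le_eqVlt => /predU1P[/esym/eqP|u0].
  by rewrite rnorm_eq0 => /eqP ->; rewrite hdot0l/= rnorm0 mul0r.
have := rnorm_ge0 v; rewrite le_eqVlt => /predU1P[/esym/eqP|v0].
  by rewrite rnorm_eq0 => /eqP ->; rewrite hdot0r/= rnorm0 mulr0.
have := sqr_ge0 (rnorm ((rnorm v)%:C%C *: u - (rnorm u)%:C%C *: v)).
rewrite rnormB_sqr !rnormZr !ger0_norm ?rnorm_ge0// hdotZl hdotZr.
rewrite (_ : complex.Re _ = rnorm u * rnorm v * complex.Re <[u, v]>); last first.
  by case: <[u, v]> => a b /=; ring.
set a := rnorm u in u0 *; set b := rnorm v in v0 *; set c := complex.Re _.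
have -> : (b * a)^+2 + (a * b)^+2 - 2 * (a * b * c) = 2 * (a * b) * (a * b - c) by ring.
by rewrite pmulr_rge0 ?subr_ge0// !mulr_gt0.
Qed.

Lemma rnorm_hdot u v : rnorm (<[u, v]> : R[i]^o) <= rnorm u * rnorm v.
Proof.
set z := <[u, v]>.
have [->|z0] := eqVneq z 0; first by rewrite rnorm0 mulr_ge0 ?rnorm_ge0.
(* A phase of modulus one: replacing [u] by [w *: u] makes the inner product equal to its modulus,
   so the bound on real parts suffices. *)
pose w : R[i] := z^* / `|z|.
have nz : `|z| != 0 by rewrite normr_eq0.
have wz : w * z = `|z|.
  by rewrite /w mulrAC [z^* * z]mulrC -normCK expr2 mulfK.
have nw : rnorm (w : R[i]^o) = 1.
  apply: (@complexI R); rewrite -rnormE /w normrM norm_conjC normfV normr_id.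
  by rewrite divff.
have := Re_hdot_le (w *: u) v; rewrite hdotZl -/z wz rnormZ nw mul1r.
done.
Qed.

Lemma hdot_rnorm_le (u : V) (c : R) : 0 <= c ->
  (forall v, rnorm (<[u, v]> : R[i]^o) <= c * rnorm v) -> rnorm u <= c.
Proof.
move=> c0 /(_ u); rewrite hdotvv -[X in rnorm X]mulr1 -[X in rnorm X]/(_ *: (1 : R[i]^o)).
rewrite rnormZr ger0_norm ?sqr_ge0// /rnorm normr1/= mulr1 -/(rnorm u) expr2.
have := rnorm_ge0 u; rewrite le_eqVlt => /predU1P[<-//|u0].
by rewrite ler_pM2r.
Qed.

Lemma hdot_inj u v : (forall w, <[u, w]> = <[v, w]>) -> u = v.
Proof.
move=> uv; apply/eqP; rewrite -subr_eq0 -(dnorm_eq0 hdot).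
by rewrite hdotBl uv subrr.
Qed.

Lemma hdot_injr u v : (forall w, <[w, u]> = <[w, v]>) -> u = v.
Proof. by move=> uv; apply: hdot_inj => w; rewrite hdotC uv -hdotC. Qed.

Lemma rnorm_sqr_Re v : rnorm v ^+ 2 = complex.Re <[v, v]>.
Proof. by rewrite hdotvv. Qed.

End HilbertBasics.

(** * Compact operators and the Riesz representation theorem *)

Section LinearMaps.
Variables (R : realType) (V W : normedModType R[i]).
Implicit Types f : V -> W.

Lemma linfunD f : linear f -> forall u v, f (u + v) = f u + f v.
Proof. by move=> fl u v; rewrite -[u]scale1r fl !scale1r. Qed.

Lemma linfun0 f : linear f -> f 0 = 0.
Proof. by move=> fl; have := linfunD fl 0 0; rewrite addr0 -{1}[f 0]addr0 => /addrI. Qed.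

Lemma linfunZ f : linear f -> forall a u, f (a *: u) = a *: f u.
Proof. by move=> fl a u; have := fl a u 0; rewrite (linfun0 fl) !addr0. Qed.

Lemma linfunN f : linear f -> forall u, f (- u) = - f u.
Proof. by move=> fl u; rewrite -scaleN1r (linfunZ fl) scaleN1r. Qed.

Lemma linfunB f : linear f -> forall u v, f (u - v) = f u - f v.
Proof. by move=> fl u v; rewrite linfunD// linfunN. Qed.

Lemma linfun_sum f (I : Type) (r : seq I) (P : pred I) (F : I -> V) : linear f ->
  f (\sum_(i <- r | P i) F i) = \sum_(i <- r | P i) f (F i).
Proof.
move=> fl; elim/big_ind2 : _ => [|x a y b <- <-|//]; first exact: linfun0.
by rewrite (linfunD fl).
Qed.

Definition bounded_by f (c : R) := forall v, rnorm (f v) <= c * rnorm v.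

Lemma bounded_by_ball f c : linear f ->
  (forall v, rnorm v <= 1 -> rnorm (f v) <= c) -> bounded_by f c.
Proof.
move=> fl fc v.
have := rnorm_ge0 v; rewrite le_eqVlt => /predU1P[/esym/eqP|v0].
  by rewrite rnorm_eq0 => /eqP ->; rewrite (linfun0 fl) !rnorm0 mulr0.
have := fc (((rnorm v)^-1)%:C%C *: v).
rewrite (linfunZ fl) !rnormZr ger0_norm ?invr_ge0 ?rnorm_ge0//.
rewrite mulVf ?gt_eqF// => /(_ (lexx _)).
by rewrite ler_pdivrMl// mulrC.
Qed.

Lemma opnorm_leP f c : linear f -> 0 <= c ->
  (opnorm f <= c%:E)%E <-> bounded_by f c.
Proof.
move=> fl c0; split=> [fc|fc].
  apply: bounded_by_ball => // v v1; rewrite -lee_fin (le_trans _ fc)//.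
  by apply: ereal_sup_ubound; exists v.
apply: ge_ereal_sup => _ [v /= v1 <-]; rewrite lee_fin (le_trans (fc v))//.
by rewrite -[leRHS]mulr1 ler_wpM2l.
Qed.

Lemma bounded_operatorP f :
  bounded_operator f <-> linear f /\ exists2 c, 0 <= c & bounded_by f c.
Proof.
split=> [[fl foo]|[fl [c c0 fc]]]; split=> //.
  have o0 : (0 <= opnorm f)%E.
    apply: ereal_sup_ubound; exists 0; rewrite /= ?rnorm0//.
    by rewrite (linfun0 fl) rnorm0.
  exists (fine (opnorm f)); first exact: fine_ge0.
  apply/opnorm_leP => //; first exact: fine_ge0.
  by rewrite fineK// ge0_fin_numE.
by rewrite (@le_lt_trans _ _ c%:E)// ?ltry//; apply/opnorm_leP.
Qed.

(** The image of the unit ball has finite nets. For a linear map into a complete space this is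
    compactness, and in this form it passes to sums, compositions, limits and adjoints by
    manipulating the nets. *)
Definition totally_bounded_map f := forall e : R, 0 < e -> exists s : seq W,
  forall v, rnorm v <= 1 -> exists2 w, w \in s & rnorm (f v - w) < e.

Lemma totally_bounded_map_bounded f : linear f -> totally_bounded_map f ->
  exists2 c, 0 <= c & bounded_by f c.
Proof.
move=> fl /(_ 1 ltr01)[s sP].
exists (1 + \sum_(w <- s) rnorm w).
  by rewrite addr_ge0// sumr_ge0// => w _; exact: rnorm_ge0.
apply: bounded_by_ball => // v /sP[w ws vw].
rewrite -[f v](subrK w) (le_trans (rnormD _ _))// lerD ?(ltW vw)//.
rewrite (big_rem w)//= lerDl sumr_ge0// => z _; exact: rnorm_ge0.
Qed.

Lemma totally_bounded_map_lim f :
  (forall e : R, 0 < e -> exists2 g, totally_bounded_map g &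
     forall v, rnorm v <= 1 -> rnorm (f v - g v) < e) ->
  totally_bounded_map f.
Proof.
move=> fP e e0; have e2 : 0 < e / 2 by rewrite divr_gt0.
have [g gt fg] := fP _ e2; have [s sP] := gt _ e2.
exists s => v v1; have [w ws gw] := sP _ v1; exists w => //.
have -> : f v - w = (f v - g v) + (g v - w) by rewrite addrA subrK.
rewrite (le_lt_trans (rnormD _ _))// [ltRHS]splitr ltrD//; exact: fg.
Qed.

Lemma totally_bounded_map_lin (a : R[i]) f g :
  totally_bounded_map f -> totally_bounded_map g ->
  totally_bounded_map (fun v => a *: f v + g v).
Proof.
move=> ft gt e e0; have e2 : 0 < e / 2 by rewrite divr_gt0.
pose k := rnorm (a : R[i]^o) + 1.
have k0 : 0 < k by rewrite ltr_wpDl// rnorm_ge0.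
have [s sP] := ft (e / 2 / k) (divr_gt0 e2 k0).
have [t tP] := gt _ e2.
exists [seq a *: x + y | x <- s, y <- t] => v v1.
have [x xs fx] := sP _ v1; have [y yt gy] := tP _ v1.
exists (a *: x + y); first by apply: allpairs_f.
rewrite opprD addrACA -scalerBr (le_lt_trans (rnormD _ _))// [ltRHS]splitr.
rewrite ltr_leD ?ltW// rnormZ (@le_lt_trans _ _ (k * rnorm (f v - x)))//.
  by rewrite ler_wpM2r ?rnorm_ge0// /k lerDl.
by rewrite mulrC -ltr_pdivlMr.
Qed.

End LinearMaps.

(** A net comes from a finite subcover by balls. Conversely, an ultrafilter on the closure must
    contain one of the finitely many balls around a net, at every radius; it is therefore Cauchy and
    converges. *)
Lemma compact_operatorP (R : realType) (V : normedModType R[i])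
    (W : completeNormedModType R[i]) (f : V -> W) :
  compact_operator f <-> linear f /\ totally_bounded_map f.
Proof.
split=> [[fl fc]|[fl ft]]; split=> //.
  move=> e e0; move: fc; rewrite compact_cover => /(_ W setT (fun w => ball w e%:C%C)).
  have ec0 : 0 < e%:C%C :> R[i] by rewrite (ltcR 0).
  case.
  - by move=> w _; exact: ball_open.
  - by move=> w _; exists w => //; exact: ballxx.
  move=> D _ Df; exists (finmap.enum_fset D) => v v1.
  have [|w wD] := Df (f v); first by apply: subset_closure; exists v.
  rewrite -ball_normE/= rnormE ltcR rnormBC => fw.
  by exists w.
rewrite compact_ultra => F FU FA.
have FF : ProperFilter F by exact: ultra_proper.
have /cauchy_cvg/cvg_ex[p Fp] : cauchy F; last first.
  exists p; split=> //; apply: closed_closure => B pB.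
  exact: (@filter_ex _ F FF _ (filterI FA (Fp _ pB))).
apply: cauchy_exP => e e0.
have /complex_realP[d de] : e \is Num.real by rewrite gtr0_real.
move: e0; rewrite de (ltcR 0) => d0.
have d2 : 0 < d / 2 by rewrite divr_gt0.
have [s sP] := ft _ d2.
apply: contrapT => /forallNP nF.
have : F (\bigcap_(w in [set` [fset w in s]%fset]) ~` ball w d%:C%C).
  apply: filter_bigI => w _.
  by have [Fb|//] := in_ultra_setVsetC (ball w d%:C%C) FU; exfalso; exact: (nF w).
move=> Fs; have [x [xA xs]] : closure (f @` [set v : V | rnorm v <= 1]) `&`
  \bigcap_(w in [set` [fset w in s]%fset]) ~` ball w d%:C%C !=set0.
  exact: (@filter_ex _ F FF _ (filterI FA Fs)).
(* The net covers the image only, not its closure; this is why it was taken at [d / 2], the other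
   half leading from [x] to a point of the image. *)
have xd : nbhs x (ball x (d / 2)%:C%C) by apply: nbhsx_ballx; rewrite (ltcR 0).
have [_ [[v v1 <-] xv]] := xA _ xd.
have [w ws fw] := sP v v1.
apply: (xs w); first by rewrite /= inE.
apply: ball_sym; rewrite [d]splitr rmorphD; apply: ball_triangle xv _.
by rewrite -ball_normE/= rnormE ltcR.
Qed.

Section Riesz.
Variables (R : realType) (V : hilbertType R).
Local Notation "<[ u , v ]>" := (hdot u v) (format "<[ u ,  v ]>").

(** The vector is the limit of a minimising sequence of [g v = |v|^2 - 2 Re (f v)], a function which
    is [|v - u|^2 - |u|^2] if [u] represents [f]. *)
Lemma Riesz_representation (f : V -> R[i]^o) (c : R) :
  linear f -> 0 <= c -> bounded_by f c -> exists u, forall v, f v = <[v, u]>.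
Proof.
move=> fl c0 fc.
pose g v := rnorm v ^+ 2 - 2 * complex.Re (f v).
have gc v : - c ^+ 2 <= g v.
  have := Re_le_rnorm (f v); have := fc v; rewrite /g.
  set n := rnorm v; have := rnorm_ge0 v; rewrite -/n => n0 h1 h2.
  have := sqr_ge0 (n - c); nra.
pose E := range g.
have Einf : has_inf E.
  split; first by exists (g 0); exists 0.
  by exists (- c ^+ 2) => _ [v _ <-].
pose m := inf E.
have mg v : m <= g v by apply: ge_inf; [case: Einf|exists v].
have /choice[v vP] : forall n : nat, exists v, g v < m + n.+1%:R^-1.
  move=> n; have [//|_ [v _ <-] h] := @inf_adherent _ E n.+1%:R^-1 _ Einf.
  by exists v.
(* The parallelogram law, with [g] at the midpoint of [a] and [b] bounded below by [m]: nearly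
   minimising vectors are close to each other. *)
have gab a b : rnorm (a - b) ^+ 2 <= 2 * (g a + g b - 2 * m).
  have := mg (2^-1%:C%C *: (a + b)); rewrite /g.
  rewrite rnormZr ger0_norm ?invr_ge0// (linfunZ fl) (linfunD fl).
  have -> : complex.Re ((2^-1)%:C%C *: (f a + f b)) =
            2^-1 * (complex.Re (f a) + complex.Re (f b)).
    by case: (f a) (f b) => [x y] [z t] /=; rewrite mul0r subr0.
  rewrite exprMn; have := parallelogram a b; nra.
have [|u vu] := @rcauchy_cvg _ V v.
  move=> e e0; have [N NP] := natSinv_small (e := e ^+ 2 / 4) ltac:(by rewrite divr_gt0
      ?exprn_gt0).
  exists N => n k Nn Nk; rewrite -(@ltr_pXn2r _ 2)// ?nnegrE ?rnorm_ge0 ?ltW//.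
  rewrite (le_lt_trans (gab _ _))//.
  have := vP n; have := vP k; have := NP _ Nn; have := NP _ Nk.
  by move: (n.+1%:R^-1) (k.+1%:R^-1) (e ^+ 2) => x y z; lra.
(* Minimality of [u] in the direction [w], in the limit: [m <= g (v n + t w)] and [g (v n) < m + d],
   while replacing [v n] by [u] in the inner product costs at most [2 |t| d |w|]. The value of [d]
   makes the total error exactly [e]. *)
have key w t : 0 <= t ^+ 2 * rnorm w ^+ 2 + 2 * t * (complex.Re <[u, w]> - complex.Re (f
    w)).
  apply/ler_addgt0Pl => e e0; rewrite addrC -lerBlDr sub0r.
  have e4 : 0 < e / (1 + 2 * `|t| * rnorm w).
    by rewrite divr_gt0// ltr_wpDr// !mulr_ge0 ?rnorm_ge0.
  have [N NP] := natSinv_small e4; have [M MP] := vu _ e4.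
  pose n := maxn N M; have := NP n (leq_maxl _ _); have := MP n (leq_maxr _ _).
  set d := e / _ => h1 h2.
  have h3 := mg (v n + t%:C%C *: w); have h4 := vP n.
  have h5 : g (v n + t%:C%C *: w) = g (v n) + t ^+ 2 * rnorm w ^+ 2
      + 2 * t * (complex.Re <[v n, w]> - complex.Re (f w)).
    rewrite /g rnormD_sqr (linfunD fl) (linfunZ fl) rnormZr exprMn hdotZr.
    rewrite real_normK ?num_real//.
    case: (f (v n)) (f w) <[v n, w]> => [x y] [x1 y1] [x2 y2] /=; ring.
  have h6 : `|complex.Re <[v n, w]> - complex.Re <[u, w]>| <= rnorm (v n - u) * rnorm w.
    rewrite -raddfB/= -hdotBl; apply: le_trans (rnorm_hdot _ _).
    by rewrite -lecR -rnormE; exact: normc_ge_Re.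
  have h7 : `|t * (complex.Re <[v n, w]> - complex.Re <[u, w]>)| <= `|t| * (d * rnorm w).
    rewrite normrM ler_wpM2l// (le_trans h6)// ler_wpM2r ?rnorm_ge0// ltW//.
  have h8 : d + 2 * (`|t| * (d * rnorm w)) = e.
    rewrite /d; field; by rewrite gt_eqF// ltr_wpDr// !mulr_ge0 ?rnorm_ge0.
  have h9 : g (v n) < m + d by rewrite (lt_trans h4)// ltrD2l.
  move: h7; rewrite ler_norml => /andP[_ h7].
  lra.
have Ref w : complex.Re (f w) = complex.Re <[u, w]>.
  set b := complex.Re _; set a := complex.Re _.
  pose A := rnorm w ^+ 2.
  have A0 : 0 <= A by rewrite sqr_ge0.
  have A1 : 0 < A + 1 by rewrite ltr_wpDl.
  (* Nearly the minimising [t] of the quadratic polynomial; [A + 1] in place of [A] also covers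
     [w = 0]. *)
  have := key w (- (a - b) / (A + 1)); rewrite -/A -/a -/b.
  have -> : (- (a - b) / (A + 1)) ^+ 2 * A + 2 * (- (a - b) / (A + 1)) * (a - b)
    = - ((a - b) ^+ 2 * ((A + 2) / (A + 1) ^+ 2)) by field; rewrite gt_eqF.
  rewrite oppr_ge0 pmulr_lle0; last by rewrite divr_gt0// ?exprn_gt0// ltr_wpDl.
  move=> h; apply/eqP; rewrite eq_sym -subr_eq0 -sqrf_eq0 eq_le h sqr_ge0//.
exists u => w; rewrite hdotC.
(* Equality of real parts at [w] and at [i w] gives equality of the complex values. *)
have := Ref w; have := Ref ('i%C *: w); rewrite (linfunZ fl) hdotZr.
case: (f w) <[u, w]> => [x y] [x1 y1] /= + ->; rewrite !mul0r !mul1r !sub0r.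
by rewrite mulN1r opprK => h; congr (_ +i* _)%C; lra.
Qed.

End Riesz.

(** * Adjoints and square roots *)

Section Adjoint.
Variables (R : realType) (V : hilbertType R).
Implicit Types f g : V -> V.
Local Notation "<[ u , v ]>" := (hdot u v) (format "<[ u ,  v ]>").

Lemma adjointP f : bounded_operator f ->
  forall u v, <[f u, v]> = <[u, adjoint f v]>.
Proof.
move=> /bounded_operatorP[fl [c c0 fc]].
suff [g gP] : exists g, forall u v, <[f u, v]> = <[u, g v]>.
  exact: (@xgetPex _ _ [set g | forall u v, <[f u, v]> = <[u, g v]>] (ex_intro _ g gP)).
have /choice[g gP] : forall v, exists w, forall u, <[f u, v]> = <[u, w]>.
  move=> v; apply: (@Riesz_representation R V (fun u => <[f u, v]>) (c * rnorm v)).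
  - by move=> a u w; rewrite fl hdotDl hdotZl.
  - by rewrite mulr_ge0// rnorm_ge0.
  - move=> u; rewrite (le_trans (rnorm_hdot _ _))// mulrAC.
    by rewrite ler_wpM2r ?rnorm_ge0.
by exists g => u v; exact: gP.
Qed.

Lemma adjoint_unique f g : (forall u v, <[f u, v]> = <[u, g v]>) -> adjoint f = g.
Proof.
move=> fg; apply/funext => v; apply: hdot_injr => w; rewrite -fg.
have := @xgetPex _ (fun=> 0) [set g | forall u v, <[f u, v]> = <[u, g v]>] (ex_intro _ g
    fg).
by move=> /= ->.
Qed.

Lemma adjoint_linear f : bounded_operator f -> linear (adjoint f).
Proof.
move=> fb a u v; apply: hdot_injr => w; rewrite -adjointP// hdotDr hdotZr.
by rewrite !adjointP// hdotDr hdotZr.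
Qed.

Lemma adjoint_bounded_by f c : bounded_operator f -> 0 <= c ->
  bounded_by f c -> bounded_by (adjoint f) c.
Proof.
move=> fb c0 fc v; apply: hdot_rnorm_le; first by rewrite mulr_ge0 ?rnorm_ge0.
move=> u; rewrite hdotC -adjointP//.
have -> : rnorm (<[f u, v]>^* : R[i]^o) = rnorm (<[f u, v]> : R[i]^o).
  by rewrite /rnorm norm_conjC.
rewrite (le_trans (rnorm_hdot _ _))// mulrAC ler_wpM2r ?rnorm_ge0//.
Qed.

Lemma totally_bounded_map_comp f g (c : R) : linear f -> totally_bounded_map f ->
  linear g -> 0 <= c -> bounded_by g c -> totally_bounded_map (f \o g).
Proof.
move=> fl ft gl c0 gc e e0; have k0 : 0 < c + 1 by rewrite ltr_wpDl.
have [s sP] := ft (e / (c + 1)) (divr_gt0 e0 k0).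
exists [seq (c + 1)%:C%C *: x | x <- s] => v v1.
(* The rescaling puts [g v] in the unit ball, where the net for [f] applies; [c + 1] is positive
   even if [c = 0]. *)
have [|x xs fx] := sP ((c + 1)^-1%:C%C *: g v).
  rewrite rnormZr gtr0_norm ?invr_gt0// ler_pdivrMl// mulr1.
  rewrite (le_trans (gc v))// (@le_trans _ _ c) ?lerDl//.
  by rewrite -[leRHS]mulr1 ler_wpM2l.
exists ((c + 1)%:C%C *: x); first exact: map_f.
have -> : (f \o g) v = (c + 1)%:C%C *: f ((c + 1)^-1%:C%C *: g v).
  rewrite (linfunZ fl) scalerA -rmorphM/= divff ?gt_eqF// rmorph1 scale1r//.
rewrite -scalerBr rnormZr gtr0_norm//.
by rewrite mulrC -ltr_pdivlMr.
Qed.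

(* Schauder: [|f^* y - f^* y'|^2 = <f f^* (y - y'), y - y'>], so a finite net for
   [f \o f^*] yields one for [f^*]. *)
Lemma totally_bounded_map_adjoint f : linear f -> totally_bounded_map f ->
  totally_bounded_map (adjoint f).
Proof.
move=> fl ft; have [c c0 fc] := totally_bounded_map_bounded fl ft.
have fb : bounded_operator f by apply/bounded_operatorP; split=> //; exists c.
have al := adjoint_linear fb.
have := totally_bounded_map_comp fl ft al c0 (adjoint_bounded_by fb c0 fc).
(* Two vectors with the same net point have images less than [2 d] apart and are themselves at
   distance at most [2], whence [4 d = e^2]. *)
move=> fft e e0; have d0 : 0 < e ^+ 2 / 4 by rewrite divr_gt0// exprn_gt0.
have [s sP] := fft _ d0; set d := e ^+ 2 / 4 in d0 sP.
(* Each net point [w] is assigned a vector of the unit ball with image near [w], or [0] if there is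
   none; the adjoint at these vectors is the new net. *)
have /choice[y yP] : forall w, exists y, rnorm y <= 1 /\
    ((exists2 v, rnorm v <= 1 & rnorm (f (adjoint f v) - w) < d) ->
     rnorm (f (adjoint f y) - w) < d).
  move=> w; have [[v v1 vw]|nv] := pselect (exists2 v, rnorm v <= 1 &
    rnorm (f (adjoint f v) - w) < d); first by exists v.
  by exists 0; rewrite rnorm0.
exists [seq adjoint f (y w) | w <- s] => v v1.
have [w ws vw] := sP _ v1; exists (adjoint f (y w)); first exact: map_f.
have [y1 yw] := yP w; have {}yw : rnorm (f (adjoint f (y w)) - w) < d.
  by apply: yw; exists v.
rewrite -(linfunB al) -(@ltr_pXn2r _ 2)// ?nnegrE ?rnorm_ge0 ?ltW//.
rewrite rnorm_sqr_Re -adjointP// (linfunB al) (linfunB fl).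
set p := f _; set q := f _; rewrite (le_lt_trans (Re_hdot_le _ _))//.
have h1 : rnorm (p - q) < d + d.
  have -> : p - q = (p - w) + (w - q) by rewrite addrA subrK.
  by rewrite (le_lt_trans (rnormD _ _))// ltrD// rnormBC.
have h2 : rnorm (v - y w) <= 2.
  by rewrite (le_trans (rnormD _ _))// rnormN -[2]/(1 + 1) lerD.
have := rnorm_ge0 (p - q); have := rnorm_ge0 (v - y w).
have -> : e ^+ 2 = 4 * d by rewrite /d mulrC divfK.
move: h1 h2; nra.
Qed.

Definition self_adjoint f := forall u v, <[f u, v]> = <[u, f v]>.

Section SquareRoot.
Variables (a : V -> V) (r : R).
Hypotheses (al : linear a) (at_ : totally_bounded_map a) (as_ : self_adjoint a).
Hypotheses (r0 : 0 <= r) (r1 : r < 1) (ar : bounded_by a r).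

Let half (v : V) := (2^-1 : R)%:C%C *: v.

(** Iteration of [b |-> (a + b^2) / 2], whose fixed points solve [2 b - b^2 = a]. Starting at [0],
    all iterates are polynomials in [a] without constant term, so they remain compact and
    self-adjoint; the bound [r] is kept because [(r + r^2) / 2 <= r]. *)
Fixpoint sqrt_iter n : V -> V :=
  if n is m.+1 then fun v => half (a v + sqrt_iter m (sqrt_iter m v))
  else fun=> 0.

Local Notation b_ := sqrt_iter.

Let half_norm v : rnorm (half v) = 2^-1 * rnorm v.
Proof. by rewrite rnormZr ger0_norm. Qed.

Let b_prop n : [/\ linear (b_ n), totally_bounded_map (b_ n), self_adjoint (b_ n)
  & bounded_by (b_ n) r].
Proof.
elim: n => [|n [bl bt bs br]] /=.
  split.
  - by move=> ? ? ?; rewrite scaler0 addr0.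
  - by move=> e e0; exists [:: 0] => v v1; exists 0; rewrite ?inE// subr0 rnorm0.
  - by move=> u v; rewrite hdot0l hdot0r.
  - by move=> v; rewrite rnorm0 mulr_ge0// rnorm_ge0.
split.
- by move=> k u v; rewrite al !bl /half !scalerDr !scalerA (mulrC k) addrACA.
- have ct := totally_bounded_map_comp bl bt bl r0 br.
  have h : totally_bounded_map (fun v => (1 : R[i]) *: a v + (b_ n \o b_ n) v).
    exact: totally_bounded_map_lin.
  have z : totally_bounded_map (fun _ : V => 0 : V).
    by move=> e e0; exists [:: 0] => v v1; exists 0; rewrite ?inE// subr0 rnorm0.
  have := totally_bounded_map_lin (2^-1 : R)%:C%C h z.
  by under eq_fun do rewrite addr0 scale1r.
- move=> u v; rewrite /half hdotZl hdotZr hdotDl hdotDr as_ bs bs.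
  by rewrite -[_^*]/((2^-1 : R)%:C%C^*)%C conjc_real.
- move=> v; rewrite half_norm.
  have h1 : rnorm (a v + b_ n (b_ n v)) <= r * rnorm v + r * (r * rnorm v).
    rewrite (le_trans (rnormD _ _))// lerD// (le_trans (br _))//.
    by rewrite ler_wpM2l.
  have : r * (r * rnorm v) <= 1 * (r * rnorm v).
    by rewrite ler_wpM2r// ?(ltW r1)// mulr_ge0 ?rnorm_ge0.
  lra.
Qed.

Let b_dist n k v : rnorm (b_ (n + k) v - b_ n v) <= r ^+ n * (r * rnorm v).
Proof.
elim: n v => [|n IHn] v; first by rewrite subr0 expr0 mul1r add0n; case: (b_prop k).
rewrite addSn /= /half -scalerBr half_norm.
have -> x y z : (x + y) - (x + z) = y - z :> V by rewrite opprD addrACA subrr add0r.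
have [bl _ _ br] := b_prop (n + k); have [_ _ _ br'] := b_prop n.
set B := b_ (n + k) in bl br IHn *; set B' := b_ n in br' IHn *.
(* The noncommutative difference of squares [B (B - B') + (B - B') B']. Each summand gains a factor
   [r], and the halving makes the whole step a contraction by [r]; the second summand uses the
   induction hypothesis at [B' v]. *)
have -> : B (B v) - B' (B' v) = B (B v - B' v) + (B (B' v) - B' (B' v)).
  by rewrite (linfunB bl) addrA subrK.
have h1 := rnormD (B (B v - B' v)) (B (B' v) - B' (B' v)).
have h2 := IHn v; have h3 := br (B v - B' v).
have h4 := IHn (B' v); have h5 := br' v.
have h6 : r ^+ n * (r * rnorm (B' v)) <= r ^+ n * (r * (r * rnorm v)).
  by rewrite ler_wpM2l ?exprn_ge0// ler_wpM2l.
have h7 : r * rnorm (B v - B' v) <= r * (r ^+ n * (r * rnorm v)).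
  by rewrite ler_wpM2l.
rewrite exprS.
have -> : r * r ^+ n * (r * rnorm v) = 2^-1 * (r * (r ^+ n * (r * rnorm v)) +
  r ^+ n * (r * (r * rnorm v))) by field.
by rewrite ler_wpM2l//; lra.
Qed.

Let rn_small (e : R) : 0 < e -> exists N, forall n, (N <= n)%N -> r ^+ n < e.
Proof.
move=> e0; have : `|r| < 1 by rewrite ger0_norm.
move=> /cvg_expr/cvgrPdist_lt/(_ _ e0)[N _ NP]; exists N => n Nn.
have := NP n Nn; rewrite sub0r normrN ger0_norm// exprn_ge0//.
Qed.

(** The iterates converge at a geometric rate that is uniform on the unit ball. This carries
    compactness to the limit, and each identity follows by bounding its defect by a multiple of
    [r ^+ n] for all [n]. *)
Lemma operator_sqrt : exists b : V -> V,
  [/\ linear b, totally_bounded_map b, self_adjoint b, bounded_by b r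
    & forall v, b v + b v - b (b v) = a v].
Proof.
have bsmall e v : 0 < e -> exists N, forall n k, (N <= n)%N ->
    rnorm (b_ (n + k) v - b_ n v) < e.
  move=> e0; have p0 : 0 < r * rnorm v + 1 by rewrite ltr_wpDl// mulr_ge0 ?rnorm_ge0.
  have [N NP] := rn_small (divr_gt0 e0 p0); exists N => n k Nn.
  rewrite (le_lt_trans (b_dist _ _ _))//.
  apply: (@le_lt_trans _ _ (r ^+ n * (r * rnorm v + 1))).
    by rewrite ler_wpM2l ?exprn_ge0// lerDl.
  by rewrite -ltr_pdivlMr//; exact: NP.
have /choice[b bP] : forall v, exists w, rcvg (fun n => b_ n v) w.
  move=> v; apply: rcauchy_cvg => e e0; have [N NP] := bsmall e v e0.
  exists N => m n Nm Nn; have [mn|/ltnW nm] := leqP m n.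
    by rewrite rnormBC -(subnKC mn); exact: NP.
  by rewrite -(subnKC nm); exact: NP.
have b_lim n v : rnorm (b v - b_ n v) <= r ^+ n * (r * rnorm v).
  apply: rnorm_lim_le (bP v) _; exists n => m nm.
  by rewrite -(subnKC nm); exact: b_dist.
have lim0 (w : V) c : (forall n, rnorm w <= r ^+ n * c) -> w = 0.
  move=> wc; apply: rnorm_le0; apply/ler_addgt0Pl => e e0; rewrite addr0.
  have c1 : 0 < `|c| + 1 by rewrite ltr_wpDl.
  have [N NP] := rn_small (divr_gt0 e0 c1).
  rewrite (le_trans (wc N))// (@le_trans _ _ (r ^+ N * (`|c| + 1)))//.
    by rewrite ler_wpM2l ?exprn_ge0// ler_wpDr// ler_norm.
  by rewrite -ler_pdivlMr// ltW// NP.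
have br : bounded_by b r.
  by move=> v; apply: rcvg_le (bP v) _ => n; case: (b_prop n) => _ _ _; exact.
have bl : linear b.
  move=> k u v; apply/eqP; rewrite -subr_eq0; apply/eqP.
  apply: (lim0 _ (r * rnorm (k *: u + v) + (rnorm (k : R[i]^o) * (r * rnorm u) + r * rnorm
      v))) => n.
  have [bl _ _ _] := b_prop n.
  have -> : b (k *: u + v) - (k *: b u + b v) =
    (b (k *: u + v) - b_ n (k *: u + v)) - (k *: (b u - b_ n u) + (b v - b_ n v)).
    have subK (A P Q : V) : A - P - (Q - P) = A - Q by rewrite opprB addrA subrK.
    by rewrite bl scalerBr [X in _ = _ - X]addrACA -opprD subK.
  rewrite (le_trans (rnormD _ _))// rnormN mulrDr lerD ?b_lim//.
  rewrite (le_trans (rnormD _ _))// mulrDr lerD ?b_lim// rnormZ mulrCA.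
  by rewrite ler_wpM2l ?rnorm_ge0.
exists b; split => //.
- apply: totally_bounded_map_lim => e e0.
  have [N NP] := rn_small e0; exists (b_ N); first by case: (b_prop N).
  move=> v v1; rewrite (le_lt_trans (b_lim N v))// (le_lt_trans _ (NP N (leqnn _)))//.
  rewrite -[leRHS]mulr1 ler_wpM2l ?exprn_ge0//.
  by rewrite (le_trans _ (ltW r1))// ler_piMr.
- move=> u v; apply/eqP; rewrite -subr_eq0; apply/eqP.
  pose z : R[i]^o := <[b u, v]> - <[u, b v]>.
  suff : z = 0 by [].
  apply: rnorm_le0; apply/ler_addgt0Pl => e e0; rewrite addr0.
  pose c := r * rnorm u * rnorm v + rnorm u * (r * rnorm v) + 1.
  have c1 : 0 < c by rewrite ltr_wpDl// addr_ge0// !mulr_ge0 ?rnorm_ge0.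
  have [N NP] := rn_small (divr_gt0 e0 c1).
  have [_ _ bs _] := b_prop N.
  have -> : z = (<[b u - b_ N u, v]> : R[i]^o) - <[u, b v - b_ N v]>.
    by rewrite /z hdotBl hdotBr bs opprB addrA subrK.
  rewrite (le_trans (rnormD _ _))// rnormN.
  have h1 := rnorm_hdot (b u - b_ N u) v; have h2 := rnorm_hdot u (b v - b_ N v).
  have h3 : rnorm (b u - b_ N u) * rnorm v <= r ^+ N * (r * rnorm u) * rnorm v.
    by rewrite ler_wpM2r ?rnorm_ge0.
  have h4 : rnorm u * rnorm (b v - b_ N v) <= rnorm u * (r ^+ N * (r * rnorm v)).
    by rewrite ler_wpM2l ?rnorm_ge0.
  apply: (@le_trans _ _ (r ^+ N * c)).
    have : 0 <= r ^+ N by rewrite exprn_ge0.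
    rewrite /c; move: h1 h2 h3 h4; set x := rnorm (<[_, v]> : R[i]^o).
    by set y := rnorm (<[u, _]> : R[i]^o); lra.
  by rewrite -ler_pdivlMr// ltW// NP.
- move=> v; apply/eqP; rewrite -subr_eq0; apply/eqP.
  apply: (lim0 _ (2 * r * (r * rnorm v) + r * (r * rnorm v) + r * (r * rnorm v))) => n.
  have hS : b_ n.+1 v + b_ n.+1 v = a v + b_ n (b_ n v).
    rewrite /= /half -scalerDl -rmorphD/= (_ : 2^-1 + 2^-1 = 1 :> R) ?scale1r//.
    by field.
  have -> : b v + b v - b (b v) - a v = (b v - b_ n.+1 v) + (b v - b_ n.+1 v)
     - (b (b v - b_ n v) + (b (b_ n v) - b_ n (b_ n v))).
    rewrite [X in _ = X - _]addrACA -opprD hS (linfunB bl).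
    rewrite [X in _ = _ - X]addrA subrK.
    have subK (A P C Q : V) : A - (P + C) - (Q - C) = A - Q - P.
      by rewrite opprB opprD addrA addrA subrK addrAC.
    by rewrite subK.
  have h1 := b_lim n.+1 v.
  have h2 := br (b v - b_ n v); have h3 := b_lim n v; have h4 := b_lim n (b_ n v).
  have [_ _ _ br'] := b_prop n; have h5 := br' v.
  have rn0 : 0 <= r ^+ n by rewrite exprn_ge0.
  have h6 : r * rnorm (b v - b_ n v) <= r * (r ^+ n * (r * rnorm v)).
    by rewrite ler_wpM2l.
  have h7 : r ^+ n * (r * rnorm (b_ n v)) <= r ^+ n * (r * (r * rnorm v)).
    by rewrite ler_wpM2l// ler_wpM2l.
  rewrite (le_trans (rnormD _ _))// rnormN.
  have := rnormD (b v - b_ n.+1 v) (b v - b_ n.+1 v).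
  have := rnormD (b (b v - b_ n v)) (b (b_ n v) - b_ n (b_ n v)).
  move: h1; rewrite exprS; set p := rnorm (_ + _); set q := rnorm (b v - b_ n.+1 v).
  set s := rnorm (_ + _); nra.
Qed.

End SquareRoot.

End Adjoint.

(** * Unconditional sums *)

Lemma big_seq_split (A : nmodType) (X : eqType) (s t : seq X) (F : X -> A) :
  uniq s -> uniq t -> {subset t <= s} ->
  \sum_(x <- s) F x = \sum_(x <- t) F x + \sum_(x <- s | x \notin t) F x.
Proof.
move=> us ut ts; rewrite (bigID (mem t))/=; congr (_ + _).
rewrite -big_filter; apply: perm_big; apply: uniq_perm; rewrite ?filter_uniq//.
by move=> x; rewrite mem_filter; case: (boolP (x \in t)) => // /ts ->.
Qed.

Section HasSum.
Variables (R : realType) (X : choiceType).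

(** Convergence along the net of finite subsets of [X], which are represented by duplicate-free
    lists. *)
Definition has_sum (V : normedModType R[i]) (z : X -> V) (l : V) :=
  forall e : R, 0 < e -> exists s0 : seq X, forall s, uniq s ->
    {subset s0 <= s} -> rnorm (\sum_(x <- s) z x - l) < e.

Lemma has_sum_unique (V : normedModType R[i]) (z : X -> V) l l' :
  has_sum z l -> has_sum z l' -> l = l'.
Proof.
move=> zl zl'; apply/eqP; rewrite -subr_eq0; apply/eqP; apply: rnorm_le0.
apply/ler_addgt0Pl => e e0; rewrite addr0.
have e2 : 0 < e / 2 by rewrite divr_gt0.
have [s sP] := zl _ e2; have [t tP] := zl' _ e2.
have us : uniq (undup (s ++ t)) by exact: undup_uniq.
have := sP _ us; have := tP _ us; set w := \sum_(x <- _) _ => h1 h2.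
have -> : l - l' = (w - l') - (w - l) by rewrite opprB [RHS]addrC addrA subrK.
rewrite (le_trans (rnormD _ _))// rnormN [leRHS]splitr lerD// ltW//.
  by apply: h1 => x xt; rewrite mem_undup mem_cat xt orbT.
by apply: h2 => x xt; rewrite mem_undup mem_cat xt.
Qed.

Lemma has_sumP (V : normedModType R[i]) (a : R[i]) (z w : X -> V) l k :
  has_sum z l -> has_sum w k -> has_sum (fun x => a *: z x + w x) (a *: l + k).
Proof.
move=> zl wk e e0; have e2 : 0 < e / 2 by rewrite divr_gt0.
pose c := rnorm (a : R[i]^o) + 1.
have c0 : 0 < c by rewrite ltr_wpDl// rnorm_ge0.
have [s sP] := zl _ (divr_gt0 e2 c0); have [t tP] := wk _ e2.
exists (s ++ t) => u uu stu.
rewrite big_split/= -scaler_sumr opprD addrACA -scalerBr.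
rewrite (le_lt_trans (rnormD _ _))// [ltRHS]splitr.
rewrite ler_ltD//; last by apply: tP => // x xt; apply: stu; rewrite mem_cat xt orbT.
rewrite rnormZ (@le_trans _ _ (c * rnorm (\sum_(x <- u) z x - l)))//.
  by rewrite ler_wpM2r ?rnorm_ge0// /c lerDl.
rewrite mulrC -ler_pdivlMr// ltW//.
by apply: sP => // x xs; apply: stu; rewrite mem_cat xs.
Qed.

Lemma has_sum_conj (z : X -> R[i]^o) (l : R[i]^o) :
  has_sum z l -> has_sum (fun x => (z x : R[i])^* : R[i]^o) ((l : R[i])^* : R[i]^o).
Proof.
move=> zl e /zl[s sP]; exists s => t ut st.
rewrite -[X in rnorm (X - _)](rmorph_sum (Num.conj : R[i] -> R[i])) -rmorphB/=.
by rewrite /rnorm norm_conjC; exact: sP.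
Qed.

Lemma has_sum_fin (V : normedModType R[i]) (z : X -> V) (s : seq X) :
  uniq s -> (forall x, x \notin s -> z x = 0) -> has_sum z (\sum_(x <- s) z x).
Proof.
move=> us z0 e e0; exists s => t ut st.
rewrite (big_seq_split _ ut us st) addrAC subrr add0r big1 ?rnorm0//.
Qed.

Lemma has_sum_ex (V : completeNormedModType R[i]) (z : X -> V) (c : R) :
  (forall s, uniq s -> \sum_(x <- s) rnorm (z x) <= c) -> exists l, has_sum z l.
Proof.
move=> zc; pose E := [set \sum_(x <- s) rnorm (z x) | s in [set s | uniq s]].
have Esup : has_sup E.
  split; first by exists 0, [::]; rewrite ?big_nil.
  by exists c => _ [s us <-]; exact: zc.
have /choice[s sP] : forall n : nat, exists s, uniq s /\
    sup E - n.+1%:R^-1 < \sum_(x <- s) rnorm (z x).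
  move=> n; have [//|_ [s us <-] h] := @sup_adherent _ E n.+1%:R^-1 _ Esup.
  by exists s.
(* Since [s n] nearly attains the supremum of the finite sums of norms, whatever is added outside it
   has total norm at most [1 / (n + 1)]. *)
have tail n t : uniq t -> {subset s n <= t} ->
    rnorm (\sum_(x <- t) z x - \sum_(x <- s n) z x) <= n.+1%:R^-1.
  move=> ut st; have [us sn] := sP n.
  rewrite (big_seq_split _ ut us st) addrAC subrr add0r.
  rewrite (le_trans (rnorm_sum _ _ _))//.
  have : \sum_(x <- t) rnorm (z x) <= sup E.
    by apply: ub_le_sup; [case: Esup|exists t].
  rewrite (big_seq_split _ ut us st).
  move: (n.+1%:R^-1) (sup E) sn => p q.
  by set a := \sum_(_ <- _) _; set b := \sum_(_ <- _ | _) _; lra.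
pose u n := \sum_(x <- s n) z x.
have uu n m : rnorm (u n - u m) <= n.+1%:R^-1 + m.+1%:R^-1.
  pose t := undup (s n ++ s m); have ut : uniq t by exact: undup_uniq.
  have -> : u n - u m = - (\sum_(x <- t) z x - u n) + (\sum_(x <- t) z x - u m).
    by rewrite opprB addrA subrK.
  rewrite (le_trans (rnormD _ _))// rnormN lerD// tail// => x xs.
    by rewrite mem_undup mem_cat xs.
  by rewrite mem_undup mem_cat xs orbT.
have [l ul] : exists l, rcvg u l.
  apply: rcauchy_cvg => e e0; have e2 : 0 < e / 2 by rewrite divr_gt0.
  have [N NP] := natSinv_small e2.
  exists N => n m Nn Nm; rewrite (le_lt_trans (uu n m))// [ltRHS]splitr.
  by rewrite ltrD// NP.
exists l => e e0; have e2 : 0 < e / 2 by rewrite divr_gt0.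
have [N NP] := natSinv_small e2; have [M MP] := ul _ e2.
pose n := maxn N M; exists (s n) => t ut st.
have -> : \sum_(x <- t) z x - l = (\sum_(x <- t) z x - u n) + (u n - l).
  by rewrite addrA subrK.
rewrite (le_lt_trans (rnormD _ _))// [ltRHS]splitr ltrD//.
  by rewrite (le_lt_trans (tail _ _ ut st))// NP// leq_maxl.
by rewrite MP// leq_maxr.
Qed.

Lemma has_sum_ge0_le (f : X -> R) (l : R[i]^o) (s : seq X) :
  (forall x, 0 <= f x) -> has_sum (fun x => (f x)%:C%C : R[i]^o) l -> uniq s ->
  \sum_(x <- s) f x <= complex.Re l.
Proof.
move=> f0 fl us; apply/ler_addgt0Pl => e /fl[s0 s0P].
pose t := undup (s ++ s0); have ut : uniq t by exact: undup_uniq.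
have := s0P t ut; rewrite -rmorph_sum/= => h.
have {}h : rnorm ((\sum_(x <- t) f x)%:C%C - l : R[i]^o) < e.
  by apply: h => x xs; rewrite mem_undup mem_cat xs orbT.
have st : {subset s <= t} by move=> x xs; rewrite mem_undup mem_cat xs.
have : \sum_(x <- s) f x <= \sum_(x <- t) f x.
  by rewrite (big_seq_split _ ut us st) lerDl sumr_ge0.
have := le_lt_trans (Re_le_rnorm _) h; rewrite raddfB/= => h1 h2; lra.
Qed.

Lemma has_sum_le (f : X -> R) (l : R[i]^o) (c : R) :
  has_sum (fun x => (f x)%:C%C : R[i]^o) l ->
  (forall s, uniq s -> \sum_(x <- s) f x <= c) -> complex.Re l <= c.
Proof.
move=> fl fc; apply/ler_addgt0Pl => e /fl[s0 s0P].
have ut : uniq (undup s0) by exact: undup_uniq.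
have := s0P _ ut; rewrite -rmorph_sum/= => h.
have {}h : rnorm (l - (\sum_(x <- undup s0) f x)%:C%C : R[i]^o) < e.
  by rewrite rnormBC; apply: h => x xs; rewrite mem_undup.
have := le_lt_trans (Re_le_rnorm _) h; rewrite raddfB/=.
have := fc _ ut; lra.
Qed.

End HasSum.

(** * The Hilbert space of complex numbers *)

(** Centres of balls of radius [1 / (n + 1)] that belong to the filter form a Cauchy sequence, and
    the filter converges to its limit. This supplies the completeness of the Hilbert spaces
    constructed below. *)
Lemma seq_complete (R : realType) (V : normedModType R[i]) :
  (forall u : nat -> V, (forall e : R, 0 < e -> exists N, forall m n,
     (N <= m)%N -> (N <= n)%N -> rnorm (u m - u n) < e) -> exists l, rcvg u l) ->
  forall F : set_system V, ProperFilter F -> cauchy F -> cvg F.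
Proof.
move=> Vc F FF FC.
have Fb (e : R) : 0 < e -> exists v, F (ball v e%:C%C).
  by move=> e0; apply: (cauchyP F).1 => //; rewrite (ltcR 0).
have /choice[u uP] : forall n : nat, exists v, F (ball v (n.+1%:R^-1 : R)%:C%C).
  by move=> n; apply: Fb; rewrite invr_gt0.
have uu m n : rnorm (u m - u n) <= m.+1%:R^-1 + n.+1%:R^-1.
  have [v [mv nv]] := @filter_ex _ F FF _ (filterI (uP m) (uP n)).
  move: mv nv; rewrite -!ball_normE/= !rnormE !ltcR => mv nv.
  have -> : u m - u n = (u m - v) - (u n - v) by rewrite opprB addrA subrK.
  by rewrite (le_trans (rnormD _ _))// rnormN ltW// ltrD.
have [|l ul] := Vc u.
  move=> e e0; have e2 : 0 < e / 2 by rewrite divr_gt0.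
  have [N NP] := natSinv_small e2.
  exists N => n m Nn Nm; rewrite (le_lt_trans (uu n m))// [ltRHS]splitr.
  by rewrite ltrD// NP.
apply/cvg_ex; exists l; apply/cvgrPdist_lt => e e0.
have /complex_realP[d de] : e \is Num.real by rewrite gtr0_real.
move: e0; rewrite de (ltcR 0) => d0; have d2 : 0 < d / 2 by rewrite divr_gt0.
have [N NP] := natSinv_small d2; have [M MP] := ul _ d2.
pose n := maxn N M; apply: filterS (uP n) => v.
rewrite -ball_normE/= !rnormE !ltcR => nv.
have -> : l - v = - (u n - l) + (u n - v) by rewrite opprB addrA subrK.
rewrite (le_lt_trans (rnormD _ _))// rnormN [ltRHS]splitr ltrD//.
  by rewrite MP// leq_maxr.
by rewrite (lt_trans nv)// NP// leq_maxl.
Qed.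

Section ComplexHilbert.
Variable R : realType.

Lemma complex_seq_complete (u : nat -> R[i]^o) :
  (forall e : R, 0 < e -> exists N, forall m n,
     (N <= m)%N -> (N <= n)%N -> rnorm (u m - u n) < e) -> exists l, rcvg u l.
Proof.
move=> uC.
have reC (p : R[i] -> R) : {morph p : a b / a - b} ->
    (forall z : R[i]^o, `|p z| <= rnorm z) ->
    exists l, forall e, 0 < e -> exists N, forall n, (N <= n)%N -> `|p (u n) - l| < e.
  move=> pB pz; have /cauchy_cvg/cvg_ex[/= l ul] : cauchy ((p \o u) @ \oo).
    apply: cauchy_exP => e e0; have [N NP] := uC _ e0.
    exists (p (u N)), N => // n /= Nn; rewrite -ball_normE/= -pB.
    by rewrite (le_lt_trans (pz _))// NP.
  exists l => e e0; have /cvgrPdist_lt/(_ _ e0)[N _ NP] := ul.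
  by exists N => n Nn; rewrite distrC; exact: NP.
have normc_ge_Im (z : R[i]^o) : `|complex.Im z| <= rnorm z.
  have := normc_ge_Re (z * 'i%C); rewrite normrM ReiNIm normrN.
  by rewrite (_ : `|'i%C| = 1) ?mulr1 ?rnormE ?lecR// normc_def/= expr0n/= add0r expr1n
      sqrtr1.
have [a aP] := reC (@complex.Re R) (raddfB _)
  (fun z => ltac:(by rewrite -lecR -rnormE; exact: normc_ge_Re)).
have [b bP] := reC (@complex.Im R) (raddfB _) normc_ge_Im.
exists (a +i* b)%C => e e0; have e2 : 0 < e / 2 by rewrite divr_gt0.
have [N NP] := aP _ e2; have [M MP] := bP _ e2.
exists (maxn N M) => n; rewrite geq_max => /andP[/NP h1 /MP h2].
have -> : u n - (a +i* b)%C = (complex.Re (u n) - a)%:C%C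
    + (complex.Im (u n) - b)%:C%C * 'i%C :> R[i]^o.
  by case: (u n) => x y; simpc.
rewrite (le_lt_trans (rnormD _ _))// [ltRHS]splitr ltrD//.
  by rewrite -[X in rnorm X]mulr1 -[X in rnorm X]/(_ *: (1 : R[i]^o)) rnormZr /rnorm
      normr1/= mulr1.
rewrite -[X in rnorm X]/(_ *: ('i%C : R[i]^o)) rnormZr /rnorm normc_def/=.
by rewrite expr0n expr1n/= add0r sqrtr1 mulr1.
Qed.

(* [GRing.regular] already carries the completeness instance of real numbers, so
   the Hilbert structure of [R[i]^o] needs a fresh key. *)
Definition complex_line : Type := R[i]^o.

HB.instance Definition _ := NormedModule.copy complex_line R[i]^o.

HB.instance Definition _ := Uniform_isComplete.Build complex_line
  (seq_complete complex_seq_complete).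

Definition cdot (a b : complex_line) : R[i] := (a : R[i]) * (b : R[i])^*.

Lemma cdot_bilinear : bilinear_for
  (GRing.Scale.Law.clone _ _ ( *%R ) _) (GRing.Scale.Law.clone _ _ (Num.conj \; *%R) _)
  cdot.
Proof.
split=> [b|a] k u v; rewrite /cdot.
  by rewrite mulrDl -mulrA.
by rewrite rmorphD rmorphM mulrDr mulrCA.
Qed.

HB.instance Definition _ := @bilinear_isBilinear.Build R[i] complex_line complex_line
  R[i] _ _ cdot cdot_bilinear.

Lemma cdot_hermitian (a b : complex_line) : cdot a b = (-1) ^+ false * (cdot b a)^*.
Proof. by rewrite /cdot expr0 mul1r rmorphM/= conjCK mulrC. Qed.

HB.instance Definition _ := @isHermitianSesquilinear.Build R[i] complex_line false
  Num.conj cdot cdot_hermitian.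

Lemma cdot_gt0 (a : complex_line) : a != 0 -> 0 < cdot a a.
Proof. by move=> a0; rewrite /cdot -normCK exprn_gt0// normr_gt0. Qed.

HB.instance Definition _ := isDotProduct.Build R[i] complex_line cdot cdot_gt0.

Lemma cdot_normE (v : complex_line) : cdot v v = `|v| ^+ 2.
Proof. by rewrite /cdot -normCK. Qed.

HB.instance Definition _ :=
  CompleteNormedModule_isHilbert.Build R complex_line cdot_normE.

End ComplexHilbert.

(** * The Hilbert space of square summable families *)

Section SquareSummable.
Variables (R : realType) (X : choiceType) (V : hilbertType R).

Definition sqsummable : {pred X -> V} := fun f => `[< exists c : R, forall s, uniq s ->
  \sum_(x <- s) rnorm (f x) ^+ 2 <= c >].

Lemma sqsummable_submod : submod_closed sqsummable.
Proof.
split.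
  apply/asboolP; exists 0 => s us; rewrite big1// => x _.
  by rewrite rnorm0 expr0n.
move=> a f g /asboolP[c fc] /asboolP[d gd]; apply/asboolP.
pose k := rnorm (a : R[i]^o).
exists (2 * k ^+ 2 * c + 2 * d) => s us.
apply: (@le_trans _ _ (\sum_(x <- s) (2 * k ^+ 2 * rnorm (f x) ^+ 2 + 2 * rnorm (g x) ^+
    2))).
  apply: ler_sum => x _; have := rnormD (a *: f x) (g x); rewrite rnormZ -/k.
  have -> : (a *: f + g) x = a *: f x + g x by [].
  have := rnorm_ge0 (a *: f x + g x); set p := rnorm (_ + _).
  set q := rnorm (f x); set r := rnorm (g x) => p0 pqr.
  have : p ^+ 2 <= (k * q + r) ^+ 2 by rewrite ler_pXn2r ?nnegrE// (le_trans p0).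
  have := sqr_ge0 (k * q - r); nra.
rewrite big_split/= -!mulr_sumr lerD//.
  by rewrite ler_wpM2l ?fc// mulr_ge0 ?sqr_ge0.
by rewrite ler_wpM2l ?gd.
Qed.

HB.instance Definition _ := GRing.isSubmodClosed.Build R[i] (X -> V) sqsummable
  sqsummable_submod.

Record l2 := L2 { l2_fun :> X -> V ; l2_funP : l2_fun \in sqsummable }.

HB.instance Definition _ := [isSub for l2_fun].
HB.instance Definition _ := [Choice of l2 by <:].
HB.instance Definition _ := [SubChoice_isSubLmodule of l2 by <:].

Implicit Types f g h : l2.

Lemma l2_eq f g : (forall x, f x = g x) -> f = g.
Proof. by move=> fg; apply/val_inj/funext. Qed.

Lemma l2_bound f : exists c : R, forall s, uniq s -> \sum_(x <- s) rnorm (f x) ^+ 2 <= c.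
Proof. by have /asboolP := l2_funP f. Qed.

Lemma l2_dot_ex f g : exists l : complex_line R,
  has_sum (fun x => hdot (f x) (g x) : complex_line R) l.
Proof.
have [c fc] := l2_bound f; have [d gd] := l2_bound g.
apply: (@has_sum_ex _ _ _ _ (2^-1 * c + 2^-1 * d)) => s us.
apply: (@le_trans _ _ (\sum_(x <- s) (2^-1 * rnorm (f x) ^+ 2 + 2^-1 * rnorm (g x) ^+ 2))).
  apply: ler_sum => x _; rewrite (le_trans (rnorm_hdot _ _))//.
  by have := sqr_ge0 (rnorm (f x) - rnorm (g x)); nra.
by rewrite big_split/= -!mulr_sumr lerD// ler_wpM2l ?fc ?gd.
Qed.

Definition l2_dot f g : R[i] := projT1 (cid (l2_dot_ex f g)).

Lemma l2_dotP f g : has_sum (fun x => hdot (f x) (g x) : R[i]^o) (l2_dot f g : R[i]^o).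
Proof. exact: (projT2 (cid (l2_dot_ex f g))). Qed.

Lemma l2_dotPl (a : R[i]) f g h : l2_dot (a *: f + g) h = a * l2_dot f h + l2_dot g h.
Proof.
apply: (has_sum_unique (l2_dotP _ _)).
have := has_sumP a (l2_dotP f h) (l2_dotP g h).
by under [X in has_sum X]eq_fun do rewrite -[_ *: _]hdotZl -hdotDl.
Qed.

Lemma l2_dotC f g : l2_dot f g = (l2_dot g f)^*.
Proof.
apply: (has_sum_unique (l2_dotP _ _)).
have := has_sum_conj (l2_dotP g f).
by under [X in has_sum X]eq_fun do rewrite -hdotC.
Qed.

Lemma l2_dotPr (a : R[i]) f g h : l2_dot h (a *: f + g) = a^* * l2_dot h f + l2_dot h g.
Proof. by rewrite l2_dotC l2_dotPl rmorphD rmorphM/= -!l2_dotC. Qed.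

Definition l2_nrm f : R := Num.sqrt (complex.Re (l2_dot f f)).

Lemma l2_has_sum_sqr f :
  has_sum (fun x => (rnorm (f x) ^+ 2)%:C%C : R[i]^o) (l2_dot f f : R[i]^o).
Proof. by have := l2_dotP f f; under [X in has_sum X]eq_fun do rewrite hdotvv. Qed.

Lemma l2_dot_ge0 f : 0 <= complex.Re (l2_dot f f).
Proof.
have := has_sum_ge0_le (fun x => sqr_ge0 (rnorm (f x))) (l2_has_sum_sqr f) (s := [::]) isT.
by rewrite big_nil.
Qed.

Lemma l2_nrm_sqr f : l2_nrm f ^+ 2 = complex.Re (l2_dot f f).
Proof. by rewrite sqr_sqrtr ?l2_dot_ge0. Qed.

Lemma l2_dotvv f : l2_dot f f = (l2_nrm f ^+ 2)%:C%C.
Proof.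
rewrite l2_nrm_sqr; have := l2_dotC f f; case: (l2_dot f f) => a b /= [].
by move=> bb; congr (_ +i* _)%C; lra.
Qed.

Lemma l2_sum_le f s : uniq s -> \sum_(x <- s) rnorm (f x) ^+ 2 <= l2_nrm f ^+ 2.
Proof.
move=> us; rewrite l2_nrm_sqr.
exact: has_sum_ge0_le (fun x => sqr_ge0 (rnorm (f x))) (l2_has_sum_sqr f) us.
Qed.

Lemma l2_nrm_le f c : 0 <= c ->
  (forall s, uniq s -> \sum_(x <- s) rnorm (f x) ^+ 2 <= c ^+ 2) -> l2_nrm f <= c.
Proof.
move=> c0 fc; rewrite -(@ler_pXn2r _ 2)// ?nnegrE ?sqrtr_ge0// l2_nrm_sqr.
exact: has_sum_le (l2_has_sum_sqr f) fc.
Qed.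

Lemma l2_coord_le f x : rnorm (f x) <= l2_nrm f.
Proof.
rewrite -(@ler_pXn2r _ 2)// ?nnegrE ?sqrtr_ge0 ?rnorm_ge0//.
by have := l2_sum_le f (s := [:: x]) isT; rewrite big_seq1.
Qed.

Lemma l2_nrm_eq0 f : l2_nrm f = 0 -> f = 0.
Proof.
move=> f0; apply: l2_eq => x; apply: rnorm_le0.
by rewrite (le_trans (l2_coord_le f x))// f0.
Qed.

Lemma l2_nrmZ (a : R[i]) f : l2_nrm (a *: f) = rnorm (a : R[i]^o) * l2_nrm f.
Proof.
apply/eqP; rewrite -(@eqrXn2 _ 2)// ?mulr_ge0 ?sqrtr_ge0 ?rnorm_ge0//.
rewrite exprMn !l2_nrm_sqr.
have E g h : l2_dot (a *: g) h = a * l2_dot g h.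
  have l0 : l2_dot 0 h = 0.
    have := l2_dotPl 1 0 0 h; rewrite scale1r addr0 mul1r => /eqP.
    by rewrite -subr_eq subrr eq_sym => /eqP.
  by have := l2_dotPl a g 0 h; rewrite addr0 l0 addr0.
rewrite E l2_dotC E rmorphM/= mulrA -normCK -l2_dotC l2_dotvv rnormE -rmorphXn -rmorphM/=.
by [].
Qed.

(** Minkowski's inequality, proved coordinatewise because the inner product lemmas presuppose a
    normed space. The weights [q / p] and [p / q] are chosen so that the summed bounds equal
    [(p + q)^2]; a vanishing norm is treated apart. *)
Lemma l2_nrmD f g : l2_nrm (f + g) <= l2_nrm f + l2_nrm g.
Proof.
have f0 : 0 <= l2_nrm f by rewrite sqrtr_ge0.
have g0 : 0 <= l2_nrm g by rewrite sqrtr_ge0.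
apply: l2_nrm_le => [|s us]; first by rewrite addr_ge0.
have sub (a b : V) : rnorm (a + b) ^+ 2 <= (rnorm a + rnorm b) ^+ 2.
  by rewrite ler_pXn2r ?nnegrE ?addr_ge0 ?rnorm_ge0// rnormD.
have := f0; rewrite le_eqVlt => /predU1P[/esym/l2_nrm_eq0 ->|fp].
  by rewrite add0r (_ : l2_nrm 0 = 0) ?add0r ?l2_sum_le// -(scale0r 0) l2_nrmZ rnorm0 mul0r.
have := g0; rewrite le_eqVlt => /predU1P[/esym/l2_nrm_eq0 ->|gp].
  by rewrite addr0 (_ : l2_nrm 0 = 0) ?addr0 ?l2_sum_le// -(scale0r 0) l2_nrmZ rnorm0 mul0r.
set p := l2_nrm f in fp f0 *; set q := l2_nrm g in gp g0 *.
apply: (@le_trans _ _ (\sum_(x <- s) ((1 + q / p) * rnorm (f x) ^+ 2 + (1 + p / q) * rnorm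
    (g x) ^+ 2))).
  apply: ler_sum => x _; rewrite (le_trans (sub _ _))//.
  set a := rnorm (f x); set b := rnorm (g x).
  (* [2 a b <= (q / p) a^2 + (p / q) b^2] *)
  rewrite -subr_ge0 (_ : _ - _ = (q * a - p * b) ^+ 2 / (p * q)); last first.
    by field; rewrite !gt_eqF.
  by rewrite divr_ge0 ?sqr_ge0// mulr_ge0.
rewrite big_split/= -!mulr_sumr.
have h1 := l2_sum_le f us; have h2 := l2_sum_le g us.
have k1 : 0 <= 1 + q / p by rewrite addr_ge0 ?divr_ge0.
have k2 : 0 <= 1 + p / q by rewrite addr_ge0 ?divr_ge0.
have -> : (p + q) ^+ 2 = (1 + q / p) * p ^+ 2 + (1 + p / q) * q ^+ 2.
  by field; rewrite !gt_eqF.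
by rewrite lerD// ler_wpM2l.
Qed.

Definition l2_norm f : R[i] := (l2_nrm f)%:C%C.

Lemma l2_normD f g : l2_norm (f + g) <= l2_norm f + l2_norm g.
Proof. by rewrite /l2_norm -rmorphD lecR l2_nrmD. Qed.

Lemma l2_normZ (a : R[i]) f : l2_norm (a *: f) = `|a| * l2_norm f.
Proof. by rewrite /l2_norm l2_nrmZ rmorphM/= -rnormE. Qed.

Lemma l2_norm_eq0 f : l2_norm f = 0 -> f = 0.
Proof. by move=> /(@complexI R); exact: l2_nrm_eq0. Qed.

HB.instance Definition _ := Lmodule_isNormed.Build R[i] l2
  l2_normD l2_normZ l2_norm_eq0.

Lemma rnorm_l2 f : rnorm f = l2_nrm f.
Proof. by []. Qed.

Lemma l2_bilinear : bilinear_for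
  (GRing.Scale.Law.clone _ _ ( *%R ) _) (GRing.Scale.Law.clone _ _ (Num.conj \; *%R) _)
  l2_dot.
Proof. by split=> h a f g; rewrite ?l2_dotPl ?l2_dotPr. Qed.

HB.instance Definition _ := @bilinear_isBilinear.Build R[i] l2 l2
  R[i] _ _ l2_dot l2_bilinear.

Lemma l2_hermitian f g : l2_dot f g = (-1) ^+ false * (l2_dot g f)^*.
Proof. by rewrite expr0 mul1r -l2_dotC. Qed.

HB.instance Definition _ := @isHermitianSesquilinear.Build R[i] l2 false
  Num.conj l2_dot l2_hermitian.

Lemma l2_dot_gt0 f : f != 0 -> 0 < l2_dot f f.
Proof.
move=> f0; rewrite l2_dotvv (ltcR 0) exprn_gt0// lt_neqAle sqrtr_ge0 andbT eq_sym.
by apply: contra f0 => /eqP/l2_nrm_eq0 ->.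
Qed.

HB.instance Definition _ := isDotProduct.Build R[i] l2 l2_dot l2_dot_gt0.

Lemma l2_normE f : l2_dot f f = `|f| ^+ 2.
Proof. by rewrite l2_dotvv rmorphXn. Qed.

Lemma rcvg_rnorm (W : normedModType R[i]) (u : nat -> W) (l : W) :
  rcvg u l -> (fun n => rnorm (u n)) @ \oo --> rnorm l.
Proof.
move=> ul; apply/cvgrPdist_lt => e /ul[N NP]; exists N => // n /= /NP h.
rewrite (le_lt_trans _ h)// ler_norml.
have := rnormD (l - u n) (u n); have := rnormD (u n - l) l.
rewrite !subrK [rnorm (l - _)]rnormBC => h1 h2; apply/andP; split; lra.
Qed.

Lemma l2_complete (u : nat -> l2) :
  (forall e : R, 0 < e -> exists N, forall m n,
     (N <= m)%N -> (N <= n)%N -> rnorm (u m - u n) < e) -> exists l, rcvg u l.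
Proof.
move=> uC.
have coordB f g x : (f - g) x = f x - g x by [].
have /choice[l ul] : forall x, exists w, rcvg (fun n => u n x) w.
  move=> x; apply: rcauchy_cvg => e /uC[N NP]; exists N => m n Nm Nn.
  by rewrite -coordB (le_lt_trans (l2_coord_le _ _))// NP.
(* The Cauchy estimate on a finite set of coordinates, with [m] sent to infinity. The bound does not
   depend on the set, so it holds for the l2 norm as well. *)
have key (e : R) : 0 < e -> exists N, forall n, (N <= n)%N -> forall s, uniq s ->
    \sum_(x <- s) rnorm (u n x - l x) ^+ 2 <= e ^+ 2.
  move=> e0; have [N NP] := uC _ e0; exists N => n Nn s us.
  have h x : (fun m => rnorm (u n x - u m x) ^+ 2) @ \oo --> rnorm (u n x - l x) ^+ 2.
    have h : (fun m => rnorm (u n x - u m x)) @ \oo --> rnorm (u n x - l x).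
      apply: rcvg_rnorm => d /(ul x)[M MP]; exists M => m /MP umd.
      by rewrite opprB [X in rnorm X]addrC addrA subrK rnormBC.
    exact: (cvgM h h).
  have hs : (fun m => \sum_(x <- s) rnorm (u n x - u m x) ^+ 2) @ \oo -->
      \sum_(x <- s) rnorm (u n x - l x) ^+ 2.
    by apply: cvg_big => //; exact: add_continuous.
  apply: (closed_cvg (fun x : R => x <= e ^+ 2) (@closed_le _ _) _ _ hs).
  exists N => // m /= Nm; rewrite (le_trans (l2_sum_le (u n - u m) us))//.
  by rewrite ler_pXn2r ?nnegrE ?sqrtr_ge0 ?(ltW e0)// ltW// NP.
have lP : l \in sqsummable.
  have [N /(_ N (leqnn _)) NP] := key 1 ltr01.
  have dP : (fun x => u N x - l x) \in sqsummable by apply/asboolP; exists (1 ^+ 2).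
  have -> : l = (-1) *: (fun x => u N x - l x) + (u N : X -> V).
    apply/funext => x; rewrite -[RHS]/((-1) *: (u N x - l x) + u N x).
    by rewrite scaleN1r opprB subrK.
  by apply: sqsummable_submod.2 => //; exact: l2_funP.
exists (L2 lP) => e e0; have e2 : 0 < e / 2 by rewrite divr_gt0.
have [N NP] := key _ e2; exists N => n Nn.
rewrite (@le_lt_trans _ _ (e / 2)) ?ltr_pdivrMr ?ltr_pMr ?ltr1n//.
by apply: l2_nrm_le; rewrite ?ltW//; exact: NP.
Qed.

HB.instance Definition _ := Uniform_isComplete.Build l2 (seq_complete l2_complete).

HB.instance Definition _ :=
  CompleteNormedModule_isHilbert.Build R l2 l2_normE.

End SquareSummable.

(** * Matrices with operator entries *)

(* The matrix algebras of both Roe algebras have entries in a set [E0] of elements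
   of [E] that act by bounded operators on a Hilbert space [V]. *)
Record operator_coefficients (R : realType) (V : hilbertType R) (E : lmodType R[i])
    (E0 : set E) (mul : E -> E -> E) (star : E -> E) (act : E -> V -> V) : Prop :=
  OperatorCoefficients {
  entry0 : E0 0 ;
  entryP : forall a x y, E0 x -> E0 y -> E0 (a *: x + y) ;
  entryM : forall x y, E0 x -> E0 y -> E0 (mul x y) ;
  entry_star : forall x, E0 x -> E0 (star x) ;
  actP : forall (a : R[i]) x y v, act (a *: x + y) v = a *: act x v + act y v ;
  act_linear : forall x, E0 x -> linear (act x) ;
  actM : forall x y v, act (mul x y) v = act x (act y v) ;
  act_star : forall x, E0 x ->
    forall u v, hdot (act x u) v = hdot u (act (star x) v) ;
  act_inj : forall x y, (forall v, act x v = act y v) -> x = y ;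
  entry_sqrt : forall x (r : R), E0 x -> star x = x -> 0 <= r -> r < 1 ->
    bounded_by (act x) r ->
    exists y, [/\ E0 y, star y = y, bounded_by (act y) r & y + y - mul y y = x]
}.

Section Coefficients.
Variables (R : realType) (V : hilbertType R) (E : lmodType R[i]) (E0 : set E).
Variables (mul : E -> E -> E) (star : E -> E) (act : E -> V -> V).
Hypothesis coef : operator_coefficients E0 mul star act.

Lemma actD x y v : act (x + y) v = act x v + act y v.
Proof. by have := actP coef 1 x y v; rewrite !scale1r. Qed.

Lemma act0 v : act 0 v = 0.
Proof. by have := actD 0 0 v; rewrite addr0 -{1}[act 0 v]addr0 => /addrI. Qed.

Lemma actZ a x v : act (a *: x) v = a *: act x v.
Proof. by have := actP coef a x 0 v; rewrite !addr0 act0 addr0. Qed.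

Lemma act_sum (I : Type) (r : seq I) (P : pred I) (F : I -> E) v :
  act (\sum_(i <- r | P i) F i) v = \sum_(i <- r | P i) act (F i) v.
Proof. by elim/big_ind2 : _ => [|x a y b <- <-|//]; rewrite ?act0 ?actD. Qed.

Lemma entryD x y : E0 x -> E0 y -> E0 (x + y).
Proof. by move=> hx hy; rewrite -[x]scale1r; exact: (entryP coef). Qed.

Lemma entryZ a x : E0 x -> E0 (a *: x).
Proof. by move=> hx; rewrite -[_ *: _]addr0; apply: (entryP coef) => //; exact: (entry0
    coef). Qed.

Lemma entry_sum (I : Type) (r : seq I) (P : pred I) (F : I -> E) :
  (forall i, E0 (F i)) -> E0 (\sum_(i <- r | P i) F i).
Proof. by move=> FE; elim/big_ind : _ => //; [exact: (entry0 coef)|exact: entryD]. Qed.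

Lemma act_bound_star x c : E0 x -> 0 <= c -> bounded_by (act x) c ->
  bounded_by (act (star x)) c.
Proof.
move=> xE c0 xc v; apply: hdot_rnorm_le; first by rewrite mulr_ge0 ?rnorm_ge0.
move=> u; rewrite hdotC -(act_star coef)// /rnorm norm_conjC.
by rewrite (le_trans (rnorm_hdot _ _))// mulrAC ler_wpM2r ?rnorm_ge0.
Qed.

Lemma act_starZ a x v : E0 x -> act (star (a *: x)) v = a^* *: act (star x) v.
Proof.
move=> xE; apply: hdot_injr => w; rewrite -(act_star coef); last exact: entryZ.
by rewrite actZ hdotZl hdotZr conjCK (act_star coef).
Qed.

Lemma starM x y : E0 x -> E0 y -> star (mul x y) = mul (star y) (star x).
Proof.
move=> xE yE; apply: (act_inj coef) => v; apply: hdot_injr => w.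
rewrite -(act_star coef); last exact: (entryM coef).
by rewrite !(actM coef) !(act_star coef).
Qed.

Lemma starK x : E0 x -> star (star x) = x.
Proof.
move=> xE; apply: (act_inj coef) => v; apply: hdot_injr => w.
rewrite -(act_star coef); last exact: (entry_star coef).
by rewrite hdotC -(act_star coef)// -hdotC.
Qed.

Lemma star0 : star 0 = 0.
Proof.
apply: (act_inj coef) => v; apply: hdot_injr => w.
by rewrite -(act_star coef) ?act0 ?hdot0l ?hdot0r//; exact: (entry0 coef).
Qed.

Variables (X : metricType R).
Hypothesis bgX : bounded_geometry X.

(** The open ball as a list; bounded geometry makes the ball finite, as [fset_set] requires to be
    meaningful. *)
Definition nbhd (S : R) (x : X) : seq X := fset_set [set y | mdist x y < S].

Lemma ball_finite S x : 0 < S -> finite_set [set y : X | mdist x y < S].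
Proof.
move=> S0; have [N /(_ x) NP] := bgX S0; apply: card_le_finite NP _.
exact: finite_II.
Qed.

Lemma nbhd_uniq S x : uniq (nbhd S x). Proof. exact: fset_uniq. Qed.

Lemma in_nbhd S x y : 0 < S -> (y \in nbhd S x) = (mdist x y < S).
Proof.
move=> S0; rewrite in_fset_set; last exact: ball_finite.
by apply/idP/idP => [/set_mem|/mem_set].
Qed.

Lemma size_nbhd S : 0 < S -> exists N, forall x, (size (nbhd S x) <= N)%N.
Proof.
move=> S0; have [N NP] := bgX S0; exists N => x.
by have /geq_card_fset_set := NP x.
Qed.

Lemma fsum_seq (A : nmodType) (f : X -> A) (s : seq X) : uniq s ->
  (forall z, z \notin s -> f z = 0) ->
  \sum_(z \in [set: X]) f z = \sum_(z <- s) f z.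
Proof.
move=> us fs; rewrite (@fsbigE _ _ _ _ _ s)//; last by move=> z _; exact: fs.
by apply: eq_bigl => z; rewrite in_setT.
Qed.

Definition roe_elem (T : X -> X -> E) := [/\ finite_propagation T,
  forall x y, E0 (T x y) &
  exists2 M : R, 0 <= M & forall x y, bounded_by (act (T x y)) M].

Definition mmul (T U : X -> X -> E) : X -> X -> E := matrix_mul mul T U.
Definition mstar (T : X -> X -> E) : X -> X -> E := matrix_star star T.

Lemma mul_entry0 x : mul 0 x = 0.
Proof. by apply: (act_inj coef) => v; rewrite (actM coef) !act0. Qed.

Lemma mulr_entry0 x : E0 x -> mul x 0 = 0.
Proof.
move=> xE; apply: (act_inj coef) => v.
by rewrite (actM coef) !act0 (linfun0 (act_linear coef xE)).
Qed.

Lemma mmul_seq (T U : X -> X -> E) x y (s : seq X) : uniq s ->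
  (forall z, z \notin s -> T x z = 0) ->
  mmul T U x y = \sum_(z <- s) mul (T x z) (U z y).
Proof. by move=> us sT; apply: fsum_seq => // z /sT ->; rewrite mul_entry0. Qed.

Definition propagation (S : R) (T : X -> X -> E) := forall x y, S <= mdist x y -> T x y = 0.

Lemma mmulE S (T U : X -> X -> E) x y : 0 < S -> propagation S T ->
  mmul T U x y = \sum_(z <- nbhd S x) mul (T x z) (U z y).
Proof.
move=> S0 ST; apply: mmul_seq => [|z]; first exact: nbhd_uniq.
by rewrite in_nbhd// -leNgt => /ST.
Qed.

Lemma act_mmul S (T U : X -> X -> E) x y v : 0 < S -> propagation S T ->
  act (mmul T U x y) v = \sum_(z <- nbhd S x) act (T x z) (act (U z y) v).
Proof.
move=> S0 ST; rewrite (mmulE _ _ _ S0 ST) act_sum; apply: eq_bigr => z _.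
exact: (actM coef).
Qed.

Lemma mstar_propagation S T : propagation S T -> propagation S (mstar T).
Proof. by move=> ST x y; rewrite metric_sym /mstar /matrix_star => /ST ->; rewrite star0.
    Qed.

Lemma roe_elem0 : roe_elem 0.
Proof.
split.
- by exists 1.
- by move=> x y; exact: (entry0 coef).
- by exists 0 => // x y v; rewrite act0 rnorm0 mul0r.
Qed.

Lemma roe_elemP (a : R[i]) T U : roe_elem T -> roe_elem U -> roe_elem (a *: T + U).
Proof.
move=> [[S S0 ST] TE [M M0 TM]] [[S' S'0 SU] UE [N N0 UN]]; split.
- exists (Order.max S S'); first by rewrite lt_max S0.
  move=> x y; rewrite ge_max => /andP[/ST h1 /SU h2].
  by rewrite -[LHS]/(a *: T x y + U x y) h1 h2 scaler0 addr0.
- by move=> x y; apply: (entryP coef).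
- exists (rnorm (a : R[i]^o) * M + N); first by rewrite addr_ge0 ?mulr_ge0 ?rnorm_ge0.
  move=> x y v; rewrite -[(a *: T + U) x y]/(a *: T x y + U x y) (actP coef).
  rewrite (le_trans (rnormD _ _))// mulrDl lerD ?UN// rnormZ -mulrA.
  by rewrite ler_wpM2l ?rnorm_ge0 ?TM.
Qed.

Lemma roe_elemD T U : roe_elem T -> roe_elem U -> roe_elem (T + U).
Proof. by move=> hT hU; rewrite -[T]scale1r; exact: roe_elemP. Qed.

Lemma roe_elemB T U : roe_elem T -> roe_elem U -> roe_elem (T - U).
Proof. by move=> hT hU; rewrite addrC -scaleN1r; exact: roe_elemP. Qed.

Lemma roe_elem_sum (I : Type) (r : seq I) (F : I -> X -> X -> E) :
  (forall i, roe_elem (F i)) -> roe_elem (\sum_(i <- r) F i).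
Proof. by move=> FE; elim/big_ind : _ => //; [exact: roe_elem0|exact: roe_elemD]. Qed.

Lemma roe_elem_mul T U : roe_elem T -> roe_elem U -> roe_elem (mmul T U).
Proof.
move=> [[S S0 ST] TE [M M0 TM]] [[S' S'0 SU] UE [N N0 UN]]; split.
- exists (S + S'); first exact: addr_gt0.
  move=> x y xy; rewrite (mmulE _ _ _ S0 ST); apply: big1_seq => z /=.
  rewrite in_nbhd// => xz; rewrite (SU z y) ?mulr_entry0//.
  have := metric_triangle x z y; lra.
- move=> x y; rewrite (mmulE _ _ _ S0 ST); apply: entry_sum => z.
  exact: (entryM coef).
- have [K KP] := size_nbhd S0; exists (K%:R * (M * N)); first by rewrite !mulr_ge0.
  move=> x y v; rewrite (act_mmul _ _ _ _ S0 ST) (le_trans (rnorm_sum _ _ _))//.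
  apply: (@le_trans _ _ (\sum_(z <- nbhd S x) M * N * rnorm v)).
    apply: ler_sum => z _; rewrite (le_trans (TM _ _ _))// -mulrA ler_wpM2l//.
    exact: UN.
  rewrite big_const_seq count_predT iter_addr addr0 -[leLHS]mulr_natl -!mulrA.
  by rewrite ler_wpM2r ?ler_nat ?KP// !mulr_ge0 ?rnorm_ge0.
Qed.

Lemma roe_elem_star T : roe_elem T -> roe_elem (mstar T).
Proof.
move=> [[S S0 ST] TE [M M0 TM]]; split.
- by exists S => //; exact: mstar_propagation.
- by move=> x y; apply: (entry_star coef).
- by exists M => // x y; exact: act_bound_star.
Qed.

Definition schur (k : X -> X -> R) (T : X -> X -> E) : X -> X -> E :=
  fun x y => (k x y)%:C%C *: T x y.

Lemma schur_propagation S k T : propagation S T -> propagation S (schur k T).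
Proof. by move=> ST x y /ST; rewrite /schur => ->; rewrite scaler0. Qed.

Lemma schur_bounded k (c M : R) T x y : `|k x y| <= c -> 0 <= M ->
  bounded_by (act (T x y)) M ->
  bounded_by (act (schur k T x y)) (c * M).
Proof.
move=> kc M0 TM v; rewrite /schur actZ rnormZr -mulrA.
by rewrite ler_pM ?rnorm_ge0 ?TM// mulr_ge0 ?rnorm_ge0.
Qed.

Lemma roe_elem_schur k (c : R) T : (forall x y, `|k x y| <= c) -> roe_elem T ->
  roe_elem (schur k T).
Proof.
move=> kc [[S S0 ST] TE [M M0 TM]]; split.
- by exists S => //; exact: schur_propagation.
- by move=> x y; exact: entryZ.
- have [x0|nX] := pselect (exists x : X, True); last first.
    by exists 0 => // x; exfalso; apply: nX; exists x.
  have c0 : 0 <= c by case: x0 => x _; exact: le_trans (kc x x).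
  by exists (c * M); [rewrite mulr_ge0|move=> x y; exact: schur_bounded].
Qed.

Definition roe_algebra : starAlg R := @StarAlg R (X -> X -> E) roe_elem mmul mstar.

End Coefficients.

(** * Colourings of bounded geometry spaces *)

Section Colouring.
Variables (R : realType) (X : metricType R).

Definition separated (r : R) (Z : set X) :=
  forall x y, Z x -> Z y -> x != y -> r <= mdist x y.

(** Zorn's lemma: separation concerns two points at a time, so it passes to unions of chains, and a
    point far from a maximal [Z] could be added to it. *)
Lemma maximal_separated (r : R) (Y : set X) : exists Z : set X,
  [/\ Z `<=` Y, separated r Z &
      forall x, Y x -> ~ Z x -> exists2 z, Z z & mdist x z < r].
Proof.
pose P (Z : set X) := Z `<=` Y /\ separated r Z.
have [F FP Ft|Z [[ZY Zr] Zmax]] := @Zorn_bigcup X P.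
  split; first by move=> x [A FA Ax]; exact: (FP _ FA).1.
  move=> x y [A FA Ax] [B FB By].
  by have [AB|BA] := Ft _ _ FA FB; [apply: (FP _ FB).2|apply: (FP _ FA).2] => //;
    [exact: AB|exact: BA].
exists Z; split => // x Yx Zx; apply: contrapT => nz.
have far z : Z z -> r <= mdist x z.
  by move=> Zz; rewrite leNgt; apply/negP => xz; apply: nz; exists z.
apply: (Zmax (Z `|` [set x])).
  by split; [move=> z; left|move=> h; apply: Zx; apply: h; right].
split; first by move=> z [/ZY//|->].
move=> a b [Za|->] [Zb|->] ab; [exact: Zr| |exact: far|by rewrite eqxx in ab].
by rewrite metric_sym; exact: far.
Qed.

(** Greedy colouring: [U m] is what remains after [m] colours, and the next class is a maximal
    separated subset of it. A point still uncoloured after [N + 1] rounds would have a point of each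
    of the [N + 1] disjoint classes in its ball of radius [r], which has at most [N] points. *)
Lemma bounded_geometry_colouring (r : R) : bounded_geometry X -> 0 < r ->
  exists (n : nat) (c : X -> 'I_n), forall x y, c x = c y -> x != y -> r <= mdist x y.
Proof.
move=> bgX r0; have [N NP] := size_nbhd bgX r0.
have /choice[Z ZP] := maximal_separated r.
pose U := fix U n := if n is m.+1 then U m `\` Z (U m) else [set: X].
have Umono m n : (m <= n)%N -> U n `<=` U m.
  elim: n => [|n IHn]; first by rewrite leqn0 => /eqP ->.
  by rewrite leq_eqVlt ltnS => /predU1P[->//|/IHn mn] x [/mn].
have Udisj m n x : (m < n)%N -> U n x -> ~ Z (U m) x by move=> /Umono h /h[].
have inU n x : (forall m, (m < n)%N -> ~ Z (U m) x) -> U n x.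
  elim: n => // n IHn h; split; last exact: h.
  by apply: IHn => m mn; apply: h; rewrite ltnS ltnW.
have /choice[c cP] : forall x, exists i : 'I_N.+1, Z (U i) x.
  move=> x; apply: contrapT => nx.
  have xU m : (m < N.+1)%N -> U m x /\ ~ Z (U m) x.
    move=> mN; split; last by move=> Zx; apply: nx; exists (Ordinal mN).
    by apply: inU => k km Zx; apply: nx; exists (Ordinal (ltn_trans km mN)).
  have /choice[z zP] : forall i : 'I_N.+1, exists z, Z (U i) z /\ mdist x z < r.
    move=> i; have [_ _ h] := ZP (U i); have [Ux Zx] := xU i (ltn_ord i).
    by have [z Zz xz] := h x Ux Zx; exists z.
  have ZU m y : Z (U m) y -> U m y by have [h _ _] := ZP (U m); exact: h.
  have z_inj : injective z.
    move=> i j zij; apply/val_inj => /=; apply/eqP; rewrite eqn_leq.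
    apply/andP; split; rewrite leqNgt; apply/negP => ij.
      have := Udisj _ _ (z i) ij (ZU _ _ (zP i).1); rewrite zij; apply.
      exact: (zP j).1.
    have := Udisj _ _ (z j) ij (ZU _ _ (zP j).1); rewrite -zij; apply.
    exact: (zP i).1.
  have := @uniq_leq_size _ [seq z i | i <- enum 'I_N.+1] (nbhd r x).
  rewrite map_inj_uniq// enum_uniq size_map size_enum_ord => /(_ isT) h.
  have : (N.+1 <= size (nbhd r x))%N.
    by apply: h => _ /mapP[i _ ->]; rewrite in_nbhd//; exact: (zP i).2.
  by rewrite ltnNge NP.
exists N.+1, c => x y cxy xy; have [_ h _] := ZP (U (c x)).
by apply: h => //; rewrite cxy.
Qed.

End Colouring.

(** * Representations of matrices of bounded propagation *)

Section Representations.
Variables (R : realType) (V : hilbertType R) (E : lmodType R[i]) (E0 : set E).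
Variables (mul : E -> E -> E) (star : E -> E) (act : E -> V -> V).
Hypothesis coef : operator_coefficients E0 mul star act.
Variables (X : metricType R).
Hypothesis bgX : bounded_geometry X.

Local Notation elem := (@roe_elem R V E E0 act X).
Local Notation mm := (@mmul R E mul X).
Local Notation ms := (@mstar R E star X).
Local Notation A := (@roe_algebra R V E E0 mul star act X).

Variables (W : hilbertType R) (pi : A -> W -> W).
Hypothesis pi_rep : star_representation pi.

Local Notation "<[ u , v ]>" := (hdot u v) (format "<[ u ,  v ]>").

Implicit Types (T U : X -> X -> E) (u v : W).

Lemma pi_bounded T : elem T -> bounded_operator (pi T).
Proof. by case: pi_rep => h _ _ _; exact: h. Qed.

Lemma pi_linear T : elem T -> linear (pi T).
Proof. by move=> /pi_bounded[]. Qed.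

Lemma pi_lin (a : R[i]) T U u : elem T -> elem U ->
  pi (a *: T + U) u = a *: pi T u + pi U u.
Proof. by case: pi_rep => _ h _ _ hT hU; rewrite h. Qed.

Lemma piM T U u : elem T -> elem U -> pi (mm T U) u = pi T (pi U u).
Proof. by case: pi_rep => _ _ h _ hT hU; rewrite -[mm T U]/(@sa_mul _ A T U) h. Qed.

Lemma pi_star T u v : elem T -> <[pi T u, v]> = <[u, pi (ms T) v]>.
Proof. by case: pi_rep => _ _ _ h hT; exact: h. Qed.

Lemma piD T U u : elem T -> elem U -> pi (T + U) u = pi T u + pi U u.
Proof. by move=> hT hU; have := pi_lin 1 u hT hU; rewrite !scale1r. Qed.

Lemma pi0 u : pi 0 u = 0.
Proof.
have e0 := roe_elem0 coef X; have := piD u e0 e0.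
by rewrite addr0 -{1}[pi 0 u]addr0 => /addrI.
Qed.

Lemma piZ (a : R[i]) T u : elem T -> pi (a *: T) u = a *: pi T u.
Proof.
by move=> hT; have := pi_lin a u hT (roe_elem0 coef X); rewrite addr0 pi0 addr0.
Qed.

Lemma piB T U u : elem T -> elem U -> pi (T - U) u = pi T u - pi U u.
Proof.
by move=> hT hU; rewrite addrC -scaleN1r pi_lin// scaleN1r addrC.
Qed.

Lemma pi_sum (I : Type) (r : seq I) (F : I -> X -> X -> E) u :
  (forall i, elem (F i)) -> pi (\sum_(i <- r) F i) u = \sum_(i <- r) pi (F i) u.
Proof.
move=> FE; elim: r => [|i r IHr]; first by rewrite !big_nil pi0.
by rewrite !big_cons piD ?IHr//; exact: (roe_elem_sum coef).
Qed.

Lemma pi_sqr T u : elem T -> rnorm (pi T u) ^+ 2 = complex.Re <[u, pi (mm (ms T) T) u]>.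
Proof.
by move=> hT; rewrite rnorm_sqr_Re pi_star// piM//; exact: (roe_elem_star coef).
Qed.

Definition diagonal (d : X -> E) : X -> X -> E := fun x y => if x == y then d x else 0.

Lemma diagonal_elem d (M : R) : (forall x, E0 (d x)) -> 0 <= M ->
  (forall x, bounded_by (act (d x)) M) -> elem (diagonal d).
Proof.
move=> dE M0 dM; split.
- exists 1 => // x y; rewrite /diagonal; case: eqVneq => // <-.
  by rewrite mdistxx leNgt ltr01.
- by move=> x y; rewrite /diagonal; case: eqP => _; [exact: dE|exact: (entry0 coef)].
- exists M => // x y; rewrite /diagonal; case: eqP => _ v; first exact: dM.
  by rewrite (act0 coef) rnorm0 mulr_ge0 ?rnorm_ge0.
Qed.

Lemma diagonal_mul d e :  (forall x, E0 (d x)) ->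
  mm (diagonal d) (diagonal e) = diagonal (fun x => mul (d x) (e x)).
Proof.
move=> dE; apply/funext => x; apply/funext => y.
rewrite (mmul_seq coef _ _ (s := [:: x]))//; last first.
  by move=> z; rewrite inE /diagonal eq_sym => /negbTE ->.
rewrite big_seq1 /diagonal eqxx; case: eqP => // _.
exact: (mulr_entry0 coef).
Qed.

Lemma diagonal_star d : ms (diagonal d) = diagonal (fun x => star (d x)).
Proof.
apply/funext => x; apply/funext => y; rewrite /mstar /matrix_star /diagonal eq_sym.
by case: eqP => [->//|_]; exact: (star0 coef).
Qed.

(** The square root is taken for [d^* d], of norm at most [r^2 < 1], entry by entry; the uniform
    bound on its entries is what makes the resulting diagonal matrix an element of the algebra. *)
Lemma diagonal_bound1 d (r : R) : (forall x, E0 (d x)) -> 0 <= r -> r < 1 ->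
  (forall x, bounded_by (act (d x)) r) ->
  forall u, rnorm (pi (diagonal d) u) <= rnorm u.
Proof.
move=> dE r0 r1 dr u.
have r2 : r ^+ 2 < 1 by rewrite expr_lt1.
have r20 : 0 <= r ^+ 2 by rewrite sqr_ge0.
have /choice[b bP] : forall x, exists y, [/\ E0 y, star y = y, bounded_by (act y) (r ^+ 2)
    & y + y - mul y y = mul (star (d x)) (d x)].
  move=> x; have sE := entry_star coef (dE x).
  apply: (entry_sqrt coef) => //.
  - exact: (entryM coef).
  - by rewrite (starM coef)// (starK coef).
  - move=> v; rewrite (actM coef) expr2 -mulrA.
    have h := act_bound_star coef (dE x) r0 (dr x).
    by rewrite (le_trans (h _))// ler_wpM2l// dr.
have bE x : E0 (b x) by case: (bP x).
have hb : elem (diagonal b).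
  by apply: diagonal_elem r20 _ => // x; case: (bP x).
have hd : elem (diagonal d) by exact: diagonal_elem r0 _.
have bs : ms (diagonal b) = diagonal b.
  by rewrite diagonal_star; congr diagonal; apply/funext => x; case: (bP x).
have bb : diagonal b + diagonal b - mm (diagonal b) (diagonal b)
    = mm (ms (diagonal d)) (diagonal d).
  rewrite diagonal_mul// diagonal_star diagonal_mul; last first.
    by move=> x; exact: (entry_star coef).
  apply/funext => x; apply/funext => y.
  rewrite -[LHS]/(diagonal b x y + diagonal b x y - diagonal (fun x => mul (b x) (b x)) x
      y).
  rewrite /diagonal; case: eqP => [_|_]; first by case: (bP x).
  by rewrite subr0 addr0.
have hbb := roe_elem_mul coef bgX hb hb.
have : 0 <= rnorm (u - pi (diagonal b) u) ^+ 2 by rewrite sqr_ge0.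
rewrite rnormB_sqr [rnorm (pi (diagonal b) u) ^+ 2]pi_sqr// bs.
have : rnorm (pi (diagonal d) u) ^+ 2 =
    2 * complex.Re <[u, pi (diagonal b) u]> - complex.Re <[u, pi (mm (diagonal b) (diagonal
        b)) u]>.
  rewrite pi_sqr// -bb piB ?piD//; last exact: (roe_elemD coef).
  by rewrite hdotBr hdotDr raddfB raddfD/=; ring.
move=> h1 h2; rewrite -(@ler_pXn2r _ 2)// ?nnegrE ?rnorm_ge0// h1; lra.
Qed.

Lemma diagonal_bound d (M : R) : (forall x, E0 (d x)) -> 0 <= M ->
  (forall x, bounded_by (act (d x)) M) ->
  forall u, rnorm (pi (diagonal d) u) <= M * rnorm u.
Proof.
move=> dE M0 dM u; have hd := diagonal_elem dE M0 dM.
(* The contraction property needs entries of norm strictly below one, so [d] is divided by [M + e];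
   this also covers [M = 0]. *)
suff key e : 0 < e -> rnorm (pi (diagonal d) u) <= (M + e) * rnorm u.
  apply/ler_addgt0Pl => e e0; have c0 : 0 < rnorm u + 1 by rewrite ltr_wpDl ?rnorm_ge0.
  rewrite (le_trans (key (e / (rnorm u + 1)) _)) ?divr_gt0// mulrDl [leRHS]addrC lerD2l.
  by rewrite -mulrA ler_piMr ?(ltW e0)// mulrC ler_pdivrMr// mul1r lerDl.
move=> e0; have Me0 : 0 < M + e by rewrite ltr_wpDl.
pose t := (M + e)^-1; have t0 : 0 < t by rewrite invr_gt0.
have := @diagonal_bound1 (fun x => t%:C%C *: d x) (M / (M + e)) _ _ _ _ u.
have -> : diagonal (fun x => t%:C%C *: d x) = t%:C%C *: diagonal d.
  apply/funext => x; apply/funext => y.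
  rewrite -[RHS]/(t%:C%C *: diagonal d x y) /diagonal.
  by case: eqP => // _; rewrite scaler0.
rewrite piZ// rnormZr gtr0_norm// ler_pdivrMl//; apply.
- by move=> x; exact: (entryZ coef).
- by rewrite divr_ge0// ltW.
- by rewrite ltr_pdivrMr// mul1r ltrDl.
- move=> x v; rewrite (actZ coef) rnormZr gtr0_norm// [M / _]mulrC -mulrA.
  by rewrite ler_wpM2l ?dM// ltW.
Qed.

Definition partial_translation T :=
  (forall x y y', T x y != 0 -> T x y' != 0 -> y = y') /\
  (forall x x' y, T x y != 0 -> T x' y != 0 -> x = x').

(** Here [T^* T] is diagonal: two nonzero entries in a row lie in the same column, which kills the
    off-diagonal terms, and a column has at most one nonzero entry, so each diagonal term is a
    single product of norm at most [M^2]. *)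
Lemma partial_translation_bound T (M : R) : elem T -> partial_translation T ->
  0 <= M -> (forall x y, bounded_by (act (T x y)) M) ->
  forall u, rnorm (pi T u) <= M * rnorm u.
Proof.
move=> hT [rowT colT] M0 TM u; have [[S S0 ST] TE _] := hT.
have hs := roe_elem_star coef hT.
pose d y := mm (ms T) T y y.
have dE y : E0 (d y) by have [_ h _] := roe_elem_mul coef bgX hs hT; exact: h.
have dM y : bounded_by (act (d y)) (M ^+ 2).
  move=> v; rewrite /d.
  have [[x xy]|nx] := pselect (exists x, T x y != 0).
    rewrite (mmul_seq coef _ _ (s := [:: x]))//; last first.
      move=> z; rewrite inE /mstar /matrix_star => zx.
      have [->|zy] := eqVneq (T z y) 0; first by rewrite (star0 coef).
      by rewrite (colT _ _ _ zy xy) eqxx in zx.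
    rewrite big_seq1 (actM coef) expr2 -mulrA.
    have h := act_bound_star coef (TE x y) M0 (TM x y).
    by rewrite (le_trans (h _))// ler_wpM2l// TM.
  rewrite (mmul_seq coef _ _ (s := [::]))//; last first.
    move=> z _; rewrite /mstar /matrix_star.
    have [->|zy] := eqVneq (T z y) 0; first by rewrite (star0 coef).
    by exfalso; apply: nx; exists z.
  by rewrite big_nil (act0 coef) rnorm0 mulr_ge0 ?sqr_ge0 ?rnorm_ge0.
have -> : rnorm (pi T u) <= M * rnorm u = (rnorm (pi T u) ^+ 2 <= (M * rnorm u) ^+ 2).
  by rewrite ler_pXn2r ?nnegrE ?mulr_ge0 ?rnorm_ge0.
have dT : mm (ms T) T = diagonal d.
  apply/funext => y; apply/funext => y'; rewrite /diagonal.
  case: eqP => [->//|yy'].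
  rewrite (mmulE coef bgX _ _ _ S0 (mstar_propagation coef ST)) big1_seq// => z _.
  rewrite /mstar /matrix_star.
  have [->|zy] := eqVneq (T z y) 0; first by rewrite (star0 coef) (mul_entry0 coef).
  have [->|zy'] := eqVneq (T z y') 0.
    by rewrite (mulr_entry0 coef)//; exact: (entry_star coef).
  by case: yy'; exact: rowT zy zy'.
rewrite pi_sqr// dT (le_trans (Re_hdot_le _ _))//.
apply: (@le_trans _ _ (rnorm u * (M ^+ 2 * rnorm u))).
  by rewrite ler_wpM2l ?rnorm_ge0//; apply: diagonal_bound => //; rewrite sqr_ge0.
by rewrite exprMn mulrCA -expr2.
Qed.

(** For a colouring with [2 S]-separated classes, the part of [T] with rows of colour [i] and
    columns of colour [j] is a partial translation: nonzero entries in one row sit in columns less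
    than [2 S] apart and of equal colour, and symmetrically. There are [n * n] parts. *)
Lemma propagation_bound (S : R) : 0 < S -> exists2 K : R, 0 <= K &
  forall T (M : R), elem T -> propagation S T -> 0 <= M ->
  (forall x y, bounded_by (act (T x y)) M) ->
  forall u, rnorm (pi T u) <= K * M * rnorm u.
Proof.
move=> S0; have [n [c cP]] := bounded_geometry_colouring bgX (addr_gt0 S0 S0).
exists ((n * n)%:R) => // T M hT ST M0 TM u.
pose k (ij : 'I_n * 'I_n) x y : R := ((c x == ij.1) && (c y == ij.2))%:R.
have k1 ij x y : `|k ij x y| <= 1 by rewrite /k ger0_norm ?ler0n// lern1 leq_b1.
have hk ij : elem (schur (k ij) T) by exact: (roe_elem_schur coef (c := 1)).
have TE : T = \sum_(ij <- enum {: 'I_n * 'I_n}) schur (k ij) T.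
  apply/funext => x; apply/funext => y; rewrite !fct_sumE big_enum/=.
  rewrite (bigD1 (c x, c y))//= /schur /k !eqxx scale1r big1 ?addr0// => -[i j].
  rewrite xpair_eqE /= ![_ == c _]eq_sym => /negbTE ->.
  by rewrite scale0r.
rewrite TE pi_sum// (le_trans (rnorm_sum _ _ _))//.
apply: (@le_trans _ _ (\sum_(ij <- enum {: 'I_n * 'I_n}) M * rnorm u)); last first.
  rewrite big_const_seq count_predT iter_addr addr0 -cardE card_prod !card_ord.
  by rewrite -mulrA mulr_natl.
apply: ler_sum => -[i j] _; apply: partial_translation_bound => //; last first.
  by move=> x y v; have := @schur_bounded _ _ _ E0 mul star act coef X (k (i, j)) 1 M T x y
      (k1 _ _ _) M0 (TM x y) v; rewrite mul1r.
have kn x y : schur (k (i, j)) T x y != 0 -> [/\ c x = i, c y = j & mdist x y < S].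
  move=> h; rewrite ltNge; split; last first.
  - by apply: contra h => /ST; rewrite /schur => ->; rewrite scaler0.
  - by move: h; rewrite /schur /k/=; case: (c y =P j) => //; rewrite andbF scale0r eqxx.
  - by move: h; rewrite /schur /k/=; case: (c x =P i) => //; rewrite scale0r eqxx.
split=> [x y y' /kn[_ yj xy] /kn[_ yj' xy']|x x' y /kn[xi _ xy] /kn[xi' _ xy']].
  apply/eqP; apply: contraT => yy'; have := cP y y'; rewrite yj yj' => /(_ erefl yy').
  have := metric_triangle y x y'; rewrite (metric_sym y x); lra.
apply/eqP; apply: contraT => yy'; have := cP x x'; rewrite xi xi' => /(_ erefl yy').
have := metric_triangle x y x'; rewrite (metric_sym y x'); lra.
Qed.

End Representations.

(** * The reduced norm *)

(** If [t < s], then [K (t / s)^(2^n)] tends to [0] and cannot stay above [1]. This removes the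
    constant from estimates that hold for all powers. *)
Lemma le_of_pow2n (R : realType) (s t K : R) : 0 <= s -> 0 <= t -> 0 <= K ->
  (forall n, s ^+ (2 ^ n) <= K * t ^+ (2 ^ n)) -> s <= t.
Proof.
move=> s0 t0 K0 h; rewrite leNgt; apply/negP => ts.
have sp : 0 < s by exact: le_lt_trans ts.
pose z := t / s; have z0 : 0 <= z by rewrite divr_ge0.
have z1 : z < 1 by rewrite ltr_pdivrMr// mul1r.
have : `|z| < 1 by rewrite ger0_norm.
have K1 : 0 < (K + 1)^-1 by rewrite invr_gt0 ltr_wpDl.
move=> /cvg_expr/cvgrPdist_lt/(_ _ K1)[N _ /(_ N (leqnn _))].
rewrite sub0r normrN ger0_norm ?exprn_ge0// => zN.
have zN2 : z ^+ (2 ^ N) <= z ^+ N.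
  by apply: ler_wiXn2l; rewrite ?(ltW z1)// ltnW// ltn_expl.
have := h N; have -> : t = z * s by rewrite divfK// gt_eqF.
rewrite exprMn mulrA ler_pMl ?exprn_gt0//.
apply/negP; rewrite -ltNge (@le_lt_trans _ _ (K * (K + 1)^-1))//.
  by rewrite ler_wpM2l// (le_trans zN2)// ltW.
by rewrite ltr_pdivrMr ?mul1r ?ltrDl// ltr_wpDl.
Qed.

Lemma sum_seq_delta (A : nmodType) (J : eqType) (ws : seq J) (v : J) (a : A) :
  uniq ws -> \sum_(w <- ws) (if v == w then a else 0) = if v \in ws then a else 0.
Proof.
move=> uw; case: ifPn => vw.
  by rewrite (bigD1_seq v)//= eqxx big1 ?addr0// => w; rewrite eq_sym => /negbTE ->.
by rewrite big1_seq// => w /= ww; case: eqP => // vw'; rewrite vw' ww in vw.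
Qed.

Lemma ler_sum_support (R : numDomainType) (I : eqType) (g : I -> R) (s t : seq I) :
  uniq s -> uniq t -> (forall x, 0 <= g x) -> (forall x, x \notin t -> g x = 0) ->
  \sum_(x <- s) g x <= \sum_(x <- t) g x.
Proof.
move=> us ut g0 gt; pose u := undup (s ++ t); have uu : uniq u by exact: undup_uniq.
have su : {subset s <= u} by move=> x xs; rewrite mem_undup mem_cat xs.
have tu : {subset t <= u} by move=> x xs; rewrite mem_undup mem_cat xs orbT.
apply: (@le_trans _ _ (\sum_(x <- u) g x)).
  by rewrite (big_seq_split _ uu us su) lerDl sumr_ge0.
by rewrite (big_seq_split _ uu ut tu) [X in _ + X]big1 ?addr0.
Qed.

Section ReducedNorm.
Variables (R : realType) (V : hilbertType R) (E : lmodType R[i]) (E0 : set E).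
Variables (mul : E -> E -> E) (star : E -> E) (act : E -> V -> V).
Hypothesis coef : operator_coefficients E0 mul star act.
Variables (X : metricType R).
Hypothesis bgX : bounded_geometry X.

Local Notation elem := (@roe_elem R V E E0 act X).
Local Notation mm := (@mmul R E mul X).
Local Notation ms := (@mstar R E star X).
Implicit Types (T : X -> X -> E).

(* [reduced_le T c] says that [T] has norm at most [c] on l2(X, V). *)
Definition reduced_le T (c : R) := forall (xi : X -> V) (d : R), 0 <= d ->
  (forall s, uniq s -> \sum_(x <- s) rnorm (xi x) ^+ 2 <= d ^+ 2) ->
  forall s, uniq s -> \sum_(x <- s) rnorm (matrix_act act T xi x) ^+ 2 <= (c * d) ^+ 2.

Lemma matrix_act_seq T xi x s : uniq s -> elem T ->
  (forall y, y \notin s -> T x y = 0 \/ xi y = 0) ->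
  matrix_act act T xi x = \sum_(y <- s) act (T x y) (xi y).
Proof.
move=> us [_ TE _] sT; apply: fsum_seq => // y /sT[->|->]; first by rewrite (act0 coef).
by rewrite (linfun0 (act_linear coef (TE x y))).
Qed.

Lemma reduced_le_entry T c : elem T -> 0 <= c -> reduced_le T c ->
  forall x y, bounded_by (act (T x y)) c.
Proof.
move=> hT c0 Tc x y v; pose xi z := if z == y then v else 0.
have := Tc xi (rnorm v) (rnorm_ge0 v) _ [:: x] isT.
rewrite big_seq1 (matrix_act_seq (s := [:: y]))//; last first.
  by move=> z; rewrite inE /xi => /negbTE ->; right.
rewrite big_seq1 [xi y]/xi eqxx ler_pXn2r ?nnegrE ?mulr_ge0 ?rnorm_ge0//; apply.
move=> s us; have [ys|ys] := boolP (y \in s).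
  rewrite (bigD1_seq y)//= /xi eqxx big1 ?addr0// => z /negbTE ->.
  by rewrite rnorm0 expr0n.
rewrite big1_seq ?sqr_ge0// => z /= zs; rewrite /xi; case: eqP => [zy|_].
  by rewrite zy (negbTE ys) in zs.
by rewrite rnorm0 expr0n.
Qed.

(** Blocks are the fibres of [b] over the values [Some z]. Points sent to [None] lie in no block and
    are not related even to themselves. *)
Definition same_block (b : X -> option X) x y := (b x == b y) && (b x != None).

(** On the rows of a block, the compressed matrix acts as [T] does on the restriction of [xi] to
    that block. The bound for [T] is applied to each restriction, and their square norms add up to
    at most that of [xi]. *)
Lemma reduced_le_compress (b : X -> option X) T (c : R) : elem T -> 0 <= c ->
  reduced_le T c -> reduced_le (schur (fun x y => (same_block b x y)%:R) T) c.
Proof.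
move=> hT c0 Tc xi d d0 xid s us; have [[S S0 ST] TE _] := hT.
set T' := schur _ T.
have hT' : elem T'.
  by apply: (roe_elem_schur coef (c := 1)) => // x y; rewrite ger0_norm// lern1 leq_b1.
(* All columns that can meet a row in [s]; cutting [xi] down to [Y] keeps every sum finite. *)
pose Y := undup (flatten [seq nbhd S x | x <- s]).
have uY : uniq Y by exact: undup_uniq.
have inY x y : x \in s -> y \notin Y -> T x y = 0.
  move=> xs; rewrite mem_undup => yY; apply: ST; rewrite leNgt; apply: contra yY => xy.
  by apply/flattenP; exists (nbhd S x); [exact: map_f|rewrite in_nbhd].
pose xi' w y := if (b y == w) && (w != None) && (y \in Y) then xi y else 0.
have T'E x : x \in s -> matrix_act act T' xi x = matrix_act act T (xi' (b x)) x.
  move=> xs; rewrite (matrix_act_seq (s := Y))//; last first.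
    by move=> y yY; left; rewrite /T' /schur (inY x y)// scaler0.
  rewrite (matrix_act_seq (s := Y))//; last by move=> y yY; left; exact: inY.
  rewrite big_seq [RHS]big_seq; apply: eq_bigr => y yY.
  rewrite /T' /schur /xi' /same_block (actZ coef) yY andbT [b y == b x]eq_sym.
  case: ifP => _; first by rewrite scale1r.
  by rewrite scale0r (linfun0 (act_linear coef (TE x y))).
pose ws := undup [seq b x | x <- s]; have uw : uniq ws by exact: undup_uniq.
pose q w := \sum_(y <- Y) rnorm (xi' w y) ^+ 2.
have q0 w : 0 <= q w by rewrite sumr_ge0// => y _; rewrite sqr_ge0.
have xi'q w t : uniq t -> \sum_(y <- t) rnorm (xi' w y) ^+ 2 <= Num.sqrt (q w) ^+ 2.
  move=> ut; rewrite sqr_sqrtr//; apply: ler_sum_support => // y.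
    by rewrite sqr_ge0.
  by move=> /negbTE yY; rewrite /xi' yY andbF rnorm0 expr0n.
have xs_ws x : x \in s -> b x \in ws by move=> xs; rewrite mem_undup map_f.
have -> : \sum_(x <- s) rnorm (matrix_act act T' xi x) ^+ 2 =
    \sum_(w <- ws) \sum_(x <- s)
      if b x == w then rnorm (matrix_act act T (xi' w) x) ^+ 2 else 0.
  rewrite exchange_big/= big_seq [RHS]big_seq; apply: eq_bigr => x xs.
  rewrite T'E//; have := sum_seq_delta (b x) (rnorm (matrix_act act T (xi' (b x)) x) ^+ 2)
      uw.
  rewrite xs_ws// => <-; apply: eq_bigr => w _.
  by case: eqP => // ->.
apply: (@le_trans _ _ (\sum_(w <- ws) c ^+ 2 * q w)).
  apply: ler_sum => w _.
  apply: (@le_trans _ _ (\sum_(x <- s) rnorm (matrix_act act T (xi' w) x) ^+ 2)).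
    by apply: ler_sum => x _; case: ifP => // _; rewrite sqr_ge0.
  rewrite -[q w]sqr_sqrtr// -exprMn.
  by apply: Tc => // t ut; exact: xi'q.
rewrite -mulr_sumr exprMn ler_wpM2l ?sqr_ge0//.
apply: (@le_trans _ _ (\sum_(y <- Y) rnorm (xi y) ^+ 2)); last exact: xid.
rewrite exchange_big/=; apply: ler_sum => y _.
apply: (@le_trans _ _ (\sum_(w <- ws) if b y == w then rnorm (xi y) ^+ 2 else 0)).
  apply: ler_sum => w _; rewrite /xi'; case: (b y == w) => /=.
    by case: ifP => // _; rewrite rnorm0 expr0n sqr_ge0.
  by rewrite rnorm0 expr0n.
by rewrite sum_seq_delta//; case: ifP => // _; rewrite sqr_ge0.
Qed.

End ReducedNorm.

(** * Property A *)

Section KernelOfPropertyA.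
Variables (R : realType) (X : metricType R).
Hypothesis bgX : bounded_geometry X.

Lemma esum_seq (f : X -> R) (s : seq X) : uniq s -> (forall z, 0 <= f z) ->
  (forall z, z \notin s -> f z = 0) ->
  \esum_(z in [set: X]) (f z)%:E = (\sum_(z <- s) f z)%:E.
Proof.
move=> us f0 fs.
have -> : \esum_(z in [set: X]) (f z)%:E = \esum_(z in [set` s]) (f z)%:E.
  rewrite [RHS]esum_mkcond; apply: eq_esum => z _; case: ifPn => // zs.
  by rewrite fs//; apply: contra zs => zs; exact/mem_set.
rewrite esum_fset; [|exact: finite_seq|by move=> z _; rewrite lee_fin].
by rewrite -fsbig_seq// sumEFin.
Qed.

(* With [c] a colouring whose classes are [2 S]-separated, at most one point of each
   colour lies in a given ball of radius [S]; so the kernel [<xi_x, xi_y>] is a finite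
   sum, over the colours, of kernels [D_i(x) e_i(x, y) D_i(y)] with [e_i] the indicator
   of a partition into uniformly bounded blocks. *)
Lemma propertyA_kernel (r e : R) : propertyA X -> 0 < r -> 0 < e ->
  exists (n : nat) (D : 'I_n -> X -> R) (b : 'I_n -> X -> option X) (S : R),
  [/\ 0 < S, forall i x, `|D i x| <= 1,
      forall x, \sum_(i < n) D i x ^+ 2 = 1,
      forall i x y, same_block (b i) x y -> mdist x y < S
    & forall x y, mdist x y <= r ->
        `|1 - \sum_(i < n) D i x * (same_block (b i) x y)%:R * D i y| < e].
Proof.
move=> pA r0 e0; have [xi [S [S0 xi01 xi1 xiS xie]]] := pA _ _ r0 e0.
have [n [c cP]] := bounded_geometry_colouring bgX (addr_gt0 S0 S0).
(* The point of colour [i] in the ball of radius [S] around [x], unique if it exists, labels the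
   block of [x]. Points with the same label are both close to it, hence less than [2 S] apart. *)
pose b (i : 'I_n) (x : X) := ohead [seq z <- nbhd S x | c z == i].
pose D (i : 'I_n) (x : X) := if b i x is Some z then xi x z else 0.
have sd (x y z : X) : mdist x z < S -> mdist y z < S -> mdist x y < S + S.
  move=> xz yz; have := metric_triangle x z y; rewrite (metric_sym z y); lra.
have bP i x z : (b i x == Some z) = (c z == i) && (mdist x z < S).
  rewrite /b; set l := [seq _ <- _ | _].
  have inl w : (w \in l) = (c w == i) && (mdist x w < S) by rewrite mem_filter in_nbhd.
  rewrite -inl; case El : l => [//|w t] /=.
  have wl : w \in l by rewrite El mem_head.
  rewrite -El; apply/eqP/idP => [[<-//]|zl].
  congr Some; apply/eqP; apply: contraT => wz.
  move: wl zl; rewrite !inl => /andP[/eqP cw xw] /andP[/eqP cz xz].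
  have := cP w z; rewrite cw cz => /(_ erefl wz).
  by rewrite leNgt; rewrite (sd w z x)// metric_sym.
have nbhd0 x z : z \notin nbhd S x -> xi x z = 0.
  by rewrite in_nbhd// => xz; apply/eqP; apply: contraNT xz => /xiS.
(* The terms are grouped by the colour of [z]. Colour [i] contributes only the point [b i x], and
   only if [b i y] is the same point, since otherwise [xi y] vanishes there. *)
have dotE x y : \sum_(z <- nbhd S x) xi x z * xi y z =
    \sum_(i < n) D i x * (same_block (b i) x y)%:R * D i y.
  have h z : xi x z * xi y z = \sum_(i < n) if c z == i then xi x z * xi y z else 0.
    by rewrite (bigD1 (c z))//= eqxx big1 ?addr0// => i; rewrite eq_sym => /negbTE ->.
  under eq_bigr => z _ do rewrite h.
  rewrite exchange_big/=; apply: eq_bigr => i _.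
  rewrite /D /same_block.
  case Ebx : (b i x) => [z0|]; last first.
    rewrite !mul0r big_seq big1// => z; rewrite in_nbhd// => xz.
    by case: ifP => // cz; have := bP i x z; rewrite cz xz Ebx.
  have := bP i x z0; rewrite Ebx eqxx => /esym/andP[cz0 xz0].
  rewrite (bigD1_seq z0) ?in_nbhd//=; last exact: nbhd_uniq.
  rewrite cz0 big_seq_cond big1 ?addr0; last first.
    move=> z; rewrite in_nbhd// => /andP[xz zz0]; case: ifP => // cz.
    have := bP i x z; rewrite cz xz Ebx => /eqP[zE].
    by rewrite zE eqxx in zz0.
  have := bP i y z0; rewrite cz0/=; case: (b i y) => [z1|] /=.
    case: eqP => [[->] _|ne /esym/negbT yz0]; first by rewrite eqxx mulr1.
    have -> : (Some z0 == Some z1) = false by apply/eqP => -[E]; apply: ne; rewrite E.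
    by rewrite mulr0 mul0r (nbhd0 y z0) ?mulr0// in_nbhd.
  by move=> /esym/negbT yz0; rewrite mulr0 (nbhd0 y z0) ?mulr0// in_nbhd.
have xi_ge0 x z : 0 <= xi x z by case/andP: (xi01 x z).
have dot x y : l2dot (xi x) (xi y) = \sum_(z <- nbhd S x) xi x z * xi y z.
  rewrite /l2dot (esum_seq (s := nbhd S x)) ?nbhd_uniq//.
    by move=> z; rewrite mulr_ge0.
  by move=> z /nbhd0 ->; rewrite mul0r.
exists n, D, b, (S + S); split=> //.
- exact: addr_gt0.
- move=> i x; rewrite /D; case: (b i x) => [z|]; last by rewrite normr0.
  by rewrite ger0_norm//; case/andP: (xi01 x z).
- move=> x.
  have -> : \sum_(i < n) D i x ^+ 2 = \sum_(z <- nbhd S x) xi x z ^+ 2.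
    rewrite (eq_bigr _ (fun z _ => expr2 (xi x z))) dotE; apply: eq_bigr => i _.
    rewrite /same_block eqxx/= /D; case: (b i x) => [z|] /=; rewrite ?mulr1 ?expr2//.
    by rewrite !mul0r.
  have := xi1 x; rewrite /l2norm (esum_seq (s := nbhd S x)) ?nbhd_uniq//; last first.
  - by move=> z /nbhd0 ->; rewrite expr0n.
  - by move=> z; rewrite sqr_ge0.
  set a := \sum_(_ <- _) _; have a0 : 0 <= a by rewrite sumr_ge0// => z _; rewrite sqr_ge0.
  rewrite poweR_EFin => -[]; rewrite powR12_sqrt// => /(congr1 (fun t => t ^+ 2)).
  by rewrite sqr_sqrtr// expr1n.
- move=> i x y /andP[/eqP bxy]; case Ebx : (b i x) => [z|//] _.
  have := bP i x z; have := bP i y z; rewrite -bxy Ebx eqxx.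
  by move=> /esym/andP[_ yz] /esym/andP[_ xz]; exact: sd xz yz.
- by move=> x y xy; rewrite -dotE -dot; exact: xie.
Qed.

End KernelOfPropertyA.

(** * Bounding an arbitrary representation by the reduced norm *)

Section RepresentationBound.
Variables (R : realType) (V : hilbertType R) (E : lmodType R[i]) (E0 : set E).
Variables (mul : E -> E -> E) (star : E -> E) (act : E -> V -> V).
Hypothesis coef : operator_coefficients E0 mul star act.
Variables (X : metricType R).
Hypothesis bgX : bounded_geometry X.
Hypothesis pA : propertyA X.

Local Notation elem := (@roe_elem R V E E0 act X).
Local Notation mm := (@mmul R E mul X).
Local Notation ms := (@mstar R E star X).
Local Notation A := (@roe_algebra R V E E0 mul star act X).

Variables (W : hilbertType R) (pi : A -> W -> W).
Hypothesis pi_rep : star_representation pi.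

(* [N] is the norm of [l2(X, V)], known only through its completion. *)
Variable N : (X -> X -> E) -> R.
Hypothesis N0 : forall T, elem T -> 0 <= N T.
Hypothesis N_red : forall T, elem T -> reduced_le act T (N T).
Hypothesis red_N : forall T c, elem T -> 0 <= c -> reduced_le act T c -> N T <= c.
Hypothesis N_star : forall T, elem T -> N (mm (ms T) T) = N T ^+ 2.

Local Notation "<[ u , v ]>" := (hdot u v) (format "<[ u ,  v ]>").
Implicit Types (T U : X -> X -> E) (u v : W).

Let elemM T U := @roe_elem_mul _ _ _ _ _ _ _ coef X bgX T U.
Let elem_star T := @roe_elem_star _ _ _ _ _ _ _ coef X T.
Let elem_schur k c T := @roe_elem_schur _ _ _ _ _ _ _ coef X k c T.

Lemma block_bound (b : X -> option X) (S : R) T : 0 < S ->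
  (forall x y, same_block b x y -> mdist x y < S) -> elem T ->
  (forall x y, T x y != 0 -> same_block b x y) ->
  forall u, rnorm (pi T u) <= N T * rnorm u.
Proof.
move=> S0 bS hT Tb u; have [K K0 KP] := propagation_bound coef bgX pi_rep S0.
(* [T] is generalised so that the induction hypothesis applies to [T^* T], which lives on the same
   blocks and thus has the same constant [K]. The step combines [|pi(T) u|^2 <= |u| |pi(T^* T) u|]
   with the C*-identity for [N]. *)
suff h : forall n T, elem T -> (forall x y, T x y != 0 -> same_block b x y) -> forall u,
    rnorm (pi T u) ^+ (2 ^ n) <= K * (N T * rnorm u) ^+ (2 ^ n).
  apply: (le_of_pow2n (K := K)) => [||//|n]; rewrite ?rnorm_ge0//.
    by rewrite mulr_ge0 ?rnorm_ge0 ?N0.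
  exact: h.
move=> {T hT Tb u}; elim => [|n IHn] T hT Tb u.
  rewrite expn0 !expr1 mulrA; apply: KP => //; last 2 first.
  - exact: N0.
  - by apply: (reduced_le_entry coef hT); [exact: N0|exact: N_red].
  move=> x y xy; apply/eqP; apply: contraTT xy => /Tb/bS.
  by rewrite ltNge.
have hTT := elemM (elem_star hT) hT.
have TTb x y : mm (ms T) T x y != 0 -> same_block b x y.
  have [[S' S'0 ST] TE _] := hT.
  rewrite (mmulE coef bgX _ _ _ S'0 (mstar_propagation coef ST)) => h.
  have [z] : exists z, mul (ms T x z) (T z y) != 0.
    apply: contrapT => nz; case/eqP: h; rewrite big1// => z _.
    by apply: contrapT => /eqP h; apply: nz; exists z.
  rewrite /mstar /matrix_star => h'.
  have zx : T z x != 0.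
    by apply: contraNneq h' => ->; rewrite (star0 coef) (mul_entry0 coef).
  have zy : T z y != 0.
    apply: contraNneq h' => ->; rewrite (mulr_entry0 coef)//.
    exact: (entry_star coef).
  have /andP[/eqP bzx zN] := Tb _ _ zx; have /andP[/eqP bzy _] := Tb _ _ zy.
  by rewrite /same_block -bzx -bzy eqxx.
have := IHn _ hTT TTb u; rewrite N_star//.
set p := rnorm _ => hp.
have sq : rnorm (pi T u) ^+ 2 <= rnorm u * p.
  by rewrite (pi_sqr coef pi_rep)// Re_hdot_le.
rewrite expnS exprM; apply: (@le_trans _ _ ((rnorm u * p) ^+ (2 ^ n))).
  by rewrite lerXn2r ?nnegrE ?sqr_ge0// mulr_ge0 ?rnorm_ge0.
rewrite exprMn (@le_trans _ _ (rnorm u ^+ (2 ^ n) * (K * (N T ^+ 2 * rnorm u) ^+ (2 ^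
    n))))//.
  by rewrite ler_wpM2l ?exprn_ge0 ?rnorm_ge0.
rewrite mulrCA -exprMn [X in _ <= K * X]exprM.
by rewrite (_ : rnorm u * (N T ^+ 2 * rnorm u) = (N T * rnorm u) ^+ 2)//; ring.
Qed.

(** The product of the scalar diagonal matrix [d] with [T], defined without requiring that diagonal
    to be a matrix over [E]. *)
Definition row_mul (d : X -> R) T : X -> X -> E := schur (fun x _ => d x) T.

(** Self-adjointness of the real diagonal [d], read off the matrix identity
    [(d B)^* Q = B^* (d Q)]. *)
Lemma row_mul_adjoint d B Q u v : (forall x, `|d x| <= 1) -> elem B -> elem Q ->
  <[pi (row_mul d B) u, pi Q v]> = <[pi B u, pi (row_mul d Q) v]>.
Proof.
move=> d1 hB hQ.
have hdB : elem (row_mul d B) by exact: (elem_schur (c := 1)).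
have hdQ : elem (row_mul d Q) by exact: (elem_schur (c := 1)).
rewrite !(pi_star pi_rep)// -!(piM pi_rep)//; try exact: elem_star.
congr (<[_, pi _ _]>); apply/funext => x; apply/funext => y.
have [[S S0 SB] BE _] := hB; have [_ QE _] := hQ.
apply: (act_inj coef) => w.
rewrite !(act_mmul coef bgX _ _ _ _ S0); last 2 first.
- exact: (mstar_propagation coef SB).
- exact: (mstar_propagation coef (schur_propagation _ SB)).
apply: eq_bigr => z _; rewrite /mstar /matrix_star /row_mul /schur.
rewrite (act_starZ coef)// (actZ coef) (linfunZ (act_linear coef (entry_star coef (BE z
    x)))).
by rewrite -[_^*]/((d z)%:C%C^*)%C conjc_real.
Qed.

(** The column of the [D i] is an isometry: moving one [D i] across the inner product leaves the sum
    of the [D i ^+ 2], which is [1]. *)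
Lemma row_mul_sqr_sum (I : finType) (D : I -> X -> R) B u :
  (forall i x, `|D i x| <= 1) -> (forall x, \sum_i D i x ^+ 2 = 1) -> elem B ->
  \sum_i rnorm (pi (row_mul (D i) B) u) ^+ 2 = rnorm (pi B u) ^+ 2.
Proof.
move=> D1 DD hB.
have hD i B' : elem B' -> elem (row_mul (D i) B') by exact: (elem_schur (c := 1)).
have sq i : rnorm (pi (row_mul (D i) B) u) ^+ 2 =
    complex.Re <[pi B u, pi (row_mul (D i) (row_mul (D i) B)) u]>.
  by rewrite rnorm_sqr_Re row_mul_adjoint//; exact: hD.
under eq_bigr => i _ do rewrite sq.
rewrite -raddf_sum/= -hdot_sumr rnorm_sqr_Re; congr (complex.Re <[_, _]>).
rewrite -(pi_sum coef pi_rep); last by move=> i; exact: hD (hD _ _ hB).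
congr (pi _ _); apply/funext => x; apply/funext => y; rewrite !fct_sumE.
rewrite -[RHS]scale1r -(rmorph1 (real_complex R)) -(DD x) rmorph_sum/= scaler_suml.
by apply: eq_bigr => i _; rewrite /row_mul /schur scalerA -rmorphM expr2.
Qed.

Lemma kernel_bound (n : nat) (D : 'I_n -> X -> R) (b : 'I_n -> X -> option X) (S : R) T :
  0 < S -> (forall i x, `|D i x| <= 1) -> (forall x, \sum_(i < n) D i x ^+ 2 = 1) ->
  (forall i x y, same_block (b i) x y -> mdist x y < S) -> elem T ->
  let k x y := \sum_(i < n) D i x * (same_block (b i) x y)%:R * D i y in
  elem (schur k T) -> forall u, rnorm (pi (schur k T) u) <= N T * rnorm u.
Proof.
move=> S0 D1 DD bS hT k hk.
pose e i x y : R := (same_block (b i) x y)%:R; pose Te i := schur (e i) T.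
have hTe i : elem (Te i).
  by apply: (elem_schur (c := 1)) => // x y; rewrite ger0_norm// lern1 leq_b1.
have hD i B : elem B -> elem (row_mul (D i) B) by exact: (elem_schur (c := 1)).
have TeN i u : rnorm (pi (Te i) u) <= N T * rnorm u.
  apply: (@le_trans _ _ (N (Te i) * rnorm u)).
    apply: (block_bound S0 (bS i) (hTe i)) => x y; rewrite /Te /schur /e.
    by case: same_block => //; rewrite scale0r eqxx.
  rewrite ler_wpM2r ?rnorm_ge0//; apply: red_N => //; first exact: N0.
  by apply: (reduced_le_compress coef bgX) => //; [exact: N0|exact: N_red].
have mulE B : elem B -> mm (schur k T) B = \sum_(i < n) row_mul (D i) (mm (Te i) (row_mul
    (D i) B)).
  move=> hB; have [[P P0 PT] TE _] := hT.
  apply/funext => x; apply/funext => y; apply: (act_inj coef) => w.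
  rewrite !fct_sumE (act_mmul coef bgX _ _ _ _ P0 (schur_propagation _ PT)) (act_sum coef).
  under [RHS]eq_bigr => i _.
    rewrite {1}/row_mul {1}/schur (actZ coef).
    rewrite (act_mmul coef bgX _ _ _ _ P0 (schur_propagation _ PT)) scaler_sumr.
    over.
  rewrite exchange_big/=; apply: eq_bigr => z _.
  rewrite /schur (actZ coef) /k rmorph_sum/= scaler_suml; apply: eq_bigr => i _.
  rewrite /Te /row_mul /schur !(actZ coef) (linfunZ (act_linear coef (TE x z))).
  by rewrite !scalerA !rmorphM.
have key B u : elem B ->
    rnorm (pi (mm (schur k T) B) u) <= N T * rnorm (pi B u).
  move=> hB; set Q := mm _ B; have hQ : elem Q by exact: elemM.
  have h : rnorm (pi Q u) ^+ 2 = \sum_(i < n)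
      complex.Re <[pi (Te i) (pi (row_mul (D i) B) u), pi (row_mul (D i) Q) u]>.
    rewrite rnorm_sqr_Re -[LHS]/(complex.Re <[pi Q u, pi Q u]>).
    rewrite {1}/Q mulE// (pi_sum coef pi_rep); last first.
      by move=> i; apply: (hD); apply: elemM => //; exact: hD.
    rewrite hdot_suml raddf_sum/=; apply: eq_bigr => i _.
    rewrite row_mul_adjoint//; last by apply: elemM => //; exact: hD.
    by rewrite (piM pi_rep)//; exact: hD.
  (* Each term is at most [N T p q <= ((N T p)^2 + q^2) / 2]. Summed over [i], the second halves
     give half of the left side, which is absorbed. *)
  have : rnorm (pi Q u) ^+ 2 <= \sum_(i < n) (2^-1 * (N T ^+ 2 * rnorm (pi (row_mul (D i)
      B) u) ^+ 2)
      + 2^-1 * rnorm (pi (row_mul (D i) Q) u) ^+ 2).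
    rewrite h; apply: ler_sum => i _; rewrite (le_trans (Re_hdot_le _ _))//.
    have := TeN i (pi (row_mul (D i) B) u).
    set a := rnorm _; set p := rnorm _; set q := rnorm _ => apq.
    have a0 : 0 <= a by exact: rnorm_ge0.
    have q0 : 0 <= q by exact: rnorm_ge0.
    apply: (@le_trans _ _ ((N T * p) * q)); first by rewrite ler_wpM2r.
    by rewrite -exprMn; have := sqr_ge0 (N T * p - q); nra.
  rewrite big_split/= -!mulr_sumr !row_mul_sqr_sum// => h2.
  rewrite -(@ler_pXn2r _ 2)// ?nnegrE ?mulr_ge0 ?rnorm_ge0 ?N0//.
  rewrite exprMn; lra.
have hks := elem_star hk.
have star_bound u : rnorm (pi (ms (schur k T)) u) <= N T * rnorm u.
  have := rnorm_ge0 (pi (ms (schur k T)) u).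
  rewrite le_eqVlt => /predU1P[<-|p0]; first by rewrite mulr_ge0 ?rnorm_ge0 ?N0.
  rewrite -(ler_pM2r p0) -expr2 rnorm_sqr_Re -(pi_star pi_rep)//.
  rewrite -(piM pi_rep)// (le_trans (Re_hdot_le _ _))//.
  rewrite (le_trans (ler_wpM2r (rnorm_ge0 u) (key _ u hks)))//.
  by rewrite mulrAC.
move=> u; have := rnorm_ge0 (pi (schur k T) u).
rewrite le_eqVlt => /predU1P[<-|p0]; first by rewrite mulr_ge0 ?rnorm_ge0 ?N0.
rewrite -(ler_pM2r p0) -expr2 rnorm_sqr_Re (pi_star pi_rep)//.
rewrite (le_trans (Re_hdot_le _ _))// (le_trans (ler_wpM2l (rnorm_ge0 u) (star_bound _)))//.
by rewrite mulrCA mulrA.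
Qed.

Lemma representation_le_reduced T : elem T -> forall u, rnorm (pi T u) <= N T * rnorm u.
Proof.
move=> hT u; have [[S S0 ST] TE [M M0 TM]] := hT.
have [K K0 KP] := propagation_bound coef bgX pi_rep S0.
apply/ler_addgt0Pl => e0 e00.
(* The entries of [T - schur k T] will be bounded by [e * M], so this part contributes at most
   [K e M |u|]; dividing [e0] by [c] keeps it below [e0]. *)
pose c := K * M * rnorm u + 1; have c0 : 0 < c by rewrite ltr_wpDl// !mulr_ge0 ?rnorm_ge0.
pose e := e0 / c; have ep : 0 < e by rewrite divr_gt0.
have [n [D [b [P [P0 D1 DD bP kP]]]]] := propertyA_kernel bgX pA S0 ep.
pose k x y := \sum_(i < n) D i x * (same_block (b i) x y)%:R * D i y.
(* A crude bound, which serves only to place [schur k T] in the algebra. *)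
have k1 x y : `|k x y| <= n%:R.
  rewrite (le_trans (ler_norm_sum _ _ _))//.
  apply: (@le_trans _ _ (\sum_(i < n) 1)); last by rewrite sumr_const card_ord.
  apply: ler_sum => i _; rewrite !normrM mulr_ile1// ?D1// mulr_ile1// ?D1//.
  by rewrite ger0_norm// lern1 leq_b1.
have hk : elem (schur k T) by exact: elem_schur k1 hT.
have -> : pi T u = pi (T - schur k T) u + pi (schur k T) u.
  by rewrite (piB pi_rep)// subrK.
rewrite (le_trans (rnormD _ _))// lerD//; last exact: (kernel_bound P0 D1 DD bP hT hk).
have Mx x y : bounded_by (act ((T - schur k T) x y)) (e * M).
  rewrite -[(T - schur k T) x y]/(T x y - schur k T x y).
  have [Sxy|xyS] := leP S (mdist x y).
    rewrite (ST _ _ Sxy) (schur_propagation k ST Sxy) subr0 => v.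
    by rewrite (act0 coef) rnorm0 mulr_ge0 ?rnorm_ge0// mulr_ge0// ltW.
  have -> : T x y - schur k T x y = schur (fun x y => 1 - k x y) T x y.
    by rewrite /schur rmorphB/= scalerBl scale1r.
  apply: (schur_bounded coef) => //; apply: ltW; exact: kP (ltW xyS).
apply: (le_trans (KP _ (e * M) _ _ _ Mx u)).
- exact: (roe_elemB coef).
- move=> x y Sxy; rewrite -[LHS]/(T x y - schur k T x y).
  by rewrite (ST _ _ Sxy) (schur_propagation k ST Sxy) subr0.
- by rewrite mulr_ge0// ltW.
have -> : K * (e * M) * rnorm u = e * (K * M * rnorm u) by ring.
apply: (@le_trans _ _ (e * c)); last by rewrite divfK// gt_eqF.
by rewrite ler_wpM2l ?(ltW ep)// lerDl.
Qed.

End RepresentationBound.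

(** * The regular representation *)

Section ReducedRepresentation.
Variables (R : realType) (V : hilbertType R) (E : lmodType R[i]) (E0 : set E).
Variables (mul : E -> E -> E) (star : E -> E) (act : E -> V -> V).
Hypothesis coef : operator_coefficients E0 mul star act.
Variables (X : metricType R).
Hypothesis bgX : bounded_geometry X.

Local Notation elem := (@roe_elem R V E E0 act X).
Local Notation mm := (@mmul R E mul X).
Local Notation ms := (@mstar R E star X).
Local Notation A := (@roe_algebra R V E E0 mul star act X).
Local Notation L := (l2 X V).
Local Notation "<[ u , v ]>" := (hdot u v) (format "<[ u ,  v ]>").

Variable N : (X -> X -> E) -> R.
Hypothesis N0 : forall T, elem T -> 0 <= N T.
Hypothesis N_red : forall T, elem T -> reduced_le act T (N T).
Implicit Types (T U : X -> X -> E) (f g : L).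

(** The default [0] is never reached for matrices of the algebra, whose action preserves square
    summability by [N_red]. *)
Definition l2_act T f : L := insubd (0 : L) (matrix_act act T f).

Lemma l2_actE T f : elem T -> l2_act T f = matrix_act act T f :> (X -> V).
Proof.
move=> hT; rewrite [LHS](@insubdK _ _ L)//; apply/asboolP.
exists ((N T * l2_nrm f) ^+ 2) => s us; apply: (N_red hT) us; first exact: sqrtr_ge0.
by move=> t ut; exact: l2_sum_le.
Qed.

Lemma l2_act_seq T f x s : uniq s -> elem T -> (forall y, y \notin s -> T x y = 0) ->
  l2_act T f x = \sum_(y <- s) act (T x y) (f y).
Proof.
move=> us hT sT; rewrite l2_actE// (matrix_act_seq coef (E0 := E0) (s := s))//.
by move=> y ys; left; exact: sT.
Qed.

Lemma l2_act_nbhd T S f x : 0 < S -> propagation S T -> elem T ->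
  l2_act T f x = \sum_(y <- nbhd S x) act (T x y) (f y).
Proof.
move=> S0 ST hT; apply: l2_act_seq => //; first exact: nbhd_uniq.
by move=> y; rewrite in_nbhd// -leNgt => /ST.
Qed.

Lemma l2_act_bound T f : elem T -> rnorm (l2_act T f) <= N T * rnorm f.
Proof.
move=> hT; rewrite rnorm_l2; apply: l2_nrm_le.
  by rewrite mulr_ge0 ?N0 ?rnorm_ge0.
move=> s us; rewrite l2_actE//; apply: (N_red hT) us; first exact: rnorm_ge0.
by move=> t ut; exact: l2_sum_le.
Qed.

Lemma reduced_le_l2_act T c : elem T -> 0 <= c -> bounded_by (l2_act T) c ->
  reduced_le act T c.
Proof.
move=> hT c0 Tc xi d d0 xid s us.
have xiP : xi \in @sqsummable R X V by apply/asboolP; exists (d ^+ 2).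
pose f : L := L2 xiP.
have fd : l2_nrm f <= d by exact: l2_nrm_le.
rewrite -[xi]/(l2_fun f) -l2_actE//.
rewrite (le_trans (l2_sum_le _ us))// lerXn2r ?nnegrE ?sqrtr_ge0// ?mulr_ge0//.
by rewrite (le_trans (Tc f))// ler_wpM2l.
Qed.

Lemma l2_act_linear T : elem T -> linear (l2_act T).
Proof.
move=> hT a f g; have [[S S0 ST] TE _] := hT; apply: l2_eq => x.
rewrite -[RHS]/(a *: l2_act T f x + l2_act T g x).
rewrite !(l2_act_nbhd _ _ S0 ST)// scaler_sumr -big_split/=; apply: eq_bigr => y _.
by rewrite -(act_linear coef (TE x y)).
Qed.

Definition l2_delta_fun (x : X) (v : V) : X -> V := fun y => if y == x then v else 0.

Lemma l2_delta_subproof x v : l2_delta_fun x v \in @sqsummable R X V.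
Proof.
apply/asboolP; exists (rnorm v ^+ 2) => s us.
apply: (@le_trans _ _ (\sum_(y <- s) if x == y then rnorm v ^+ 2 else 0)).
  apply: ler_sum => y _; rewrite /l2_delta_fun eq_sym; case: eqP => // _.
  by rewrite rnorm0 expr0n.
by rewrite sum_seq_delta//; case: ifP => // _; rewrite sqr_ge0.
Qed.

Definition l2_delta x v : L := L2 (l2_delta_subproof x v).

Lemma l2_dot_fin f g s : uniq s -> (forall x, x \notin s -> g x = 0) ->
  <[f, g]> = \sum_(x <- s) <[f x, g x]>.
Proof.
move=> us sg; apply: (has_sum_unique (l2_dotP f g)).
by apply: has_sum_fin => // x /sg ->; rewrite hdot0r.
Qed.

(** Some finite list carries all of the square norm of [g] up to [e^2], and the truncation error is
    supported outside it. *)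
Lemma l2_truncation g (e : R) : 0 < e -> exists s : seq X,
  rnorm (g - \sum_(x <- s) l2_delta x (g x)) <= e.
Proof.
move=> e0; have [s us gs] : exists2 s : seq X, uniq s &
    l2_nrm g ^+ 2 - e ^+ 2 < \sum_(x <- s) rnorm (g x) ^+ 2.
  apply: contrapT => ns.
  have : l2_nrm g ^+ 2 <= l2_nrm g ^+ 2 - e ^+ 2.
    rewrite {1}l2_nrm_sqr; apply: has_sum_le (l2_has_sum_sqr g) _ => s us.
    by rewrite leNgt; apply/negP => h; apply: ns; exists s.
  by have := exprn_gt0 2 e0; lra.
exists s; set h := \sum_(x <- s) _.
set gh : L := g - h.
have hE y : gh y = if y \in s then 0 else g y.
  rewrite -[LHS]/(g y - h y).
  have -> : h y = \sum_(x <- s) if y == x then g y else 0.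
    rewrite /h; elim: (s) => [|x r IHr]; first by rewrite !big_nil.
    rewrite !big_cons -IHr -[LHS]/(l2_delta x (g x) y + _); congr (_ + _).
    by rewrite /= /l2_delta_fun; case: eqP => [->|].
  by rewrite sum_seq_delta//; case: ifP; rewrite ?subrr ?subr0.
apply: l2_nrm_le; first exact: ltW.
move=> t ut; pose u := undup (s ++ t); have uu : uniq u by exact: undup_uniq.
have su : {subset s <= u} by move=> x xs; rewrite mem_undup mem_cat xs.
have := l2_sum_le g uu; rewrite (big_seq_split _ uu us su).
suff : \sum_(x <- t) rnorm (gh x) ^+ 2 <= \sum_(x <- u | x \notin s) rnorm (g x) ^+ 2.
  move: gs; set a := \sum_(_ <- _) _; set b := \sum_(_ <- _) _; set c := \sum_(_ <- _ | _)
      _; lra.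
apply: (@le_trans _ _ (\sum_(x <- u) rnorm (gh x) ^+ 2)).
  have tu : {subset t <= u} by move=> x xt; rewrite mem_undup mem_cat xt orbT.
  by rewrite (big_seq_split _ uu ut tu) lerDl sumr_ge0// => x _; rewrite sqr_ge0.
rewrite [leRHS]big_mkcond; apply: ler_sum => x _; rewrite hE.
by case: (x \in s) => //=; rewrite rnorm0 expr0n.
Qed.

Lemma l2_dot_delta f x v : <[f, l2_delta x v]> = <[f x, v]>.
Proof.
rewrite (@l2_dot_fin _ _ [:: x])// => [|y].
  by rewrite big_seq1 /= /l2_delta_fun eqxx.
by rewrite inE /= /l2_delta_fun => /negbTE ->.
Qed.

Lemma l2_act_adjoint_delta T f x v : elem T ->
  <[l2_act T f, l2_delta x v]> = <[f, l2_act (ms T) (l2_delta x v)]>.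
Proof.
move=> hT; have [[S S0 ST] TE _] := hT.
have hs : elem (ms T) by exact: (roe_elem_star coef).
have sE y : l2_act (ms T) (l2_delta x v) y = act (star (T x y)) v.
  rewrite l2_actE// (matrix_act_seq coef (E0 := E0) (s := [:: x]))//; last first.
    by move=> z; rewrite inE /= /l2_delta_fun => /negbTE ->; right.
  by rewrite big_seq1 /= /l2_delta_fun eqxx.
rewrite l2_dot_delta (l2_act_nbhd _ _ S0 ST)// hdot_suml.
rewrite (@l2_dot_fin _ _ (nbhd S x)) ?nbhd_uniq//; last first.
  move=> y; rewrite in_nbhd// -leNgt => /ST Txy.
  by rewrite sE Txy (star0 coef) (act0 coef).
by apply: eq_bigr => y _; rewrite sE (act_star coef).
Qed.

(** The defect [F] is additive in [g], vanishes on finitely supported vectors and is bounded by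
    [C |g|]; truncation of [g] then shows that it is zero. *)
Lemma l2_act_adjoint T f g : elem T ->
  <[l2_act T f, g]> = <[f, l2_act (ms T) g]>.
Proof.
move=> hT; have hs : elem (ms T) by exact: (roe_elem_star coef).
pose F g : R[i]^o := <[l2_act T f, g]> - <[f, l2_act (ms T) g]>.
pose C := rnorm (l2_act T f) + rnorm f * N (ms T) + 1.
have C0 : 0 < C by rewrite ltr_wpDl// addr_ge0 ?mulr_ge0 ?rnorm_ge0 ?N0.
have FB g1 g2 : F (g1 - g2) = F g1 - F g2.
  rewrite /F hdotBr (linfunB (l2_act_linear hs)) hdotBr.
  have swap (a b c d : R[i]) : a - b - (c - d) = a - c - (b - d) by ring.
  exact: swap.
have Fsum s : F (\sum_(x <- s) l2_delta x (g x)) = 0.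
  rewrite /F (linfun_sum _ _ _ (l2_act_linear hs)) !hdot_sumr.
  by apply/eqP; rewrite subr_eq0; apply/eqP/eq_bigr => x _; exact: l2_act_adjoint_delta.
have Fle g1 : rnorm (F g1) <= C * rnorm g1.
  rewrite (le_trans (rnormD _ _))// rnormN.
  have h1 := rnorm_hdot (l2_act T f) g1.
  have h2 := rnorm_hdot f (l2_act (ms T) g1).
  have h3 : rnorm f * rnorm (l2_act (ms T) g1) <= rnorm f * (N (ms T) * rnorm g1).
    by rewrite ler_wpM2l ?rnorm_ge0// l2_act_bound.
  have := rnorm_ge0 g1; move: h1 h2 h3; rewrite /C.
  set a := rnorm (<[_, g1]> : R[i]^o); set b := rnorm (<[f, _]> : R[i]^o); lra.
suff : F g = 0 by move=> /eqP; rewrite subr_eq0 => /eqP.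
apply: rnorm_le0; apply/ler_addgt0Pl => e e0; rewrite addr0.
have [s gs] := l2_truncation g (divr_gt0 e0 C0).
rewrite -[F g]subr0 -(Fsum s) -FB (le_trans (Fle _))//.
by rewrite mulrC -ler_pdivlMr.
Qed.

Lemma l2_act_mul T U f : elem T -> elem U -> l2_act (mm T U) f = l2_act T (l2_act U f).
Proof.
move=> hT hU; have [[S S0 ST] TE _] := hT; have [[S' S'0 SU] UE _] := hU.
apply: l2_eq => x; pose Y := undup (flatten [seq nbhd S' z | z <- nbhd S x]).
have uY : uniq Y by exact: undup_uniq.
have inY z y : z \in nbhd S x -> y \notin Y -> U z y = 0.
  move=> xz; rewrite mem_undup => yY; apply: SU; rewrite leNgt; apply: contra yY => zy.
  by apply/flattenP; exists (nbhd S' z); [exact: map_f|rewrite in_nbhd].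
rewrite (l2_act_seq _ uY); last 2 first.
- exact: (roe_elem_mul coef).
- move=> y yY; rewrite (mmulE coef bgX _ _ _ S0 ST) big1_seq// => z /= xz.
  by rewrite (inY z y)// (mulr_entry0 coef).
rewrite (l2_act_nbhd _ _ S0 ST)//.
under eq_bigr => y _ do rewrite (act_mmul coef bgX _ _ _ _ S0 ST).
rewrite exchange_big/= big_seq [RHS]big_seq; apply: eq_bigr => z xz.
rewrite (l2_act_seq _ uY hU); last by move=> y; exact: inY.
by rewrite (linfun_sum _ _ _ (act_linear coef (TE x z))).
Qed.

Lemma l2_act_representation : @star_representation R A L l2_act.
Proof.
split.
- move=> T hT; apply/bounded_operatorP; split; first exact: l2_act_linear.
  by exists (N T); [exact: N0|move=> f; exact: l2_act_bound].
- move=> a T U hT hU; apply/funext => f; apply: l2_eq => x.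
  have [[S S0 ST] TE _] := hT; have [[S' S'0 SU] UE _] := hU.
  rewrite -[RHS]/(a *: l2_act T f x + l2_act U f x).
  pose M := Order.max S S'; have M0 : 0 < M by rewrite lt_max S0.
  have TM : propagation M T by move=> y z; rewrite ge_max => /andP[/ST].
  have UM : propagation M U by move=> y z; rewrite ge_max => /andP[_ /SU].
  rewrite !(l2_act_nbhd _ _ M0)//; last 2 first.
  - by move=> y z yz; rewrite -[LHS]/(a *: T y z + U y z) TM// UM// scaler0 addr0.
  - exact: (roe_elemP coef).
  rewrite scaler_sumr -big_split/=; apply: eq_bigr => y _.
  by rewrite -(actP coef).
- by move=> T U hT hU; apply/funext => f; exact: l2_act_mul.
- by move=> T hT f g; exact: l2_act_adjoint.
Qed.

End ReducedRepresentation.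

(** * Completions *)

Section CStarNorm.
Variables (R : realType) (B : cstarAlgType R).
Implicit Types x y : B.

Lemma rnorm_cmul x y : rnorm (cmul x y) <= rnorm x * rnorm y.
Proof. by rewrite -lecR rmorphM/= -!rnormE ler_normcM. Qed.

Lemma rnorm_cstar_sqr x : rnorm (cmul (cstar x) x) = rnorm x ^+ 2.
Proof. by apply: (@complexI R); rewrite rmorphXn/= -!rnormE normc_star. Qed.

Lemma rnorm_cstar x : rnorm (cstar x) = rnorm x.
Proof.
suff h y : rnorm y <= rnorm (cstar y).
  by apply/eqP; rewrite eq_le -{2}[x]cstarK !h.
have := rnorm_ge0 y; rewrite le_eqVlt => /predU1P[<-|y0]; first exact: rnorm_ge0.
by rewrite -(ler_pM2r y0) -expr2 -rnorm_cstar_sqr rnorm_cmul.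
Qed.

Lemma cmulBl x y (z : B) : cmul (x - y) z = cmul x z - cmul y z.
Proof. by rewrite cmulDl -scaleN1r cmulZl scaleN1r. Qed.

Lemma cmulBr x y (z : B) : cmul z (x - y) = cmul z x - cmul z y.
Proof. by rewrite cmulDr -scaleN1r cmulZr scaleN1r. Qed.

Lemma cstarB x y : cstar (x - y) = cstar x - cstar y.
Proof.
rewrite cstarD -scaleN1r cstarZ -[Num.conj _]/((- 1)^*) rmorphN rmorph1.
by rewrite scaleN1r.
Qed.

End CStarNorm.

Section LimitRelation.
Variables (R : realType) (A : starAlg R) (B B' : cstarAlgType R).
Variables (j : A -> B) (j' : A -> B').

(* The graph of the extension by continuity of [j T |-> j' T]. *)
Definition limit_rel (b : B) (b' : B') := forall e : R, 0 < e ->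
  exists T : A, [/\ sa_elem T, rnorm (j T - b) < e & rnorm (j' T - b') < e].

End LimitRelation.

Lemma limit_rel_sym (R : realType) (A : starAlg R) (B B' : cstarAlgType R)
    (j : A -> B) (j' : A -> B') b b' : limit_rel j j' b b' -> limit_rel j' j b' b.
Proof. by move=> h e /h[T [? ? ?]]; exists T. Qed.

Section Completion.
Variables (R : realType) (A : starAlg R).
Hypothesis elemP : forall (a : R[i]) (T S : A), sa_elem T -> sa_elem S -> sa_elem (a *: T +
    S).
Hypothesis elemM : forall T S : A, sa_elem T -> sa_elem S -> sa_elem (sa_mul T S).
Hypothesis elem_star : forall T : A, sa_elem T -> sa_elem (sa_star T).

Lemma cstar_completion_dense (N : A -> \bar R) (B : cstarAlgType R) (j : A -> B) :
  cstar_completion N j -> forall b (e : R), 0 < e ->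
  exists2 T, sa_elem T & rnorm (j T - b) < e.
Proof.
move=> [_ _ _ _ jd] b e e0.
have ec0 : 0 < e%:C%C :> R[i] by rewrite (ltcR 0).
have [||b' [bb' [T hT TE]]] := jd (ball b e%:C%C).
- by exists b; exact: ballxx.
- exact: ball_open.
exists T => //; rewrite TE; move: bb'; rewrite -ball_normE/= rnormE ltcR.
by rewrite rnormBC.
Qed.

Lemma cstar_completion_dist (N : A -> \bar R) (B : cstarAlgType R) (j : A -> B) :
  cstar_completion N j -> forall T S, sa_elem T -> sa_elem S ->
  (rnorm (j T - j S))%:E = N (- 1 *: S + T).
Proof.
move=> [jl _ _ jn _] T S hT hS; rewrite -jn; last exact: elemP.
by rewrite jl// scaleN1r addrC.
Qed.

Section TwoCompletions.
Variables (N N' : A -> \bar R) (B B' : cstarAlgType R) (j : A -> B) (j' : A -> B').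
Hypothesis NN' : forall T, sa_elem T -> N T = N' T.
Hypotheses (jC : cstar_completion N j) (jC' : cstar_completion N' j').

Lemma completion_isometry T S : sa_elem T -> sa_elem S ->
  rnorm (j T - j S) = rnorm (j' T - j' S).
Proof.
move=> hT hS; apply: EFin_inj; rewrite (cstar_completion_dist jC)//.
by rewrite (cstar_completion_dist jC')// NN'//; exact: elemP.
Qed.

Lemma limit_rel_ex b : exists b', limit_rel j j' b b'.
Proof.
have n0 n : 0 < n.+1%:R^-1 :> R by rewrite invr_gt0.
have /choice[T TP] : forall n : nat, exists T, sa_elem T /\ rnorm (j T - b) < n.+1%:R^-1.
  by move=> n; have [T hT Tb] := cstar_completion_dense jC b (n0 n); exists T.
have [|b' Tb'] := @rcauchy_cvg _ B' (fun n => j' (T n)).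
  move=> e e0; have e2 : 0 < e / 2 by rewrite divr_gt0.
  have [M MP] := natSinv_small e2; exists M => m n /MP hm /MP hn.
  have [h1 h2] := TP m; have [h3 h4] := TP n.
  rewrite -completion_isometry//.
  have -> : j (T m) - j (T n) = (j (T m) - b) - (j (T n) - b) by rewrite opprB addrA subrK.
  rewrite (le_lt_trans (rnormD _ _))// rnormN [ltRHS]splitr ltrD//; [exact: lt_trans h2
      hm|exact: lt_trans h4 hn].
exists b' => e e0; have [M MP] := natSinv_small e0; have [K KP] := Tb' _ e0.
have [h1 h2] := TP (maxn M K); exists (T (maxn M K)); split => //.
  by rewrite (lt_trans h2)// MP// leq_maxl.
by rewrite KP// leq_maxr.
Qed.

Lemma limit_rel_le a b a' b' : limit_rel j j' a a' -> limit_rel j j' b b' ->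
  rnorm (a' - b') <= rnorm (a - b).
Proof.
move=> aa' bb'; apply/ler_addgt0Pl => e e0; have e4 : 0 < e / 4 by rewrite divr_gt0.
have [T [hT Ta Ta']] := aa' _ e4; have [S [hS Sb Sb']] := bb' _ e4.
have -> : a' - b' = - (j' T - a') + ((j' T - j' S) + (j' S - b')).
  by rewrite [X in _ = _ + X]addrA subrK opprB addrA subrK.
have h1 := rnormD (- (j' T - a')) ((j' T - j' S) + (j' S - b')).
have h2 := rnormD (j' T - j' S) (j' S - b').
have E : j T - j S = (j T - a) + ((a - b) - (j S - b)).
  by rewrite opprB [X in _ = _ + X]addrA subrK addrA subrK.
have h3 := rnormD (j T - a) ((a - b) - (j S - b)).
have h4 := rnormD (a - b) (- (j S - b)).
move: h1 h2 h3 h4; rewrite -E !rnormN completion_isometry//.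
by move: Ta Ta' Sb Sb'; rewrite [e]splitr; lra.
Qed.

Lemma limit_rel_unique b b' b'' : limit_rel j j' b b' -> limit_rel j j' b b'' -> b' = b''.
Proof.
move=> h h'; apply/eqP; rewrite -subr_eq0; apply/eqP; apply: rnorm_le0.
by have := limit_rel_le h h'; rewrite subrr rnorm0.
Qed.

Lemma limit_rel_elem T : sa_elem T -> limit_rel j j' (j T) (j' T).
Proof. by move=> hT e e0; exists T; rewrite !subrr !rnorm0. Qed.

Lemma limit_rel_lin (k : R[i]) a b a' b' : limit_rel j j' a a' -> limit_rel j j' b b' ->
  limit_rel j j' (k *: a + b) (k *: a' + b').
Proof.
move=> aa' bb' e e0; have e2 : 0 < e / 2 by rewrite divr_gt0.
pose c := rnorm (k : R[i]^o) + 1; have c0 : 0 < c by rewrite ltr_wpDl// rnorm_ge0.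
have [T [hT Ta Ta']] := aa' _ (divr_gt0 e2 c0); have [S [hS Sb Sb']] := bb' _ e2.
have h (W : normedModType R[i]) (x y z t : W) : rnorm (x - z) < e / 2 / c ->
    rnorm (y - t) < e / 2 -> rnorm (k *: x + y - (k *: z + t)) < e.
  move=> xz yt; rewrite opprD addrACA -scalerBr (le_lt_trans (rnormD _ _))// [ltRHS]splitr.
  rewrite ler_ltD// rnormZ (@le_trans _ _ (c * rnorm (x - z)))//.
    by rewrite ler_wpM2r ?rnorm_ge0// /c lerDl.
  by rewrite mulrC -ler_pdivlMr// ltW.
exists (k *: T + S); split; first exact: elemP.
  by case: jC => -> // _ _ _ _; exact: h.
by case: jC' => -> // _ _ _ _; exact: h.
Qed.

Lemma limit_rel_mul a b a' b' : limit_rel j j' a a' -> limit_rel j j' b b' ->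
  limit_rel j j' (cmul a b) (cmul a' b').
Proof.
move=> aa' bb' e e0.
pose c := rnorm a + rnorm a' + rnorm b + rnorm b' + 1.
have c0 : 0 < c by rewrite ltr_wpDl// !addr_ge0 ?rnorm_ge0.
(* With [d <= 1], the approximating factors have norm at most [c], and the two error terms of the
   product are each below [d c <= e / 2]. *)
pose d := Order.min 1 (e / (2 * c)).
have d0 : 0 < d by rewrite lt_min ltr01 divr_gt0// mulr_gt0.
have d1 : d <= 1 by rewrite ge_min lexx.
have de : d * c <= e / 2.
  by rewrite -ler_pdivlMr// -mulrA -invfM ge_min lexx orbT.
have [T [hT Ta Ta']] := aa' _ d0; have [S [hS Sb Sb']] := bb' _ d0.
have h (W : cstarAlgType R) (x y z t : W) : rnorm z + 1 <= c -> rnorm t <= c ->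
    rnorm (x - z) < d -> rnorm (y - t) < d -> rnorm (cmul x y - cmul z t) < e.
  move=> zc tc xz yt.
  have -> : cmul x y - cmul z t = cmul x (y - t) + cmul (x - z) t.
    by rewrite cmulBl cmulBr addrA subrK.
  have h1 := rnormD (cmul x (y - t)) (cmul (x - z) t).
  have h2 := rnorm_cmul x (y - t); have h3 := rnorm_cmul (x - z) t.
  have h4 : rnorm x <= c.
    have := rnormD (x - z) z; rewrite subrK; lra.
  have h5 : rnorm x * rnorm (y - t) <= c * rnorm (y - t).
    by rewrite ler_wpM2r ?rnorm_ge0.
  have h6 : rnorm (x - z) * rnorm t <= rnorm (x - z) * c by rewrite ler_wpM2l ?rnorm_ge0.
  have h7 : c * rnorm (y - t) < c * d by rewrite ltr_pM2l.
  have h8 : rnorm (x - z) * c < d * c by rewrite ltr_pM2r.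
  move: de h7 h8; rewrite (mulrC c d); lra.
have := rnorm_ge0 a; have := rnorm_ge0 a'; have := rnorm_ge0 b; have := rnorm_ge0 b'.
move=> ? ? ? ?; exists (sa_mul T S); split; first exact: elemM.
  by case: jC => _ -> // _ _ _; apply: h => //; rewrite /c; lra.
by case: jC' => _ -> // _ _ _; apply: h => //; rewrite /c; lra.
Qed.

Lemma limit_rel_star a a' : limit_rel j j' a a' -> limit_rel j j' (cstar a) (cstar a').
Proof.
move=> aa' e /aa'[T [hT Ta Ta']]; exists (sa_star T); split; first exact: elem_star.
  by case: jC => _ _ -> // _ _; rewrite -cstarB rnorm_cstar.
by case: jC' => _ _ -> // _ _; rewrite -cstarB rnorm_cstar.
Qed.

End TwoCompletions.

(** The relation [limit_rel] is total and single-valued, hence the graph of a map; it is symmetric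
    in the two completions, so exchanging them gives the inverse. *)
Lemma completion_isomorphism (N N' : A -> \bar R) (B B' : cstarAlgType R)
    (j : A -> B) (j' : A -> B') :
  (forall T, sa_elem T -> N T = N' T) ->
  cstar_completion N j -> cstar_completion N' j' ->
  exists f : B -> B', unique (canonical_map j j') f /\ star_isomorphism f.
Proof.
move=> NN' jC jC'; have N'N T : sa_elem T -> N' T = N T by move=> /NN' ->.
have /choice[f fP] := limit_rel_ex NN' jC jC'.
have /choice[g gP] := limit_rel_ex N'N jC' jC.
have fU b b' : limit_rel j j' b b' -> f b = b'.
  exact: (limit_rel_unique NN' jC jC' (fP b)).
have gU b b' : limit_rel j' j b' b -> g b' = b.
  exact: (limit_rel_unique N'N jC' jC (gP b')).
have fhom : star_homomorphism f.
  split.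
  - by move=> k a b; apply: fU; apply: (limit_rel_lin jC jC').
  - by move=> a b; apply: fU; apply: (limit_rel_mul jC jC').
  - by move=> a; apply: fU; apply: (limit_rel_star jC jC').
exists f; split; last first.
  split => //; exists g => b; last by apply: fU; exact: limit_rel_sym (gP b).
  by apply: gU; exact: limit_rel_sym (fP b).
split.
  split => //; last by move=> T hT; apply: fU; exact: limit_rel_elem.
  move=> b; apply/cvgrPdist_lt => e e0; near=> a.
  rewrite rnormE; apply: le_lt_trans (_ : `|b - a| < e).
    by rewrite rnormE lecR; exact: (limit_rel_le NN' jC jC' (fP b) (fP a)).
  by near: a; exact: cvgr_dist_lt.
(* A competitor [f'] has the same graph: if [j T] is close to [b], then by continuity
   [j' T = f' (j T)] is close to [f' b]. *)
move=> f' [_ f'c f'j]; apply/funext => b; apply: fU => e e0.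
have ec0 : 0 < e%:C%C :> R[i] by rewrite (ltcR 0).
have /cvgrPdist_lt/(_ _ ec0)/nbhs_ballP[d /= d0 dP] := f'c b.
have /complex_realP[r rd] : d \is Num.real by rewrite gtr0_real.
move: d0 dP; rewrite rd (ltcR 0) => r0 rP.
have me0 : 0 < Order.min r e by rewrite lt_min r0.
have [T hT Tb] := cstar_completion_dense jC b me0.
move: Tb; rewrite lt_min => /andP[Tr Te]; exists T; split => //.
have := rP (j T); rewrite f'j// -ball_normE/= !rnormE !ltcR ![rnorm (_ - j _)]rnormBC.
by rewrite [rnorm (f' b - _)]rnormBC; exact.
Unshelve. all: by end_near. Qed.

End Completion.

(** * The two Roe algebras *)

Lemma l2norm_leP (R : realType) (X : metricType R) (f : X -> R) (c : R) : 0 <= c ->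
  (l2norm f <= c%:E)%E <-> (forall s, uniq s -> \sum_(x <- s) f x ^+ 2 <= c ^+ 2).
Proof.
move=> c0; rewrite /l2norm; set a := \esum_(_ in _) _.
have a0 : (0 <= a)%E by apply: esum_ge0 => x _; rewrite lee_fin sqr_ge0.
have -> : (a `^ 2^-1 <= c%:E)%E = (a <= (c ^+ 2)%:E)%E.
  case: a a0 => [r r0| _|//]; last by rewrite poweRyr ?invr_eq0// !leye_eq.
  rewrite poweR_EFin powR12_sqrt// !lee_fin.
  by rewrite -[in RHS](@sqr_sqrtr _ r)// ler_pXn2r ?nnegrE ?sqrtr_ge0.
split=> [ac s us|h].
  rewrite -lee_fin (le_trans _ ac)//; apply: ereal_sup_ubound.
  exists [set` s]; first by split => //; exact: finite_seq.
  by rewrite -fsbig_seq// sumEFin.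
apply: ge_ereal_sup => _ [F [Ff _] <-].
by rewrite fsbig_finite//= sumEFin lee_fin h// fset_uniq.
Qed.

Section Isomorphism.
Variables (R : realType) (V : hilbertType R) (E : lmodType R[i]) (E0 : set E).
Variables (mul : E -> E -> E) (star : E -> E) (act : E -> V -> V).
Hypothesis coef : operator_coefficients E0 mul star act.
Variables (X : metricType R).
Hypothesis bgX : bounded_geometry X.
Hypothesis pA : propertyA X.

Local Notation elem := (@roe_elem R V E E0 act X).
Local Notation A := (@roe_algebra R V E E0 mul star act X).

(** The operator norm is a supremum over the unit ball while [reduced_le] is its homogeneous form;
    they are linked by scaling with [d^-1], and [d = 0] forces the vector to vanish. *)
Lemma l2opnorm_leP T (c : R) : elem T -> 0 <= c ->
  (l2opnorm (matrix_act act T) <= c%:E)%E <-> reduced_le act T c.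
Proof.
move=> hT c0; have [[S S0 ST] TE _] := hT.
split=> [Tc xi d d0 xid s us|Tc].
  have [d00|dn0] := eqVneq d 0.
    have xi0 x : xi x = 0.
      apply: rnorm_le0; rewrite -(@ler_pXn2r _ 2)// ?nnegrE ?rnorm_ge0//.
      by have := xid [:: x] isT; rewrite big_seq1 d00.
    rewrite big1 ?sqr_ge0// => x _.
    by rewrite (matrix_act_seq coef (E0 := E0) (s := [::]))// ?big_nil ?rnorm0 ?expr0n//;
        right.
  have dp : 0 < d by rewrite lt_neqAle eq_sym dn0.
  pose xi' x := (d^-1)%:C%C *: xi x.
  have scaled x : rnorm (matrix_act act T xi' x) = d^-1 * rnorm (matrix_act act T xi x).
    have Tx y : y \notin nbhd S x -> T x y = 0.
      by rewrite in_nbhd// -leNgt => /ST.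
    rewrite !(matrix_act_seq coef (E0 := E0) (s := nbhd S x)) ?nbhd_uniq//; try by move=> y
        /Tx; left.
    rewrite -(ger0_norm (x := d^-1)) ?invr_ge0// -rnormZr scaler_sumr; congr rnorm.
    by apply: eq_bigr => y _; rewrite (linfunZ (act_linear coef (TE x y))).
  have : (l2norm (fun x => rnorm (matrix_act act T xi' x)) <= c%:E)%E.
    apply: le_trans Tc; apply: ereal_sup_ubound; exists xi' => //=.
    apply/l2norm_leP => // t ut; rewrite expr1n.
    have -> : \sum_(x <- t) rnorm (xi' x) ^+ 2 = d^-1 ^+ 2 * \sum_(x <- t) rnorm (xi x) ^+
        2.
      rewrite mulr_sumr; apply: eq_bigr => x _.
      by rewrite rnormZr gtr0_norm ?invr_gt0// exprMn.
    by rewrite exprVn ler_pdivrMl ?exprn_gt0// mulr1 xid.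
  move=> /(l2norm_leP _ c0).1/(_ s us).
  under eq_bigr => x _ do rewrite scaled exprMn.
  by rewrite -mulr_sumr exprVn ler_pdivrMl ?exprn_gt0// -exprMn mulrC.
apply: ge_ereal_sup => _ [xi /= xi1 <-]; apply/l2norm_leP => // s us.
rewrite -[c]mulr1; apply: Tc us => // t ut.
by have /l2norm_leP := xi1; apply.
Qed.

(** The set [el] is a parameter because the two algebras phrase the bound on entries differently
    from [roe_elem]. The function [N T], the norm of [j T], is real-valued and inherits the
    C*-identity from the completion. *)
Lemma canonical_quotient_isomorphism (el : set (X -> X -> E)) : el = elem ->
  let A' := @StarAlg R (X -> X -> E) el (matrix_mul mul) (matrix_star star) in
  forall (Cmax C : cstarAlgType R) (jmax : A' -> Cmax) (j : A' -> C),
  cstar_completion (@max_norm R A') jmax ->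
  cstar_completion (fun T : A' => l2opnorm (matrix_act act T)) j ->
  exists lambda : Cmax -> C,
    unique (canonical_map jmax j) lambda /\ star_isomorphism lambda.
Proof.
move=> -> A' Cmax C jmax j jmaxC jC.
have elP (a : R[i]) (T U : A') : sa_elem T -> sa_elem U -> sa_elem (a *: T + U).
  exact: (roe_elemP coef).
have elM (T U : A') : sa_elem T -> sa_elem U -> sa_elem (sa_mul T U).
  exact: (roe_elem_mul coef bgX).
have elS (T : A') : sa_elem T -> sa_elem (sa_star T).
  exact: (roe_elem_star coef).
pose N (T : A') := rnorm (j T).
have N0 T : elem T -> 0 <= N T by move=> _; exact: rnorm_ge0.
have [_ jM jS jN _] := jC; have [_ _ _ jmaxN _] := jmaxC.
have N_red T : elem T -> reduced_le act T (N T).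
  by move=> hT; apply/(l2opnorm_leP hT); [exact: rnorm_ge0|rewrite -jN].
have red_N T c : elem T -> 0 <= c -> reduced_le act T c -> N T <= c.
  by move=> hT c0 Tc; rewrite -lee_fin jN//; exact/(l2opnorm_leP hT c0).
have N_star T : elem T -> N (mmul mul (mstar star T) T) = N T ^+ 2.
  move=> hT; rewrite /N -[mmul _ _ _]/(@sa_mul _ A' (@sa_star _ A' T) T).
  by rewrite jM ?jS ?rnorm_cstar_sqr//; exact: elS.
apply: (completion_isomorphism elP elM elS _ jmaxC jC) => T hT.
rewrite -jN//; apply/eqP; rewrite eq_le; apply/andP; split.
  apply: ge_ereal_sup => _ [W [pi [pi_rep ->]]].
  apply/opnorm_leP; [exact: (pi_linear pi_rep)|exact: N0|].
  exact: (representation_le_reduced coef bgX pA pi_rep N0 N_red red_N N_star hT).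
rewrite -jmaxN// lee_fin; apply: (red_N) => //; first exact: rnorm_ge0.
apply: (reduced_le_l2_act N_red hT); first exact: rnorm_ge0.
apply/opnorm_leP; [exact: (l2_act_linear coef bgX N_red hT)|exact: rnorm_ge0|].
rewrite jmaxN//; apply: ereal_sup_ubound.
exists (l2 X V), (@l2_act R V E act X); split => //.
exact: (l2_act_representation coef bgX N0 N_red).
Qed.

End Isomorphism.

Section Entries.
Variable R : realType.

Lemma scalar_coefficients : @operator_coefficients R (complex_line R) R[i]^o setT
  (fun a b => a * b) (fun a => (a : R[i])^*) (fun a b => a * b).
Proof.
split=> //.
- by move=> a x y v; rewrite mulrDl -[a *: x * v]/(a * x * v) -mulrA.
- by move=> x _ a u v; rewrite mulrDr -[x * (a *: u)]/(x * (a * u)) mulrCA.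
- by move=> x y v; rewrite mulrA.
- by move=> x _ u v; rewrite -[LHS]/(x * u * v^*) -[RHS]/(u * (x^* * v)^*) rmorphM/= conjCK
    mulrCA mulrA.
- by move=> x y /(_ 1); rewrite !mulr1.
- move=> x r _ xs r0 r1 xr.
  have xR : x = (complex.Re x)%:C%C.
    case: x xs xr => a b /= [bb] _; congr (_ +i* _)%C; lra.
  set a := complex.Re x in xR.
  have ar : `|a| <= r.
    have := xr 1; rewrite mulr1 xR -[X in rnorm X]mulr1 -[X in rnorm X]/(_ *: (1 : R[i]^o))
        rnormZr.
    by rewrite [rnorm _](_ : _ = 1) ?mulr1// /rnorm normr1.
  have a1 : 0 <= 1 - a by move: ar; rewrite ler_norml => /andP[]; lra.
  (* The required element is [1 - s]. It satisfies the same bound as [a], since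
     [|1 - s| (1 + s) = |a|]. *)
  pose s := Num.sqrt (1 - a).
  have ss : s ^+ 2 = 1 - a by rewrite sqr_sqrtr.
  have s0 : 0 <= s by rewrite sqrtr_ge0.
  have br : `|1 - s| <= r.
    move: ar; rewrite !ler_norml => /andP[h1 h2]; apply/andP; split; nra.
  exists (1 - s)%:C%C; split => //.
  - exact: conjc_real.
  - by move=> v; rewrite -[X in rnorm X]/(_ *: v) rnormZr ler_wpM2r ?rnorm_ge0.
  - rewrite xR -rmorphD -rmorphM -rmorphB/=; congr (_%:C%C).
    have -> : 1 - s + (1 - s) - (1 - s) * (1 - s) = 1 - s ^+ 2 by ring.
    by rewrite ss; ring.
Qed.

Lemma compact_coefficients (H : hilbertType R) : @operator_coefficients R H (H -> H)
  (@compact_operator R H H) (fun f g => f \o g) (@adjoint R H) (fun f v => f v).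
Proof.
have bounded f : compact_operator f -> bounded_operator (f : H -> H).
  move=> /compact_operatorP[fl /(totally_bounded_map_bounded fl)[c c0 fc]].
  by apply/bounded_operatorP; split=> //; exists c.
split=> //.
- apply/compact_operatorP; split; first by move=> a u v; rewrite scaler0 addr0.
  by move=> e e0; exists [:: 0] => v v1; exists 0; rewrite ?inE// subr0 rnorm0.
- move=> a f g /compact_operatorP[fl ft] /compact_operatorP[gl gt].
  apply/compact_operatorP; split; last exact: totally_bounded_map_lin.
  move=> k u v; rewrite -[LHS]/(a *: f (k *: u + v) + g (k *: u + v)).
  rewrite -[RHS]/(k *: (a *: f u + g u) + (a *: f v + g v)) fl gl !scalerDr.
  by rewrite !scalerA (mulrC a) addrACA.
- move=> f g fc gc; have /bounded_operatorP[gl [c c0 gb]] := bounded _ gc.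
  move: fc => /compact_operatorP[fl ft]; apply/compact_operatorP; split.
    by move=> k u v /=; rewrite gl fl.
  exact: totally_bounded_map_comp gb.
- move=> f fc; have fb := bounded _ fc; move: fc => /compact_operatorP[fl ft].
  apply/compact_operatorP; split; first exact: adjoint_linear.
  exact: totally_bounded_map_adjoint.
- by move=> f [].
- by move=> f fc; apply: adjointP; exact: bounded.
- by move=> f g fg; apply/funext.
- move=> f r fc fs r0 r1 fr; have fb := bounded _ fc.
  move: fc => /compact_operatorP[fl ft].
  have fsa : self_adjoint f by move=> u v; rewrite {2}(esym fs); exact: adjointP.
  have [b [bl bt bs br bf]] := operator_sqrt fl ft fsa r0 r1 fr.
  exists b; split => //; [exact/compact_operatorP|exact: adjoint_unique|].
  by apply/funext => v; exact: bf.
Qed.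

End Entries.

Theorem proposition1p3 (R : realType) (X : metricType R) (H : hilbertType R) :
  uniformly_discrete X -> bounded_geometry X -> propertyA X ->
  separable H -> infinite_dimensional H ->
  (forall (Cumax Cu : cstarAlgType R)
          (jmax : uniform_roe_alg X -> Cumax) (j : uniform_roe_alg X -> Cu),
     cstar_completion (@max_norm R (uniform_roe_alg X)) jmax ->
     cstar_completion (@uniform_roe_norm R X) j ->
     exists lambda : Cumax -> Cu,
       unique (canonical_map jmax j) lambda /\ star_isomorphism lambda)
  /\
  (forall (Cmax C : cstarAlgType R)
          (jmax : roe_alg X H -> Cmax) (j : roe_alg X H -> C),
     cstar_completion (@max_norm R (roe_alg X H)) jmax ->
     cstar_completion (@roe_norm R X H) j ->
     exists lambda : Cmax -> C,
       unique (canonical_map jmax j) lambda /\ star_isomorphism lambda).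
Proof.
move=> _ bgX pA _ _; split.
  apply: (canonical_quotient_isomorphism (scalar_coefficients R) bgX pA).
  apply/seteqP; split=> T.
    (* If [X] is empty the given [M] may be negative, whereas [roe_elem] asks for a nonnegative
       bound. *)
    move=> [TS [M TM]]; split=> //; exists (Order.max 0 M); first by rewrite le_max lexx.
    move=> x y v; rewrite -[X in rnorm X]/(T x y *: (v : R[i]^o)) rnormZ.
    by rewrite ler_wpM2r ?rnorm_ge0// le_max TM orbT.
  move=> [TS _ [M M0 TM]]; split=> //; exists M => x y.
  have := TM x y 1; rewrite [X in rnorm X]mulr1.
  by rewrite [X in _ * X](_ : _ = 1) ?mulr1// /rnorm normr1.
apply: (canonical_quotient_isomorphism (compact_coefficients H) bgX pA).
apply/seteqP; split=> T.
  move=> [TS TE [M TM]]; split=> //; exists (Order.max 0 M); first by rewrite le_max lexx.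
  move=> x y; apply/opnorm_leP; rewrite ?le_max ?lexx//; first by case: (TE x y).
  by rewrite (le_trans (TM x y))// lee_fin le_max lexx orbT.
move=> [TS TE [M M0 TM]]; split=> //; exists M => x y.
by apply/opnorm_leP => //; case: (TE x y).
Qed.
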